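(* Let $b\ge 2$, $\beta\ge 0$, $h\in\mathbb{R}$, and let $\tau\in\{\pm1\}^{\mathbb{T}^b}$ be a boundary condition. Suppose that at least one of the following holds: (i) $\tau$ is arbitrary, and either $\beta<\beta_1$ (with $h$ arbitrary), or $|h|>h_c(\beta)$ (with $\beta$ arbitrary); (ii) $\tau$ is the $(+)$-boundary condition, i.e. $\tau\equiv +1$, and $\beta,h$ are arbitrary. Then the spectral gap of the Glauber dynamics for the Ising model on complete $b$-ary trees with boundary condition $\tau$ is $\Omega(1)$: there exists a constant $C>0$ such that $c_{\mathrm{gap}}(\mu_T^\tau)\ge 1/C$ for every finite complete subtree $T$ of $\mathbb{T}^b$.
   Context: Setting. Fix an integer $b\ge2$, $\beta\ge0$ (inverse temperature) and $h\in\mathbb{R}$ (external field). $\mathbb{T}^b$ is the infinite rooted tree in which every vertex has $b$ children. $T$ denotes a finite complete subtree: for some vertex $r$ (the root of $T$) and some $m\ge0$, $T$ consists of $r$ and all its descendants at distance at most $m$ from $r$; $n=|T|=(b^{m+1}-1)/(b-1)$. $\partial T$ is the set of children in $\mathbb{T}^b$ of the leaves of $T$ (so $|\partial T|=b^{m+1}$); only edges inside $T\cup\partial T$ are considered. For $A\subseteq T$, $\partial A$ is the set of vertices of $(T\cup\partial T)\setminus A$ adjacent to $A$, and $E(A\cup\partial A)$ is the set of edges with both endpoints in $A\cup\partial A$. A boundary condition is a configuration $\tau\in\{\pm1\}^{\mathbb{T}^b}$; $\Omega=\Omega_T^\tau$ is the set of $\sigma\in\{\pm1\}^{T\cup\partial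 T}$ agreeing with $\tau$ on $\partial T$. For $\eta\in\Omega$ and $A\subseteq T$, $\mu_A^\eta$ is the probability measure on $\Omega$ with $\mu_A^\eta(\sigma)\propto\exp[\beta(\sum_{xy\in E(A\cup\partial A)}\sigma_x\sigma_y+h\sum_{x\in A}\sigma_x)]$ if $\sigma$ agrees with $\eta$ outside $A$, and $\mu_A^\eta(\sigma)=0$ otherwise. $\mu=\mu_T^\tau$ is the case $A=T$. $\mu_A^\eta(f)$ is the expectation of $f:\Omega\to\mathbb{R}$, $\mathrm{Var}_A^\eta(f)=\mu_A^\eta(f^2)-\mu_A^\eta(f)^2$; viewed as functions of $\eta$ these are written $\mu_A(f),\mathrm{Var}_A(f)$. $\mathrm{Var}$ without subscripts is with respect to $\mu$. Spectral gap. The (heat-bath) Glauber dynamics has generator $(\mathcal{L}f)(\sigma)=\sum_{x\in T}\mu^\sigma_{\{x\}}(\sigma^x)[f(\sigma^x)-f(\sigma)]$, where $\sigma^x$ is $\sigma$ with the spin at $x$ flipped; its Dirichlet form is $\mathcal{D}(f)=\sum_{x\in T}\mu(\mathrm{Var}_{\{x\}}(f))$, and $c_{\mathrm{gap}}(\mu)=\inf_f \mathcal{D}(f)/\mathrm{Var}(f)$ over non-constant $f:\Omega\to\mathbb{R}$. Critical values. $\beta_0=\frac12\log\frac{b+1}{b-1}$ and $\beta_1=\frac12\log\frac{\sqrt b+1}{\sqrt b-1}$. For $\beta>\beta_0$, $h_c(\beta)>0$ is the critical field such that the infinite-volume Ising Gibbs measure on $\mathbb{T}^b$ with parameters $(\beta,h)$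 is non-unique when $|h|\le h_c(\beta)$ and unique when $|h|>h_c(\beta)$; for $\beta\le\beta_0$ (where the Gibbs measure is unique for all $h$) $h_c(\beta)=0$. *)

(* Defs.v *)
From mathcomp Require Import all_boot all_order all_algebra.
From mathcomp Require Import all_classical all_reals all_analysis.

Set Implicit Arguments.
Unset Strict Implicit.
Unset Printing Implicit Defensive.

Import Order.TTheory GRing.Theory Num.Theory.

Local Open Scope classical_set_scope.
Local Open Scope ring_scope.

(* Spins +1 and -1 are encoded by [true] and [false]. *)
Definition spin (R : realType) (s : bool) : R := if s then 1 else -1.

(* The Ising model on a finite graph. The relation [e] lists every edge once,
   in one orientation; on trees it goes from the parent to the child. *)
Section FiniteIsing.
Variables (R : realType) (V : finType) (e : rel V) (beta h : R).
Implicit Types (A T : {set V}) (sigma eta tau : {ffun V -> bool}).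
Implicit Types f : {ffun V -> bool} -> R.

Definition boundary A : {set V} :=
  [set y | (y \notin A) && [exists x in A, e x y || e y x]]%SET.

Definition agree_off A eta sigma : bool :=
  [forall x, (x \notin A) ==> (sigma x == eta x)].

Definition ising_weight A sigma : R :=
  let AdA := (A :|: boundary A)%SET in
  expR (beta * (\sum_(x in AdA) \sum_(y in AdA | e x y)
                   spin R (sigma x) * spin R (sigma y)
                + h * \sum_(x in A) spin R (sigma x))).

Definition partition_fun A eta : R :=
  \sum_(sigma | agree_off A eta sigma) ising_weight A sigma.

(* mu_A^eta(sigma) *)
Definition gibbs A eta sigma : R :=
  if agree_off A eta sigma then ising_weight A sigma / partition_fun A eta
  else 0.

Definition gibbs_mean A eta f : R := \sum_sigma gibbs A eta sigma * f sigma.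

Definition gibbs_var A eta f : R :=
  gibbs_mean A eta (fun sigma => f sigma ^+ 2) - gibbs_mean A eta f ^+ 2.

Definition dirichlet T tau f : R :=
  \sum_(x in T) gibbs_mean T tau (fun eta => gibbs_var [set x]%SET eta f).

(* A function on Omega_T^tau is given by any extension of it to all
   configurations: only its values on [agree_off T tau] are ever used. *)
Definition nonconstant_on_Omega T tau f : Prop :=
  exists sigma sigma', [/\ agree_off T tau sigma, agree_off T tau sigma' &
                           f sigma <> f sigma'].

Definition spectral_gap T tau : R :=
  inf [set dirichlet T tau f / gibbs_var T tau f
      | f in nonconstant_on_Omega T tau].

End FiniteIsing.

(* The vertices of T^b are the finite words on b letters: the root is [::],
   the children of x are the i :: x, and the descendants of r at distance k
   from r are the w ++ r with size w = k. *)
Definition vertex (b : nat) : Type := seq 'I_b.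

(* The words w of size at most m + 1 stand for the vertices w ++ r of
   T \cup \partial T, where T is the complete subtree of depth m rooted at r;
   r itself is the empty word. *)
Definition tree_vertex (b m : nat) : finType := m.+1.-bseq 'I_b.

Definition tree_edge (b m : nat) : rel (tree_vertex b m) :=
  fun x y : m.+1.-bseq 'I_b =>
    (0 < size y)%N && (behead y == x :> seq 'I_b).

Definition tree_interior (b m : nat) : {set tree_vertex b m} :=
  [set x : m.+1.-bseq 'I_b | (size x <= m)%N]%SET.

Definition tree_restrict (b m : nat) (r : vertex b) (tau : vertex b -> bool) :
    {ffun tree_vertex b m -> bool} :=
  [ffun w : m.+1.-bseq 'I_b => tau (w ++ r)].

Definition tree_gap (R : realType) (b : nat) (beta h : R)
    (tau : vertex b -> bool) (r : vertex b) (m : nat) : R :=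
  spectral_gap (@tree_edge b m) beta h (tree_interior b m)
               (tree_restrict m r tau).

(* Infinite-volume Gibbs measures: probability measures on {+1,-1}^{T^b}, with
   the product sigma-algebra, satisfying the DLR equations. *)
Definition cylinders (b : nat) : set (set (vertex b -> bool)) :=
  [set B | exists (x : vertex b) (s : bool), B = [set eta | eta x = s]].

Definition tree_config (b : nat) := g_sigma_algebraType (@cylinders b).

Definition splice (b m : nat) (sigma : {ffun tree_vertex b m -> bool})
    (eta : tree_config b) : tree_config b :=
  fun x => oapp sigma (eta x) (insub x : option (m.+1.-bseq 'I_b)).

(* Every finite set of vertices of T^b lies in some ball [tree_interior b m]
   around the root, and its neighbours are then in [tree_vertex b m]. *)
Definition infinite_gibbs (R : realType) (b : nat) (beta h : R)
    (P : probability (tree_config b) R) : Prop :=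
  forall (m : nat) (A : {set tree_vertex b m}), A \subset tree_interior b m ->
  forall B : set (tree_config b), measurable B ->
    P B = (\int[P]_eta
             (gibbs_mean (@tree_edge b m) beta h A (tree_restrict m [::] eta)
                (fun sigma => \1_B (splice sigma eta)))%:E)%E.

Definition gibbs_nonunique (R : realType) (b : nat) (beta h : R) : Prop :=
  exists P Q : probability (tree_config b) R,
    [/\ infinite_gibbs beta h P, infinite_gibbs beta h Q &
        exists2 B : set (tree_config b), measurable B & P B <> Q B].

Definition beta0 (R : realType) (b : nat) : R :=
  2^-1 * ln ((b%:R + 1) / (b%:R - 1)).

Definition beta1 (R : realType) (b : nat) : R :=
  2^-1 * ln ((Num.sqrt b%:R + 1) / (Num.sqrt b%:R - 1)).

(* The supremum is taken in \bar R so that it carries no junk value;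
   [critical_fieldE] relates it to the threshold property. *)
Definition critical_field (R : realType) (b : nat) (beta : R) : \bar R :=
  if beta <= beta0 R b then 0%E
  else ereal_sup [set (`|h|)%:E | h in gibbs_nonunique b beta].

Lemma critical_fieldE (R : realType) (b : nat) (beta hc : R) :
  beta0 R b < beta -> 0 < hc ->
  (forall h : R, gibbs_nonunique b beta h <-> `|h| <= hc) ->
  critical_field b beta = hc%:E.
Proof.
move=> lt_beta hc_gt0 hcP; rewrite /critical_field leNgt lt_beta /=.
apply/eqP; rewrite eq_le; apply/andP; split.
  by apply: ge_ereal_sup => _ [h /hcP le_h <-]; rewrite lee_fin.
apply: ereal_sup_ubound; exists hc; last by rewrite gtr0_norm.
by apply/hcP; rewrite gtr0_norm.
Qed.

(* Main.v *)
(* The route is that of Martinelli, Sinclair and Weitz. On a tree the Gibbs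
   measure is a Markov chain run from the root, so one may integrate out the
   spins one at a time, children before parents: the variance of f splits
   exactly into one term V_x per vertex x, the variance due to the spin at x of
   the mean of f over what lies below. To bound V_x, let B be the l levels
   starting at x, and let g be the mean of f given what is not below B and the
   level L following B. Setting the spins of B to + in g costs only local
   Dirichlet terms, as |B| is bounded, and leaves a function of L. The squared
   maximal correlation between x and L is at most a constant times
   (b kappa gamma)^l: kappa bounds the influence of a parent on a child, so that
   of x on L is at most (b kappa)^l, while by Bayes' rule one spin of L moves
   the conditional law of x by at most a constant times gamma^l, with
   gamma = tanh beta. Hence V_x is at most a local term plus a small multiple of
   the sum of the V_y over y in B and L, and summing over x gives
   Var f <= C D(f) as soon as b kappa gamma < 1.

   For beta < beta_1 take kappa = gamma. In the other cases kappa only matters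
   far from the leaves, and any kappa > 1/b is admissible there: the ratio of the
   weights of + and - converges to a fixed point of the recursion phi which is
   approached from above, so the slope of phi, which is b times the influence, is
   at most 1 there. For an arbitrary boundary condition this needs the largest
   and the smallest limits to agree; if they do not, the two homogeneous chains
   they define are distinct infinite-volume Gibbs measures, so h is at most the
   critical field. *)

From HB Require Import structures.
Require Import Defs.
From mathcomp Require Import all_boot all_order all_algebra.
From mathcomp Require Import all_classical all_reals all_analysis.
From mathcomp Require Import measurable_realfun.
From mathcomp Require Import ring lra zify.

Set Implicit Arguments.
Unset Strict Implicit.
Unset Printing Implicit Defensive.

Import Order.TTheory GRing.Theory Num.Theory numFieldNormedType.Exports.
Local Open Scope ring_scope.

(** The small multiple has to beat an overlap: a vertex lies in about l of the sets B and L, so the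
    multiple must be below a constant over l. The geometric decay of (b kappa gamma)^l provides
    this, and the terms V_y are absorbed into Var f. As kappa can be taken close to 1/b, the
    condition b kappa gamma < 1 then amounts to gamma < 1, true at every temperature. In the last M
    levels, where kappa bounds nothing, the block is lengthened down to the leaves: L is empty and
    V_x is purely local. Correlation is a forward influence times a backward one because the best
    predictor psi of the spin at x has a variance proportional to the effect of x on the conditional
    mean of psi: Bayes' rule bounds how one spin of L moves psi, kappa bounds how x moves the spins
    of L. All finite-volume integrals are iterated two-point averages over total configurations.
    Measure theory enters only for uniqueness: the infinite chain is the image of a uniform
    variable, and both sides of the DLR equations are measures compared on events of finite
    depth. *)

Section Update.
Variable V : eqType.
Implicit Types (x y z : V) (s t : bool) (sigma : V -> bool).

Definition upd sigma x t : V -> bool := fun z => if z == x then t else sigma z.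

Lemma updxx sigma x t : upd sigma x t x = t.
Proof. by rewrite /upd eqxx. Qed.

Lemma upd_neq sigma x t y : y != x -> upd sigma x t y = sigma y.
Proof. by rewrite /upd => /negPf ->. Qed.

Lemma upd_upd sigma x s t : upd (upd sigma x s) x t = upd sigma x t.
Proof. by apply/funext => z; rewrite /upd; case: eqP. Qed.

Lemma updC sigma x y s t :
  x != y -> upd (upd sigma x s) y t = upd (upd sigma y t) x s.
Proof.
move=> neq_xy; apply/funext => z; rewrite /upd.
by case: eqP => // ->; case: eqP => // eq_yx; rewrite eq_yx eqxx in neq_xy.
Qed.

Lemma upd_id sigma x : upd sigma x (sigma x) = sigma.
Proof. by apply/funext => z; rewrite /upd; case: eqP => // ->. Qed.

Definition indep (T : Type) x (f : (V -> bool) -> T) :=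
  forall sigma t, f (upd sigma x t) = f sigma.

Lemma indep_updx (T : Type) x t (f : (V -> bool) -> T) :
  indep x (fun sigma => f (upd sigma x t)).
Proof. by move=> sigma s; rewrite upd_upd. Qed.

End Update.

(** * Iterated averages and variances of a tree-indexed chain *)

Section Chain.
Variables (R : realFieldType) (V : eqType).
(* [p x s] is the probability of the spin + at [x] when the parent of [x] has
   spin [s]. *)
Variables (par : V -> V) (p : V -> bool -> R).
Implicit Types (x y z : V) (l : seq V) (a : pred V) (s t : bool).
Implicit Types (sigma : V -> bool) (f g h : (V -> bool) -> R).

Definition prob x t sigma : R :=
  if t then p x (sigma (par x)) else 1 - p x (sigma (par x)).

Definition avg x f : (V -> bool) -> R := fun sigma =>
  prob x true sigma * f (upd sigma x true)
  + prob x false sigma * f (upd sigma x false).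

(** The last vertex of [l] is integrated first; with parents listed before children, each spin is
    averaged while that of its parent is still fixed. *)
Definition avgs l f : (V -> bool) -> R := foldr avg f l.

Definition dif x f : (V -> bool) -> R :=
  fun sigma => f (upd sigma x true) - f (upd sigma x false).

Definition sqf f : (V -> bool) -> R := fun sigma => f sigma ^+ 2.

Definition var1 x f : (V -> bool) -> R :=
  fun sigma => avg x (sqf f) sigma - avg x f sigma ^+ 2.

Definition vars l f : (V -> bool) -> R :=
  fun sigma => avgs l (sqf f) sigma - avgs l f sigma ^+ 2.

Lemma var1E x f sigma :
  var1 x f sigma = prob x true sigma * prob x false sigma * dif x f sigma ^+ 2.
Proof. by rewrite /var1 /avg /sqf /dif /prob; ring. Qed.

Lemma avgs_cat l1 l2 f : avgs (l1 ++ l2) f = avgs l1 (avgs l2 f).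
Proof. by rewrite /avgs foldr_cat. Qed.

Lemma avgD x f g :
  avg x (fun sigma => f sigma + g sigma) =
  (fun sigma => avg x f sigma + avg x g sigma).
Proof. by apply/funext => sigma; rewrite /avg; ring. Qed.

Lemma avgZ x (k : R) f :
  avg x (fun sigma => k * f sigma) = (fun sigma => k * avg x f sigma).
Proof. by apply/funext => sigma; rewrite /avg; ring. Qed.

Lemma avgsD l f g :
  avgs l (fun sigma => f sigma + g sigma) =
  (fun sigma => avgs l f sigma + avgs l g sigma).
Proof. by elim: l => //= x l ->; rewrite avgD. Qed.

Lemma avgsZ l (k : R) f :
  avgs l (fun sigma => k * f sigma) = (fun sigma => k * avgs l f sigma).
Proof. by elim: l => //= x l ->; rewrite avgZ. Qed.

Lemma avgsB l f g :
  avgs l (fun sigma => f sigma - g sigma) =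
  (fun sigma => avgs l f sigma - avgs l g sigma).
Proof.
have -> : (fun sigma => f sigma - g sigma) =
  (fun sigma => f sigma + (-1) * g sigma).
  by apply/funext => sigma; rewrite mulN1r.
by rewrite avgsD avgsZ; apply/funext => sigma; rewrite mulN1r.
Qed.

Lemma avgs_sum (I : Type) (r : seq I) (P : pred I) l
    (F : I -> (V -> bool) -> R) :
  avgs l (fun sigma => \sum_(i <- r | P i) F i sigma) =
  (fun sigma => \sum_(i <- r | P i) avgs l (F i) sigma).
Proof.
elim: r => [|i r IH].
  under eq_fun do rewrite big_nil.
  have := avgsZ l 0 (fun=> 0); under eq_fun do rewrite mul0r.
  by move=> ->; apply/funext => sigma; rewrite big_nil mul0r.
under eq_fun do rewrite big_cons.
case Pi: (P i); last by rewrite IH; apply/funext => s; rewrite big_cons Pi.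
by rewrite avgsD IH; apply/funext => sigma; rewrite big_cons Pi.
Qed.

Lemma avg_upd_parent x y t f sigma : par x != y ->
  avg x f (upd sigma y t) =
  prob x true sigma * f (upd (upd sigma y t) x true)
  + prob x false sigma * f (upd (upd sigma y t) x false).
Proof. by move=> neq; rewrite /avg /prob upd_neq. Qed.

Lemma avg_indep x f : indep x f -> avg x f = f.
Proof. by move=> fx; apply/funext => s; rewrite /avg !fx /prob; ring. Qed.

Lemma avgs_indep l f : {in l, forall x, indep x f} -> avgs l f = f.
Proof.
elim: l => //= x l IH fl.
rewrite IH ?avg_indep //; first by apply: fl; rewrite mem_head.
by move=> y yl; apply: fl; rewrite in_cons yl orbT.
Qed.

Lemma avg_const x (k : R) : avg x (fun=> k) = (fun=> k).
Proof. exact: avg_indep. Qed.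

Lemma avgs_const l (k : R) : avgs l (fun=> k) = (fun=> k).
Proof. exact: avgs_indep. Qed.

Lemma avgM_indep x f g : indep x g ->
  avg x (fun sigma => g sigma * f sigma) = (fun sigma => g sigma * avg x f sigma).
Proof. by move=> gx; apply/funext => sigma; rewrite /avg !gx; ring. Qed.

Lemma avgsM_indep l f g : {in l, forall x, indep x g} ->
  avgs l (fun sigma => g sigma * f sigma) =
  (fun sigma => g sigma * avgs l f sigma).
Proof.
elim: l => //= x l IH gl.
rewrite IH ?avgM_indep //; first by apply: gl; rewrite mem_head.
by move=> y yl; apply: gl; rewrite in_cons yl orbT.
Qed.

Lemma indep_prob x y t : par x != y -> indep y (prob x t).
Proof. by move=> neq sigma s; rewrite /prob upd_neq. Qed.

Lemma avgC x y f : x != y -> par x != y -> par y != x ->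
  avg x (avg y f) = avg y (avg x f).
Proof.
move=> neq nxy nyx; apply/funext => sigma.
rewrite -[LHS]/(_ * avg y f _ + _ * avg y f _).
rewrite -[RHS]/(_ * avg x f _ + _ * avg x f _).
by rewrite !avg_upd_parent // !(updC _ _ _ neq); ring.
Qed.

Definition unrelated x y := [&& x != y, par x != y & par y != x].

Lemma avg_avgsC x l f : all (unrelated x) l ->
  avg x (avgs l f) = avgs l (avg x f).
Proof.
by elim: l f => //= y l IH f /andP[/and3P[? ? ?] /IH <-]; rewrite avgC.
Qed.

Lemma dif_avg x y f : x != y -> par y != x ->
  dif x (avg y f) = avg y (dif x f).
Proof.
move=> neq nyx; apply/funext => sigma.
by rewrite /dif !avg_upd_parent // !(updC _ _ _ neq) /avg; ring.
Qed.

Lemma dif_avgs x l f : {in l, forall y, x != y /\ par y != x} ->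
  dif x (avgs l f) = avgs l (dif x f).
Proof.
elim: l => //= y l IH nl.
have [nxy nyx] := nl y (mem_head _ _).
by rewrite dif_avg // IH // => z zl; apply: nl; rewrite in_cons zl orbT.
Qed.

(** * Orders in which parents come first *)

Fixpoint ordered l :=
  if l is x :: l' then
    [&& x \notin l', par x != x, par x \notin l' & ordered l']
  else true.

Lemma ordered_filter a l : ordered l -> ordered (seq.filter a l).
Proof.
elim: l => //= x l IH /and4P[xl pxx pxl /IH ol].
by case: (a x) => //=; rewrite !mem_filter !negb_and xl pxx pxl !orbT.
Qed.

Lemma ordered_catr l1 l2 : ordered (l1 ++ l2) -> ordered l2.
Proof. by elim: l1 => //= x l1 IH /and4P[_ _ _ /IH]. Qed.

Lemma ordered_uniq l : ordered l -> uniq l.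
Proof. by elim: l => //= x l IH /and4P[-> _ _ /IH]. Qed.

(** Parents outside [l] are exempt, so that a block hanging below a vertex [x] counts as closed
    although the parent of [x] is not in it. *)
Definition par_closed a l := {in l, forall y, a y -> par y \in l -> a (par y)}.

Lemma par_closed_behead a x l : par_closed a (x :: l) -> par_closed a l.
Proof.
by move=> c y yl ay py; apply: c => //; rewrite in_cons ?yl ?py orbT.
Qed.

Lemma unrelated_filter a x l : ordered (x :: l) -> par_closed a (x :: l) ->
  ~~ a x -> all (unrelated x) (seq.filter a l).
Proof.
move=> /= /and4P[xl pxx pxl ol] cl ax; apply/allP => y.
rewrite mem_filter => /andP[ay yl]; apply/and3P; split.
- by apply: contraNneq xl => ->.
- by apply: contraNneq pxl => ->.
- apply: contraNneq ax => e; rewrite -e; apply: cl => //.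
    by rewrite in_cons yl orbT.
  by rewrite e mem_head.
Qed.

(** A vertex outside [a] has no child in [a], so its average commutes with those of the later
    vertices of [a] and can be moved inside them. *)
Lemma avgs_split a l f : ordered l -> par_closed a l ->
  avgs l f = avgs (seq.filter a l) (avgs (seq.filter (predC a) l) f).
Proof.
elim: l => //= x l IH ol cl; have /and4P[_ _ _ ol'] := ol.
rewrite (IH ol' (par_closed_behead cl)).
case: ifPn => /= ax //.
by rewrite avg_avgsC //; apply: unrelated_filter.
Qed.

(** * Positivity and conditional variances *)

Section Bounds.
Variable c : R.
Hypotheses (c_gt0 : 0 < c) (p_bnd : forall x s, c <= p x s <= 1 - c).

Lemma prob_ge x t sigma : c <= prob x t sigma.
Proof.
by have := p_bnd x (sigma (par x)); rewrite /prob; case: t => /andP[]; lra.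
Qed.

Lemma prob_ge0 x t sigma : 0 <= prob x t sigma.
Proof. by apply: le_trans (prob_ge _ _ _); apply: ltW. Qed.

Lemma prob_le1 x t sigma : prob x t sigma <= 1.
Proof.
have := p_bnd x (sigma (par x)); move: c_gt0.
by rewrite /prob; case: t => ? /andP[]; lra.
Qed.

Lemma probT_F x sigma : prob x true sigma + prob x false sigma = 1.
Proof. by rewrite /prob; ring. Qed.

Lemma ler_avg x f g : (forall sigma, f sigma <= g sigma) ->
  forall sigma, avg x f sigma <= avg x g sigma.
Proof.
by move=> fg sigma; rewrite /avg lerD // ler_wpM2l // prob_ge0.
Qed.

Lemma ler_avgs l f g : (forall sigma, f sigma <= g sigma) ->
  forall sigma, avgs l f sigma <= avgs l g sigma.
Proof. by move=> fg; elim: l => //= x l IH; apply: ler_avg. Qed.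

Lemma avgs_ge0 l f : (forall sigma, 0 <= f sigma) ->
  forall sigma, 0 <= avgs l f sigma.
Proof. by move=> f0 s; have := ler_avgs l f0 s; rewrite avgs_const. Qed.

Lemma var1_ge0 x f sigma : 0 <= var1 x f sigma.
Proof. by rewrite var1E mulr_ge0 ?sqr_ge0 // mulr_ge0 // prob_ge0. Qed.

(** The weights at [x] do not involve [y], and [dif x] commutes with [avg y]; what remains is
    Jensen's inequality for the square of [dif x f]. *)
Lemma var1_avg x y f : unrelated x y ->
  forall sigma, var1 x (avg y f) sigma <= avg y (var1 x f) sigma.
Proof.
move=> /and3P[nxy npx npy] sigma; rewrite var1E dif_avg //.
under [X in _ <= avg y X _]funext do rewrite var1E.
rewrite avgM_indep; last first.
  by move=> s t; rewrite !(indep_prob _ npx).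
apply: ler_wpM2l; first by rewrite mulr_ge0 // prob_ge0.
by have := var1_ge0 y (dif x f) sigma; rewrite /var1 subr_ge0.
Qed.

Lemma var1_avgs x l f : all (unrelated x) l ->
  forall sigma, var1 x (avgs l f) sigma <= avgs l (var1 x f) sigma.
Proof.
elim: l f => //= y l IH f /andP[xy xl] sigma.
apply: le_trans (var1_avg _ xy _) _; apply: ler_avg => s; exact: IH.
Qed.

(** Law of total variance, conditioning on the spin at [x]. *)
Lemma vars_cons x l f sigma :
  vars (x :: l) f sigma = avg x (vars l f) sigma + var1 x (avgs l f) sigma.
Proof.
rewrite /vars /var1 /= /avg /sqf; ring.
Qed.

Lemma vars_ge0 l f sigma : 0 <= vars l f sigma.
Proof.
elim: l f sigma => [|x l IH] f sigma; first by rewrite /vars /= /sqf subrr.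
rewrite vars_cons addr_ge0 ?var1_ge0 //.
by have := ler_avg x (IH f) sigma; rewrite avg_const.
Qed.

(* The sum over [y] in [l] of [w y] times the mean of the variance of the spin
   at [y] under the law that integrates out what comes after [y] in [l]. *)
Fixpoint wvar (w : V -> R) l f : (V -> bool) -> R :=
  if l is y :: l' then
    fun sigma => w y * var1 y (avgs l' f) sigma + avg y (wvar w l' f) sigma
  else fun=> 0.

Lemma vars_wvar l f sigma : vars l f sigma = wvar (fun=> 1) l f sigma.
Proof.
elim: l sigma => [|x l IH] sigma; first by rewrite /vars /= /sqf subrr.
by rewrite vars_cons /= mul1r addrC; congr (_ + _); rewrite /avg !IH.
Qed.

Lemma wvar_cat w l1 l2 f sigma : (forall y, 0 <= w y) ->
  avgs l1 (wvar w l2 f) sigma <= wvar w (l1 ++ l2) f sigma.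
Proof.
move=> w0; elim: l1 sigma => //= x l1 IH sigma.
rewrite -[leLHS]add0r; apply: lerD; first by rewrite mulr_ge0 // var1_ge0.
exact: ler_avg.
Qed.

Lemma wvar_sum (I : Type) (r : seq I) (w : I -> V -> R) l f sigma :
  \sum_(i <- r) wvar (w i) l f sigma =
  wvar (fun y => \sum_(i <- r) w i y) l f sigma.
Proof.
elim: l sigma => [|x l IH] sigma /=; first by rewrite big1.
rewrite big_split /= mulr_suml; congr (_ + _).
by rewrite /avg -!IH !mulr_sumr -big_split.
Qed.

Lemma wvar_le (k : R) w l f sigma : {in l, forall y, w y <= k} ->
  wvar w l f sigma <= k * vars l f sigma.
Proof.
rewrite vars_wvar.
elim: l sigma => [|x l IH] sigma wk /=; first by rewrite mulr0.
rewrite mul1r [leRHS]mulrDr; apply: lerD.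
  by rewrite ler_wpM2r ?var1_ge0 // wk // mem_head.
have := congr1 (@^~ sigma) (avgZ x k (wvar (fun=> 1) l f)).
move=> /= <-; apply: ler_avg => s; apply: IH => y yl.
by apply: wk; rewrite in_cons yl orbT.
Qed.

(** Passes from the chain restricted to a block back to the terms of the full chain. A vertex of [a]
    contributes the same term on both sides; averaging over a vertex outside [a] can only lower the
    variance due to the others. *)
Lemma vars_avgs_filter a l f sigma : ordered l -> par_closed a l ->
  vars (seq.filter a l) (avgs (seq.filter (predC a) l) f) sigma <=
  wvar (fun y => (a y)%:R) l f sigma.
Proof.
elim: l sigma => [|x l IH] sigma ol cl; first by rewrite /vars /= /sqf subrr.
have /= /and4P[_ _ _ ol'] := ol; have cl' := par_closed_behead cl.
rewrite /=; case: ifPn => /= ax.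
  rewrite vars_cons addrC mul1r -avgs_split // lerD2l.
  by apply: ler_avg => s; apply: IH.
rewrite mul0r add0r.
have un := unrelated_filter ol cl ax; set wl := seq.filter a l in un *.
set g := avgs _ f.
apply: (@le_trans _ _ (avg x (vars wl g) sigma)); last first.
  by apply: ler_avg => s; apply: IH.
(* Once the averages are commuted, this inequality rearranges into [vars wl (avg x g) sigma <= avg x
   (vars wl g) sigma]: the same four terms, grouped differently. *)
have := @var1_avgs x wl g un sigma.
rewrite /vars /var1 -!avg_avgsC //.
have -> : avgs wl (fun eta => avg x (sqf g) eta - avg x g eta ^+ 2) sigma =
    avg x (avgs wl (sqf g)) sigma - avgs wl (sqf (avg x g)) sigma.
  by rewrite avgsB avg_avgsC.
have -> : avg x (fun eta => avgs wl (sqf g) eta - avgs wl g eta ^+ 2) sigma =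
   avg x (avgs wl (sqf g)) sigma - avg x (sqf (avgs wl g)) sigma.
  by rewrite /avg /sqf; ring.
lra.
Qed.

(** * Replacing spins by + *)

Definition set_plus z sigma : V -> bool := upd sigma z true.

(** Forcing + at [z] alters only the laws of its children. Their probabilities lie between [c] and
    1, so each child costs a factor [c^-1] in the density. *)
Lemma avgs_set_plus z l h sigma : z \notin l -> (forall eta, 0 <= h eta) ->
  avgs l (fun eta => h (set_plus z eta)) sigma <=
  c^-1 ^+ count (fun y => par y == z) l * avgs l h (set_plus z sigma).
Proof.
move=> + h0; elim: l sigma => [|y l IH] sigma /=; first by rewrite mul1r.
rewrite in_cons negb_or eq_sym => /andP[nyz zl].
apply: le_trans (ler_avg y (fun eta => IH eta zl) sigma) _.
rewrite avgZ /= addnC exprD -mulrA ler_wpM2l //.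
  by rewrite exprn_ge0 // invr_ge0 ltW.
rewrite /set_plus /avg !(updC _ _ _ nyz).
have [epy|npy] := eqVneq (par y) z; last by rewrite mul1r /prob upd_neq.
rewrite expr1 mulrDr; apply: lerD; rewrite mulrA ler_wpM2r ?avgs_ge0 //;
  apply: le_trans (prob_le1 _ _ _) _; rewrite ler_pdivlMl // mulr1 prob_ge //.
Qed.

(** The extra factor [c^-1] is for [z] itself, whose spin is + with probability at least [c]. *)
Lemma avgs_set_plus_mem z l h sigma : ordered l -> z \in l ->
  (forall eta, 0 <= h eta) ->
  avgs l (fun eta => h (set_plus z eta)) sigma <=
  c^-1 ^+ (count (fun y => par y == z) l).+1 * avgs l h sigma.
Proof.
move=> ol + h0; elim: l sigma ol => //= y l IH sigma /and4P[yl pyy pyl ol].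
have ci : 1 <= c^-1.
  rewrite -div1r ler_pdivlMr // mul1r.
  by have := p_bnd z true => /andP[]; move: c_gt0; lra.
have c0 n : 0 <= c^-1 ^+ n by rewrite exprn_ge0 // invr_ge0 ltW.
rewrite in_cons eq_sym; have [eyz _|nyz /= zl] := eqVneq y z.
  rewrite -eyz (negPf pyy) add0n exprSr -mulrA.
  have le1 eta : avgs l (fun eta0 => h (set_plus y eta0)) eta <=
      c^-1 ^+ count (fun z => par z == y) l * avgs l h (set_plus y eta).
    exact: avgs_set_plus.
  apply: le_trans (ler_avg y le1 sigma) _.
  rewrite avgZ /= ler_wpM2l // avg_indep; last exact: indep_updx.
  rewrite ler_pdivlMl // /avg -[leLHS]addr0 lerD //.
    by rewrite ler_wpM2r ?avgs_ge0 ?prob_ge.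
  by rewrite mulr_ge0 ?prob_ge0 ?avgs_ge0.
apply: le_trans (ler_avg y (fun eta => IH eta ol zl) sigma) _.
rewrite avgZ /= ler_wpM2r ?(ler_avg _ _) //.
  have := ler_avg y (avgs_ge0 l h0) sigma; rewrite avg_const; exact.
by rewrite ler_weXn2l // ltnS leq_addl.
Qed.

Definition set_pluses (zs : seq V) sigma : V -> bool :=
  fun y => (y \in zs) || sigma y.

Lemma set_pluses_cons z zs sigma :
  set_pluses (z :: zs) sigma = set_pluses zs (set_plus z sigma).
Proof.
apply/funext => y; rewrite /set_pluses in_cons /set_plus /upd.
by case: eqP => //= _; rewrite orbT.
Qed.

Lemma indep_set_pluses zs y (T : Type) (f : (V -> bool) -> T) :
  y \in zs -> indep y (fun eta => f (set_pluses zs eta)).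
Proof.
move=> yzs sigma t; congr f; apply/funext => x; rewrite /set_pluses.
have [//|xzs /=] := boolP (x \in zs).
by rewrite upd_neq //; apply: contraNneq xzs => ->.
Qed.

Section Local.
Variables (d : nat) (K : R).
Hypothesis K_def : K = c^-1 ^+ d.+1.

Lemma K_ge1 (v : V) : 1 <= K.
Proof.
rewrite K_def; apply: exprn_ege1.
rewrite -div1r ler_pdivlMr // mul1r.
by have := p_bnd v true => /andP[]; move: c_gt0; lra.
Qed.

Lemma sub_set_plus_le z f eta :
  sqf (fun eta => f eta - f (set_plus z eta)) eta <= sqf (dif z f) eta.
Proof.
rewrite /sqf /dif /set_plus; have := upd_id eta z; case: (eta z) => ->.
  by rewrite subrr expr0n sqr_ge0.
by rewrite -sqrrN opprB.
Qed.

(** The spins are set to + one at a time. Each step costs a factor 2 for splitting a square and a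
    factor [K] for returning to the original law. *)
Lemma avgs_set_pluses zs l f sigma : ordered l ->
  (forall z, count (fun y => par y == z) l <= d)%N -> {subset zs <= l} ->
  avgs l (sqf (fun eta => f eta - f (set_pluses zs eta))) sigma <=
  (2 * K) ^+ size zs * \sum_(z <- zs) avgs l (sqf (dif z f)) sigma.
Proof.
move=> ol dl; elim: zs => [|z zs IH] sub.
  rewrite big_nil mulr0 /sqf /set_pluses /=.
  under [X in avgs l X]funext do rewrite subrr expr0n.
  by rewrite avgs_const.
have zl : z \in l by rewrite sub // mem_head.
have {}IH := IH (fun y yzs => sub y (mem_behead (s := z :: zs) yzs)).
have K1 := K_ge1 z.
pose h eta := f eta - f (set_pluses zs eta).
have le1 eta : sqf (fun eta => f eta - f (set_pluses (z :: zs) eta)) eta <=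
    2 * sqf (dif z f) eta + 2 * sqf h (set_plus z eta).
  have := sub_set_plus_le z f eta; rewrite /sqf /h set_pluses_cons.
  set u := f eta; set v := f (set_plus z eta); set w := f (set_pluses zs _).
  by have := sqr_ge0 ((u - v) - (v - w)); nra.
apply: le_trans (ler_avgs _ le1 sigma) _.
rewrite avgsD !avgsZ.
have h0 eta : 0 <= sqf h eta by apply: sqr_ge0.
have le2 : avgs l (fun eta => sqf h (set_plus z eta)) sigma <=
    K * avgs l (sqf h) sigma.
  apply: le_trans (avgs_set_plus_mem _ ol zl h0) _.
  rewrite ler_wpM2r ?avgs_ge0 // K_def ler_weXn2l ?ltnS //.
  rewrite -div1r ler_pdivlMr // mul1r.
  by have := p_bnd z true => /andP[]; move: c_gt0; lra.
rewrite big_cons /= exprS.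
set A := avgs l _ sigma; set B := \sum_(_ <- _) _ in IH *.
have A0 : 0 <= A by apply: avgs_ge0 => eta; apply: sqr_ge0.
have B0 : 0 <= B by apply: sumr_ge0 => i _; apply: avgs_ge0 => eta; apply: sqr_ge0.
have X1 : 1 <= (2 * K) ^+ size zs by apply: exprn_ege1; lra.
move: IH le2; rewrite -/(sqf h) -/h; set H := avgs l (sqf h) sigma.
set H' := avgs l _ sigma; set X := (2 * K) ^+ _ in X1 * => IH le2.
have KA : A <= K * X * A.
  by rewrite ler_peMl //; apply: mulr_ege1 => //; lra.
have KH : K * H <= K * (X * B) by rewrite ler_wpM2l //; lra.
rewrite mulrDr; apply: lerD; first by rewrite -!mulrA ler_wpM2l // mulrA.
by rewrite -!mulrA ler_wpM2l //; apply: le_trans le2 KH.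
Qed.

(** Parallelogram identity for the variance, with the variance of the difference dropped. *)
Lemma ler_varsD l f g sigma :
  vars l (fun eta => f eta + g eta) sigma <=
  2 * vars l f sigma + 2 * avgs l (sqf g) sigma.
Proof.
have vB := vars_ge0 l (fun eta => f eta - g eta) sigma.
suff -> : vars l (fun eta => f eta + g eta) sigma =
    2 * vars l f sigma + 2 * vars l g sigma
    - vars l (fun eta => f eta - g eta) sigma.
  have : vars l g sigma <= avgs l (sqf g) sigma.
    by rewrite /vars lerBlDr lerDl sqr_ge0.
  by lra.
rewrite /vars avgsB avgsD.
have -> : avgs l (sqf (fun eta => f eta + g eta)) sigma =
   2 * avgs l (sqf f) sigma + 2 * avgs l (sqf g) sigma
   - avgs l (sqf (fun eta => f eta - g eta)) sigma.
  rewrite -!(congr1 (@^~ sigma) (avgsZ l _ _)) /=.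
  rewrite -(congr1 (@^~ sigma) (avgsD l _ _)) /=.
  rewrite -(congr1 (@^~ sigma) (avgsB l _ _)) /=.
  by congr avgs; apply/funext => eta; rewrite /sqf; ring.
ring.
Qed.

Lemma ler_var1D x f g sigma :
  var1 x (fun eta => f eta + g eta) sigma <=
  2 * var1 x f sigma + 2 * var1 x g sigma.
Proof.
rewrite !var1E /dif.
set P := _ * prob x false sigma.
have P0 : 0 <= P by rewrite mulr_ge0 ?prob_ge0.
set u := f _; set v := f _; set w := g _; set r := g _.
rewrite -!(mulrCA P) -mulrDr ler_wpM2l //.
by have := sqr_ge0 ((u - v) - (w - r)); nra.
Qed.

Lemma var1_avgs_le x l f sigma :
  var1 x (avgs l f) sigma <= avgs (x :: l) (sqf f) sigma.
Proof.
apply: (@le_trans _ _ (avg x (sqf (avgs l f)) sigma)).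
  by rewrite /var1 lerBlDr lerDl sqr_ge0.
apply: ler_avg => eta.
by have := vars_ge0 l f eta; rewrite /vars subr_ge0.
Qed.

(** * The variance term of one vertex, and the sum over all vertices *)

Lemma ordered_cat_filter a l1 l2 :
  ordered (l1 ++ l2) -> ordered (l1 ++ seq.filter a l2).
Proof.
elim: l1 => /= [|x l1 IH]; first exact: ordered_filter.
rewrite !mem_cat !negb_or => /and4P[/andP[-> xl] -> /andP[-> pl] /IH ->].
by rewrite !mem_filter !negb_and xl pl !orbT.
Qed.

(** The vertex itself counts: [anc n.+1 x] selects the [n.+1] levels from [x] down, which form the
    block of [x], and [anc n.+2 x] adds the level that follows. *)
Definition anc n x y := x \in traject par y n.

Lemma anc_par n x y : y != x -> anc n.+1 x y -> anc n x (par y).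
Proof. by rewrite /anc /= in_cons eq_sym => /negPf ->. Qed.

Lemma anc_succ n x y : anc n x y -> anc n.+1 x y.
Proof. by rewrite /anc trajectSr mem_rcons in_cons => ->; rewrite orbT. Qed.

Lemma anc_child n x y z : par y = z -> anc n x z -> anc n.+1 x y.
Proof. by rewrite /anc /= in_cons => -> ->; rewrite orbT. Qed.

Lemma anc_refl n x : anc n.+1 x x.
Proof. by rewrite /anc mem_head. Qed.

Lemma par_closed_anc n x l : ordered (x :: l) ->
  par_closed (anc n.+1 x) (x :: l).
Proof.
move=> /= /and4P[xl pxx pxl _] y _ ay pyl.
have [eyx|nyx] := eqVneq y x; last exact/anc_succ/anc_par.
by rewrite eyx in_cons (negPf pxx) (negPf pxl) in pyl.
Qed.

(** Here [zs] is the block of [x], and [b] is the block without [x] together with the next level.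
    With the spins of [zs] set to +, the hypothesis on correlations applies; the error made is a sum
    of squared differences at the vertices of [zs]. *)
Lemma var1_step n x l1 l2 (S : nat) (eps : R) f sigma :
    let N := l1 ++ x :: l2 in
    let b := seq.filter (anc n.+2 x) l2 in
    let zs := seq.filter (anc n.+1 x) (x :: l2) in
  ordered N -> (forall z, count (fun y => par y == z) N <= d)%N ->
  (size zs <= S)%N -> 0 <= eps ->
  (forall g, {in zs, forall z, indep z g} ->
     forall eta, var1 x (avgs b g) eta <= eps * vars (x :: b) g eta) ->
  avgs l1 (var1 x (avgs l2 f)) sigma <=
  (2 + 4 * eps) * (2 * K) ^+ S * (\sum_(z <- zs) avgs N (sqf (dif z f)) sigma)
  + 4 * eps * wvar (fun y => (anc n.+2 x y)%:R) N f sigma.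
Proof.
move=> N b zs oN dN zsS eps0 mc.
have K1 := K_ge1 x.
have ol := ordered_catr oN; have /= /and4P[xl2 pxx pxl2 ol2] := ol.
have cl := par_closed_anc (n := n.+1) ol.
have cl2 := par_closed_behead cl.
set rest := seq.filter (predC (anc n.+2 x)) l2.
have fb : seq.filter (anc n.+2 x) (x :: l2) = x :: b by rewrite /= anc_refl.
have frest : seq.filter (predC (anc n.+2 x)) (x :: l2) = rest.
  by rewrite /= anc_refl.
pose f2 := avgs rest f; pose phi eta := f2 (set_pluses zs eta).
pose h eta := f2 eta - phi eta.
have phi_indep : {in zs, forall z, indep z phi}.
  by move=> z zzs; apply: indep_set_pluses.
(* From [f2 = h + phi]: twice the term of [h], at most its second moment, plus twice that of [phi],
   at most [eps] times its variance, which is in turn at most twice the variance of [f2] plus twice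
   the second moment of [h]. *)
have le1 eta : var1 x (avgs l2 f) eta <=
    (2 + 4 * eps) * avgs (x :: b) (sqf h) eta + 4 * eps * vars (x :: b) f2 eta.
  rewrite (avgs_split _ ol2 cl2) -/b -/rest -/f2.
  have -> : avgs b f2 = (fun eta => avgs b h eta + avgs b phi eta).
    by rewrite -avgsD; congr avgs; apply/funext => u; rewrite /h subrK.
  apply: le_trans (ler_var1D _ _ _ _) _.
  have := var1_avgs_le x b h eta; have := mc _ phi_indep eta.
  have := ler_varsD (x :: b) f2 (fun u => phi u - f2 u) eta.
  have -> : (fun u => f2 u + (phi u - f2 u)) = phi.
    by apply/funext => u; rewrite addrC subrK.
  have -> : sqf (fun u => phi u - f2 u) = sqf h.
    by apply/funext => u; rewrite /sqf /h -sqrrN opprB.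
  move=> h1 h2 h3.
  have : eps * vars (x :: b) phi eta <=
      eps * (2 * vars (x :: b) f2 eta + 2 * avgs (x :: b) (sqf h) eta).
    exact: ler_wpM2l.
  lra.
apply: le_trans (ler_avgs _ le1 sigma) _.
rewrite avgsD !avgsZ; apply: lerD; last first.
  apply: ler_wpM2l; first by rewrite mulr_ge0.
  apply: le_trans (wvar_cat _ _ _ _ _); last by move=> y; apply: ler0n.
  by apply: ler_avgs => eta; rewrite -fb /f2 -frest; apply: vars_avgs_filter.
rewrite -mulrA; apply: ler_wpM2l; first by rewrite addr_ge0 ?mulr_ge0.
rewrite -avgs_cat.
set l := l1 ++ x :: b.
have lE : l = l1 ++ seq.filter (anc n.+2 x) (x :: l2) by rewrite fb.
have oll : ordered l by rewrite lE ordered_cat_filter.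
have zsl : {subset zs <= l}.
  move=> z; rewrite lE mem_cat !mem_filter => /andP[/anc_succ -> ->].
  by rewrite orbT.
have dl z : (count (fun y => par y == z) l <= d)%N.
  apply: leq_trans (dN z); rewrite lE !count_cat leq_add2l count_filter.
  by apply: sub_count => y /andP[].
apply: le_trans (avgs_set_pluses f2 sigma oll dl zsl) _.
apply: ler_pM.
- by rewrite exprn_ge0 // mulr_ge0 //; lra.
- by apply: sumr_ge0 => z _; apply: avgs_ge0 => eta; apply: sqr_ge0.
- by rewrite ler_weXn2l //; lra.
rewrite [leLHS]big_seq [leRHS]big_seq; apply: ler_sum => z zzs.
have zW : anc n.+1 x z by move: zzs; rewrite mem_filter => /andP[].
(* The children of the block are in the next level, so none is in [rest]: the difference at [z]
   commutes with averaging over [rest], and Jensen's inequality finishes. *)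
have dz : dif z f2 = avgs rest (dif z f).
  apply: dif_avgs => y; rewrite mem_filter /= => /andP[nW _]; split.
    by apply: contraNneq nW => <-; apply: anc_succ.
  by apply: contraNneq nW => /anc_child; apply.
apply: (@le_trans _ _ (avgs l (avgs rest (sqf (dif z f))) sigma)).
  apply: ler_avgs => eta; rewrite /sqf dz.
  by have := vars_ge0 rest (dif z f) eta; rewrite /vars subr_ge0.
rewrite lE avgs_cat /N avgs_cat (avgs_split _ ol cl) frest //.
Qed.

Lemma vars_le_sum N (e : V -> R) f sigma :
  (forall l1 x l2, N = l1 ++ x :: l2 ->
     avgs l1 (var1 x (avgs l2 f)) sigma <= e x) ->
  vars N f sigma <= \sum_(x <- N) e x.
Proof.
move=> le_e; rewrite vars_wvar.
suff H l1 l2 : N = l1 ++ l2 ->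
    avgs l1 (wvar (fun=> 1) l2 f) sigma <= \sum_(x <- l2) e x by apply: (H [::]).
elim: l2 l1 => [|x l2 IH] l1 eN; first by rewrite big_nil avgs_const.
rewrite big_cons /= avgsD; under [X in avgs l1 X]funext do rewrite mul1r.
apply: lerD; first exact: le_e.
have := IH (rcons l1 x); rewrite -cats1 -catA avgs_cat; exact.
Qed.

(** Controls the overlap of the blocks: only the first [k] iterates of [par] from [y] can have [y]
    in theirs. *)
Lemma sum_anc_le N k y : uniq N ->
  (\sum_(x <- N) (anc k x y)%:R <= k%:R :> R).
Proof.
move=> uN; rewrite -natr_sum ler_nat.
have -> : (\sum_(x <- N) anc k x y = size (seq.filter (anc k ^~ y) N))%N.
  by rewrite size_filter -sum1_count [RHS]big_mkcond; apply: eq_bigr => x _; case: anc.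
rewrite -[leqRHS](size_traject par y k); apply: uniq_leq_size.
  exact: filter_uniq.
by move=> x; rewrite mem_filter => /andP[].
Qed.

(** Summing [var1_step] counts each variance term at most [n0.+2] times, so the remainder is at most
    [4 * eps * n0.+2%:R] times the variance, hence at most half of it; absorbing it gives the
    leading factor 2. The depth [n x] varies because blocks near the leaves will be longer. *)
Lemma vars_le_dif N (n : V -> nat) n0 S (eps : R) f sigma :
  ordered N -> (forall z, count (fun y => par y == z) N <= d)%N ->
  (forall x, n x <= n0)%N ->
  {in N, forall x, (count (anc (n x).+1 x) N <= S)%N} ->
  0 <= eps -> 8 * eps * n0.+2%:R <= 1 ->
  (forall l1 x l2 g, N = l1 ++ x :: l2 ->
     {in seq.filter (anc (n x).+1 x) (x :: l2), forall z, indep z g} ->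
     forall eta, let b := seq.filter (anc (n x).+2 x) l2 in
       var1 x (avgs b g) eta <= eps * vars (x :: b) g eta) ->
  vars N f sigma <=
  2 * ((2 + 4 * eps) * (2 * K) ^+ S * n0.+1%:R)
    * \sum_(z <- N) avgs N (sqf (dif z f)) sigma.
Proof.
move=> oN dN nn0 NS eps0 eps8 mc.
pose D z := avgs N (sqf (dif z f)) sigma.
have D0 z : 0 <= D z by apply: avgs_ge0 => eta; apply: sqr_ge0.
set C := (2 + 4 * eps) * _.
have uN := ordered_uniq oN.
have [->|[v vN]] : N = [::] \/ exists v, v \in N.
  by case: (N) => [|v N']; [left|right; exists v; rewrite mem_head].
  by rewrite /vars /= subrr big_nil mulr0.
have C0 : 0 <= C.
  have K1 := K_ge1 v.
  by rewrite mulr_ge0 ?exprn_ge0 //; lra.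
pose w x y : R := (anc (n x).+2 x y)%:R.
pose e x := C * (\sum_(z <- N | anc (n x).+1 x z) D z)
            + 4 * eps * wvar (w x) N f sigma.
have le_e : vars N f sigma <= \sum_(x <- N) e x.
  apply: vars_le_sum => l1 x l2 eN.
  have xN : x \in N by rewrite eN mem_cat mem_head orbT.
  have := @var1_step (n x) x l1 l2 S eps f sigma; rewrite -eN /= => step.
  apply: le_trans (step oN dN _ eps0 _) _; last 1 first.
  - rewrite lerD2r -/C ler_wpM2l //.
    have -> : \sum_(z <- N | anc (n x).+1 x z) D z =
        \sum_(z <- seq.filter (anc (n x).+1 x) l1) D z
        + \sum_(z <- seq.filter (anc (n x).+1 x) (x :: l2)) D z.
      by rewrite -big_filter {1}eN filter_cat big_cat.
    by rewrite lerDr sumr_ge0.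
  - apply: leq_trans (NS x xN); rewrite eN count_cat.
    by rewrite -(size_filter _ (x :: l2)) leq_addl.
  - by move=> g gi eta; apply: (mc l1).
have v0 := vars_ge0 N f sigma.
have swp (I : eqType) (r s : seq I) (P : I -> pred I) (F : I -> R) :
    \sum_(x <- r) \sum_(z <- s | P x z) F z =
    \sum_(z <- s) (\sum_(x <- r) (P x z)%:R) * F z.
  under eq_bigr do rewrite big_mkcond.
  rewrite exchange_big /=; apply: eq_bigr => z _; rewrite mulr_suml.
  by apply: eq_bigr => x _; case: (P x z); rewrite ?mul1r ?mul0r.
have anc_mono i j x z : (i <= j)%N ->
    (anc i x z)%:R <= (anc j x z)%:R :> R.
  move=> /subnKC <-; rewrite ler_nat; case: (boolP (anc i x z)) => // W.
  suff -> : anc (i + (j - i)) x z by [].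
  by elim: (j - i)%N => [|k IH]; rewrite ?addn0 // addnS; apply: anc_succ.
have sum_n0 z : \sum_(x <- N) (anc (n x).+1 x z)%:R <= n0.+1%:R :> R.
  by apply: le_trans (sum_anc_le n0.+1 z uN); apply: ler_sum => x _;
    apply: anc_mono; rewrite ltnS.
have le1 : \sum_(x <- N) \sum_(z <- N | anc (n x).+1 x z) D z <=
    n0.+1%:R * \sum_(z <- N) D z.
  by rewrite swp mulr_sumr; apply: ler_sum => z _; rewrite ler_wpM2r.
have le2 : \sum_(x <- N) wvar (w x) N f sigma <= n0.+2%:R * vars N f sigma.
  rewrite wvar_sum; apply: wvar_le => y _.
  apply: le_trans (sum_anc_le n0.+2 y uN); apply: ler_sum => x _.
  by apply: anc_mono; rewrite !ltnS.
move: le_e; rewrite /e big_split /= -!mulr_sumr.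
move: le1 le2; set A := \sum_(x <- N) \sum_(_ <- _ | _) _.
set B := \sum_(x <- N) wvar _ _ _ _; set u := vars N f sigma in v0 *.
set E := \sum_(z <- N) D z => le1 le2 le_e.
have h1 : C * A <= C * n0.+1%:R * E by rewrite -mulrA ler_wpM2l.
have h2 : 4 * eps * B <= 4 * eps * (n0.+2%:R * u) by rewrite ler_wpM2l ?mulr_ge0.
have h3 : 8 * eps * n0.+2%:R * u <= u by rewrite ler_piMl.
lra.
Qed.

End Local.

(** * Maximal correlation between a vertex and a level below it *)

Section Likelihood.
Variable B : pred V.

(* [lam l z] is the density, as a function of the spins of [l] outside of [B],
   of their law given the spin - at [z] with respect to their law given the
   spin + at [z]; [lam_out] is the contribution of the child [y] of [z]. *)
Definition lam_out y (L : (V -> bool) -> R) : (V -> bool) -> R := fun sigma =>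
  if B y then (p y false + (1 - p y false) * L sigma)
              / (p y true + (1 - p y true) * L sigma)
  else if sigma y then p y false / p y true
       else (1 - p y false) / (1 - p y true).

Fixpoint lam l z : (V -> bool) -> R :=
  if l is y :: l' then
    if par y == z then fun sigma => lam_out y (lam l' y) sigma * lam l' z sigma
    else lam l' z
  else fun=> 1.

Let p_gt0 y t : 0 < p y t.
Proof. by have := p_bnd y t => /andP[]; move: c_gt0; lra. Qed.

Let q_gt0 y t : 0 < 1 - p y t.
Proof. by have := p_bnd y t => /andP[]; move: c_gt0; lra. Qed.

Lemma lam_out_gt0 y (L : (V -> bool) -> R) sigma :
  0 < L sigma -> 0 < lam_out y L sigma.
Proof.
move=> L0; rewrite /lam_out; case: (B y).
  by rewrite divr_gt0 // addr_gt0 // mulr_gt0.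
by case: (sigma y); rewrite divr_gt0.
Qed.

Lemma lam_gt0 l z sigma : 0 < lam l z sigma.
Proof.
elim: l z sigma => //= y l IH z sigma; case: eqP => // _.
by rewrite mulr_gt0 // lam_out_gt0.
Qed.

Lemma indep_lam_out v y (L : (V -> bool) -> R) :
  (v != y) || B y -> indep v L -> indep v (lam_out y L).
Proof.
move=> vy Lv sigma t; rewrite /lam_out Lv; case: (B y) vy => //.
by rewrite orbF eq_sym => /upd_neq ->.
Qed.

Lemma indep_lam v l z : (v \notin l) || B v -> indep v (lam l z).
Proof.
elim: l z => //= y l IH z vl.
have vl' : (v \notin l) || B v.
  by case/orP: vl => [|->]; rewrite ?orbT // in_cons negb_or => /andP[_ ->].
case: eqP => [_|_]; last exact: IH.
move=> sigma t; rewrite (IH z) // indep_lam_out //; last exact: IH.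
case: eqVneq vl => //= ->; by rewrite mem_head.
Qed.

(** Change of measure, one child of [z] at a time: a child outside [B] contributes the ratio of its
    two conditional probabilities, a child in [B] the ratio of its mixtures of 1 and of its own
    density. *)
Lemma avgs_lam l z g sigma : ordered l -> z \notin l -> indep z g ->
  {in l, forall y, B y -> indep y g} ->
  avgs l g (upd sigma z false) =
  avgs l (fun eta => g eta * lam l z eta) (upd sigma z true).
Proof.
elim: l z g sigma => [|y l IH] z g sigma /=.
  by move=> _ _ gz _; rewrite mulr1 !gz.
move=> /and4P[yl pyy pyl ol]; rewrite in_cons negb_or => /andP[nzy zl] gz gB.
have gBl : {in l, forall w, B w -> indep w g}.
  by move=> w wl; apply: gB; rewrite in_cons wl orbT.
have nyz : y != z by rewrite eq_sym.
case: eqVneq => [pyz|npyz]; last first.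
  by rewrite !avg_upd_parent // !(updC _ _ _ nzy) !(IH z).
rewrite /avg /prob pyz !updxx !(updC _ _ _ nzy) !(IH z) // -!(updC _ _ _ nzy).
set s1 := upd sigma z true.
pose g1 eta := g eta * lam l z eta.
have ygl : indep y g1 \/ ~~ B y.
  have [By|] := boolP (B y); [left|by right].
  move=> eta t; rewrite /g1 (gB y) ?mem_head // indep_lam ?yl //.
have g1B : {in l, forall w, B w -> indep w g1}.
  by move=> w wl Bw eta t; rewrite /g1 (gBl w) // indep_lam ?Bw ?orbT.
rewrite -/g1.
have -> : (fun eta => g eta * (lam_out y (lam l y) eta * lam l z eta)) =
    (fun eta => lam_out y (lam l y) eta * g1 eta).
  by apply/funext => eta; rewrite /g1 mulrCA.
have lam_y : indep y (lam l y) by apply: indep_lam; rewrite yl.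
have [By|nBy] := boolP (B y); last first.
  rewrite avgsM_indep; last first.
    move=> w wl eta t; rewrite /lam_out (negPf nBy) upd_neq //.
    by apply: contraNneq yl => ->.
  rewrite /lam_out (negPf nBy) !updxx.
  by field; rewrite !gt_eqF.
have yg1 : indep y g1 by case: ygl => //; rewrite By.
have yG : indep y (lam_out y (lam l y)) by apply: indep_lam_out; rewrite ?By ?orbT.
rewrite (IH y g1) // (IH y (fun eta => lam_out y (lam l y) eta * g1 eta)) //;
  last 2 first.
- by move=> eta t; rewrite yg1 yG.
- move=> w wl Bw eta t; rewrite (g1B w) // indep_lam_out ?By ?orbT //.
  by apply: indep_lam; rewrite Bw orbT.
set s2 := upd s1 y true.
rewrite -!(congr1 (@^~ s2) (avgsZ l _ _)) /= -!(congr1 (@^~ s2) (avgsD l _ _)) /=.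
congr avgs; apply/funext => eta; rewrite /lam_out By.
have : 0 < p y true + (1 - p y true) * lam l y eta.
  by rewrite addr_gt0 // mulr_gt0 // lam_gt0.
by move=> den; field; rewrite gt_eqF.
Qed.

Section Distortion.
Variables (lev : V -> nat) (theta gam : R) (v : V).
Hypothesis lev_par : forall y, lev (par y) = (lev y).-1.
Hypotheses (theta_ge0 : 0 <= theta) (gam_ge0 : 0 <= gam).
Hypothesis p_mono : forall y, p y false <= p y true.
Hypothesis p_odds : forall y,
  (1 - p y false) * p y true <= (1 + theta) * (p y false * (1 - p y true)).
(** Bounds by [gam] the derivative, in logarithmic scale for both argument and value, of the Moebius
    map that [lam_out] applies to the density at a vertex of [B]. *)
Hypothesis p_gam : forall y (L : R), 0 < L ->
  ((1 - p y false) * p y true - p y false * (1 - p y true)) * L <=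
  gam * ((p y false + (1 - p y false) * L) * (p y true + (1 - p y true) * L)).
Hypothesis vB : ~~ B v.

Definition distorts (k : R) (g : (V -> bool) -> R) := forall sigma,
  g (upd sigma v true) <= g (upd sigma v false) <= (1 + k) * g (upd sigma v true).

Lemma distorts_indep k g : 0 <= k -> (forall sigma, 0 <= g sigma) ->
  indep v g -> distorts k g.
Proof. by move=> k0 g0 gv sigma; rewrite !gv lexx /= ler_peMl //; lra. Qed.

Lemma distortsM k g h : 0 <= k -> (forall sigma, 0 <= h sigma) -> indep v h ->
  distorts k g -> distorts k (fun eta => g eta * h eta).
Proof.
move=> k0 h0 hv gk sigma; rewrite !hv; have /andP[g1 g2] := gk sigma.
by rewrite mulrA !ler_wpM2r.
Qed.

Lemma lev_iter k y : lev (iter k par y) = (lev y - k)%N.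
Proof. by elim: k => [|k IH] /=; rewrite ?subn0 // lev_par IH subnS. Qed.

(** The increment of the quotient is bounded by [p_gam] at the smaller of the two densities, since
    its denominator only grows with the larger one. *)
Lemma distorts_lam_out k y (L : (V -> bool) -> R) : B y -> 0 <= k ->
  (forall sigma, 0 < L sigma) -> distorts k L ->
  distorts (gam * k) (lam_out y L).
Proof.
move=> By k0 L0 Lk sigma; rewrite /lam_out By.
have := Lk sigma; have := L0 (upd sigma v true); have := L0 (upd sigma v false).
move: (L (upd sigma v true)) (L (upd sigma v false)) => A A' A'0 A0 /andP[AA' A'A].
have := p_mono y; have := @p_gam y A A0; have := p_gt0 y true.
have := p_gt0 y false; have := q_gt0 y true; have := q_gt0 y false.
move: (p y true) (p y false) => u w q0 q1 w0 u0 gm wu.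
have d0 : 0 < u + (1 - u) * A by rewrite addr_gt0 // mulr_gt0.
have d0' : 0 < u + (1 - u) * A' by rewrite addr_gt0 // mulr_gt0.
have n0 : 0 < w + (1 - w) * A by rewrite addr_gt0 // mulr_gt0.
apply/andP; split.
  rewrite ler_pdivrMr // mulrAC ler_pdivlMr //.
  have : 0 <= (A' - A) * (u - w) by rewrite mulr_ge0 // subr_ge0.
  lra.
rewrite ler_pdivrMr // mulrA mulrAC ler_pdivlMr //.
have : ((1 - w) * u - w * (1 - u)) * (A' - A) <=
       k * (((1 - w) * u - w * (1 - u)) * A).
  by rewrite mulrCA; apply: ler_wpM2l; [nra|lra].
have := ler_wpM2l k0 gm.
have : gam * k * ((w + (1 - w) * A) * (u + (1 - u) * A)) <=
       gam * k * ((w + (1 - w) * A) * (u + (1 - u) * A')).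
  by rewrite !ler_wpM2l ?mulr_ge0 // ?(ltW n0) // lerD2l ler_wpM2l // ltW.
lra.
Qed.

Lemma indep_lam_path l z :
  (forall j, iter j par v \in l -> par (iter j par v) != z) ->
  indep v (lam l z).
Proof.
elim: l z => //= y l IH z vl.
have vl' j : iter j par v \in l -> par (iter j par v) != z.
  by move=> jl; apply: vl; rewrite in_cons jl orbT.
case: eqVneq => [pyz|_]; last exact: IH.
have vy j : iter j par v != y.
  by apply/eqP => vjy; have := vl j; rewrite vjy mem_head pyz eqxx => /(_ isT).
move=> sigma t; rewrite (IH z vl') indep_lam_out ?(vy 0) //.
by apply: IH => j _; apply: (vy j.+1).
Qed.

(** Only the factor of the child on the path from [iter k.+1 par v] to [v] can see [v]. At [v]
    itself the distortion is an odds ratio, at most [1 + theta]; every integrated vertex on the way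
    up contracts it by [gam]. *)
Lemma distorts_lam l k : uniq l -> (0 < lev (iter k.+1 par v))%N ->
  distorts (theta * gam ^+ k) (lam l (iter k.+1 par v)).
Proof.
elim: l k => [|y l IH] k ul levz.
  by apply: distorts_indep => [|sigma|//]; rewrite ?mulr_ge0 ?exprn_ge0 // ler01.
have /andP[yl ul'] : (y \notin l) && uniq l := ul.
(* Levels drop strictly along the path as long as they are positive, so the path visits no vertex
   twice. *)
have idx j : iter j.+1 par v = iter k.+1 par v -> j = k.
  by move/(congr1 lev); rewrite !lev_iter; move: levz; rewrite lev_iter; lia.
rewrite /=; case: eqVneq => [py|_]; last exact: IH.
have th0 j : 0 <= theta * gam ^+ j by rewrite mulr_ge0 ?exprn_ge0.
have pos u w sigma : 0 <= lam u w sigma by apply: ltW; apply: lam_gt0.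
have [vky|vky] := eqVneq (iter k par v) y; last first.
  have vy j : iter j par v != y.
    by apply: contraNneq vky => vjy; rewrite -(idx j) ?vjy //= vjy.
  have := IH k ul' levz => /(distortsM (h := lam_out y (lam l y)) (th0 k)) H sigma.
  rewrite !(mulrC (lam_out _ _ _)); apply: H => {}sigma.
    by apply/ltW/lam_out_gt0/lam_gt0.
  apply: indep_lam_out; rewrite ?(vy 0) //.
  by apply: indep_lam_path => j _; apply: (vy j.+1).
apply: distortsM => //.
  apply: indep_lam_path => j jl; apply: contraNneq yl => e.
  by rewrite -vky -(idx j).
case: k => [|k] in vky py levz idx *.
  rewrite expr0 mulr1 => sigma; rewrite /lam_out -vky (negPf vB) !updxx.
  have := p_odds v; have := p_mono v.
  have := p_gt0 v true; have := q_gt0 v true.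
  move: (p v true) (p v false) => u w q0 u0 wu odds; apply/andP; split.
    by rewrite ler_pdivrMr // mulrAC ler_pdivlMr //; lra.
  by rewrite ler_pdivrMr // mulrA mulrAC ler_pdivlMr //; lra.
have [By|nBy] := boolP (B y).
  rewrite exprS mulrCA; apply: distorts_lam_out => //.
    by move=> sigma; apply: lam_gt0.
  rewrite -vky; apply: IH => //.
  by move: levz; rewrite /= lev_par; lia.
(* A vertex of the path outside [B] has its spin fixed, which screens off everything below it. *)
apply: distorts_indep => // [sigma|].
  by apply/ltW/lam_out_gt0/lam_gt0.
move=> sigma t; rewrite /lam_out (negPf nBy) upd_neq //.
apply/eqP => yv; move/(congr1 lev): vky; rewrite lev_iter -yv.
by move: levz; rewrite lev_iter -yv /=; lia.
Qed.

End Distortion.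
End Likelihood.

(** [e] bounds the direct effect of a spin on [g], and [D] is a supersolution of the recursion for
    its total effect, direct and through descendants. *)
Lemma dif_avgs_le (kap : R) (e D : V -> R) l g z sigma :
  0 <= kap -> ordered l -> z \notin l ->
  (forall y t s, y \in l -> `|p y t - p y s| <= kap) ->
  (forall y, 0 <= D y) ->
  {in l, forall y, e y + kap * \sum_(w <- l | par w == y) D w <= D y} ->
  (forall y, y \in l \/ y = z -> forall eta, `|dif y g eta| <= e y) ->
  `|dif z (avgs l g) sigma| <= e z + kap * \sum_(w <- l | par w == z) D w.
Proof.
move=> k0 + + + D0; elim: l z sigma => [|y l IH] z sigma.
  by move=> _ _ _ _ eg; rewrite big_nil mulr0 addr0; apply: eg; right.
move=> /= /and4P[yl pyy pyl ol]; rewrite in_cons negb_or => /andP[nzy zl] pk De eg.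
have IHl w eta : w \notin l -> w = y \/ w = z ->
    `|dif w (avgs l g) eta| <= e w + kap * \sum_(u <- l | par u == w) D u.
  move=> wl wyz; apply: IH => //.
  - by move=> u t s ul; apply: pk; rewrite in_cons ul orbT.
  - move=> u ul; have := De u; rewrite in_cons ul orbT => /(_ isT).
    apply: le_trans; rewrite lerD2l ler_wpM2l // big_cons.
    by case: ifP => _ //; rewrite lerDr.
  - move=> u [ul|->]; first by apply: eg; left; rewrite in_cons ul orbT.
    by apply: eg; case: wyz => ->; [left; rewrite mem_head|right].
have le_z eta : `|dif z (avgs l g) eta| <= e z + kap * \sum_(u <- l | par u == z) D u.
  by apply: IHl => //; right.
set bz := e z + _ in le_z.
have avg_le (f : (V -> bool) -> R) k eta : (forall u, `|f u| <= k) ->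
    `|avg y f eta| <= k.
  move=> fk; apply: le_trans (ler_normD _ _) _.
  rewrite !normrM !(ger0_norm (prob_ge0 _ _ _)).
  apply: le_trans (lerD (ler_wpM2l (prob_ge0 _ _ _) (fk _))
                        (ler_wpM2l (prob_ge0 _ _ _) (fk _))) _.
  by rewrite -mulrDl probT_F mul1r.
have [pyz|npyz] := eqVneq (par y) z; last first.
  rewrite dif_avg // big_cons (negPf npyz).
  exact: avg_le.
rewrite big_cons pyz eqxx mulrDr addrCA addrC -/bz.
(* The flip is made in two moves: the spin at [z] under the law of [y] given -, then that law, whose
   mass shifts by at most [kap]. *)
have -> : dif z (avg y (avgs l g)) sigma =
   avg y (dif z (avgs l g)) (upd sigma z false)
   + (p y true - p y false) * dif y (avgs l g) (upd sigma z true).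
  rewrite /dif /avg /prob pyz !updxx !(updC _ _ _ nzy) !upd_upd.
  ring.
apply: le_trans (ler_normD _ _) _; apply: lerD; first exact: avg_le.
rewrite normrM; apply: ler_pM => //; first by apply: pk; rewrite mem_head.
apply: le_trans (IHl y _ yl (or_introl erefl)) _.
have := De y; rewrite mem_head => /(_ isT); apply: le_trans.
by rewrite lerD2l ler_wpM2l // big_cons ifN.
Qed.

(** [psi] plays the conditional probability of + at [x]. Its variance is [p0 * q0 * D] and its
    covariance with [g] is [p0 * q0 * G], so this is the Cauchy-Schwarz inequality. Only the first
    two moments of [psi] and its product with [g] enter, whence the three instances of [f]. *)
Lemma var1_le_vars x l (psi g : (V -> bool) -> R) (eps : R) eta :
  0 < eps -> par x != x -> x \notin l ->
  (forall f, f = psi \/ f = g \/ f = (fun=> 1) ->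
     avgs (x :: l) (fun u => psi u * f u) eta =
     prob x true eta * avgs l f (upd eta x true)) ->
  `|dif x (avgs l psi) eta| <= eps ->
  var1 x (avgs l g) eta <= eps * vars (x :: l) g eta.
Proof.
move=> eps0 pxx xl post.
set D := dif x _ eta; set p0 := prob x true eta; set q0 := prob x false eta.
move=> Deps.
have pq : p0 + q0 = 1 by apply: probT_F.
have p00 : 0 < p0 := lt_le_trans c_gt0 (prob_ge x true eta).
have q00 : 0 < q0 := lt_le_trans c_gt0 (prob_ge x false eta).
pose G := dif x (avgs l g) eta.
have mpsi : avgs (x :: l) psi eta = p0.
  have := post (fun=> 1) (or_intror (or_intror erefl)).
  by rewrite avgs_const mulr1 -/p0 => <-; congr avgs; apply/funext => u; rewrite mulr1.
have E (f : (V -> bool) -> R) :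
    avgs (x :: l) f eta = p0 * avgs l f (upd eta x true) + q0 * avgs l f (upd eta x false).
  by [].
have vpsi : vars (x :: l) psi eta = p0 * q0 * D.
  have := E psi; rewrite mpsi /vars mpsi.
  have -> : sqf psi = (fun u => psi u * psi u) by apply/funext => u; rewrite /sqf expr2.
  rewrite post; last by left.
  rewrite -/p0 /D /dif; move: (avgs l psi _) (avgs l psi _) => u w h.
  transitivity (p0 * (w - (p0 * w + q0 * u))); first by rewrite -h; ring.
  have -> : q0 = 1 - p0 by lra.
  ring.
have vpsig k : vars (x :: l) (fun u => g u - k * psi u) eta =
    vars (x :: l) g eta - 2 * k * (p0 * q0 * G) + k ^+ 2 * (p0 * q0 * D).
  rewrite -vpsi /vars.
  have -> : avgs (x :: l) (sqf (fun u => g u - k * psi u)) eta =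
      avgs (x :: l) (sqf g) eta - (2 * k) * avgs (x :: l) (fun u => psi u * g u) eta
      + k ^+ 2 * avgs (x :: l) (sqf psi) eta.
    rewrite -!(congr1 (@^~ eta) (avgsZ (x :: l) _ _)).
    rewrite -(congr1 (@^~ eta) (avgsB (x :: l) _ _)).
    rewrite -(congr1 (@^~ eta) (avgsD (x :: l) _ _)).
    by congr avgs; apply/funext => u; rewrite /sqf; ring.
  rewrite (congr1 (@^~ eta) (avgsB (x :: l) _ _)) (congr1 (@^~ eta) (avgsZ (x :: l) _ _)).
  rewrite mpsi post; last by right; left.
  rewrite -/p0 /G /dif (E g); move: (avgs l g _) (avgs l g _) => u w.
  have -> : q0 = 1 - p0 by lra.
  ring.
(* The least squares coefficient would be [G / D]; its bound [eps] replaces [D], which may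
   vanish. *)
have := vars_ge0 (x :: l) (fun u => g u - (G / eps) * psi u) eta.
rewrite vpsig var1E -/p0 -/q0 -/G.
set v := vars _ _ _ => h.
have pq0 : 0 < p0 * q0 by apply: mulr_gt0.
have : (G / eps) ^+ 2 * (p0 * q0 * D) <= (G / eps) ^+ 2 * (p0 * q0 * eps).
  rewrite ler_wpM2l ?sqr_ge0 // ler_wpM2l ?(ltW pq0) //.
  exact: le_trans (ler_norm _) Deps.
have -> : (G / eps) ^+ 2 * (p0 * q0 * eps) = p0 * q0 * (G ^+ 2 / eps).
  by field; rewrite gt_eqF.
have e2 : 2 * (G / eps) * (p0 * q0 * G) = 2 * (p0 * q0 * (G ^+ 2 / eps)).
  by field; rewrite gt_eqF.
move=> h2; have h3 : p0 * q0 * (G ^+ 2 / eps) <= v by lra.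
rewrite mulrA ler_pdivrMr // in h3; lra.
Qed.

(** * Decay of correlation across a block, and the Poincare inequality *)

Section Level.
Variables (lev : V -> nat) (theta gam kap : R) (d : nat).
Hypothesis lev_par : forall y, lev (par y) = (lev y).-1.
Hypotheses (theta_ge0 : 0 <= theta) (gam_ge0 : 0 <= gam) (kap_ge0 : 0 <= kap).
Hypothesis p_mono : forall y, p y false <= p y true.
Hypothesis p_odds : forall y,
  (1 - p y false) * p y true <= (1 + theta) * (p y false * (1 - p y true)).
Hypothesis p_gam : forall y (L : R), 0 < L ->
  ((1 - p y false) * p y true - p y false * (1 - p y true)) * L <=
  gam * ((p y false + (1 - p y false) * L) * (p y true + (1 - p y true) * L)).

Lemma lev_anc_iter x y j : (0 < lev x)%N -> x = iter j par y ->
  lev y = (lev x + j)%N.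
Proof. by move=> lx e; move: lx; rewrite e lev_iter //; lia. Qed.

Lemma lev_child w y : par w = y -> (0 < lev y)%N -> lev w = (lev y).+1.
Proof. by move=> <-; rewrite lev_par; lia. Qed.

Lemma var1_level n x l (eps : R) g eta :
    let b := seq.filter (anc n.+2 x) l in
  ordered (x :: l) -> (0 < lev x)%N ->
  (forall z, count (fun y => par y == z) l <= d)%N ->
  (forall y t s, y \in b -> `|p y t - p y s| <= kap) ->
  0 < eps -> theta * gam ^+ n * (d%:R * kap) ^+ n.+1 <= eps ->
  {in seq.filter (anc n.+1 x) (x :: l), forall z, indep z g} ->
  var1 x (avgs b g) eta <= eps * vars (x :: b) g eta.
Proof.
move=> b ol lx dl pk eps0 le_eps gi; have /= /and4P[xl pxx pxl ol2] := ol.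
pose B := anc n.+1 x.
have Bx : B x by apply: anc_refl.
have ob : ordered b by apply: ordered_filter.
have xb : x \notin b by rewrite mem_filter negb_and xl orbT.
have bzs : {in b, forall y, B y -> y \in seq.filter B (x :: l)}.
  by move=> y; rewrite !mem_filter in_cons => /andP[_ ->] ->; rewrite orbT.
have xzs : x \in seq.filter B (x :: l) by rewrite mem_filter mem_head Bx.
set p0 := prob x true eta; pose q0 := 1 - p0.
have p00 : 0 < p0 := lt_le_trans c_gt0 (prob_ge x true eta).
have q00 : 0 < q0 := lt_le_trans c_gt0 (prob_ge x false eta).
(* Bayes' rule: the conditional probability of + at [x] given the spins that follow the block. *)
pose psi u := p0 / (p0 + q0 * lam B b x u).
have den u : 0 < p0 + q0 * lam B b x u.
  by rewrite addr_gt0 // mulr_gt0 // lam_gt0.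
have psiB z : B z -> indep z psi.
  by move=> Bz u t; rewrite /psi indep_lam // Bz orbT.
have lev_anc j y : (x = iter j par y) -> lev y = (lev x + j)%N.
  exact: lev_anc_iter.
have lev_b y : y \in b -> B y -> (lev y <= lev x + n)%N.
  by move=> _ /trajectP[j jn /lev_anc ->]; rewrite leq_add2l -ltnS.
have top y : y \in b -> ~~ B y -> x = iter n.+1 par y.
  rewrite mem_filter => /andP[/trajectP[j jn e] _] nB.
  suff <- : j = n.+1 by [].
  apply/eqP; rewrite eqn_leq -ltnS jn /= ltnNge; apply: contra nB => jn'.
  by apply/trajectP; exists j.
have child y w : w \in b -> par w = y -> (0 < lev y)%N -> lev w = (lev y).+1.
  by move=> _; apply: lev_child.
(* Only spins of the next level move [psi], by the distortion of the density. Each level up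
   multiplies the total effect by at most [d] children times [kap], which dictates [D] below. *)
pose e y := if B y then 0 else theta * gam ^+ n.
pose D y := theta * gam ^+ n * (d%:R * kap) ^+ (lev x + n.+1 - lev y).
have tg0 : 0 <= theta * gam ^+ n by rewrite mulr_ge0 ?exprn_ge0.
have D0 y : 0 <= D y by rewrite mulr_ge0 // exprn_ge0 // mulr_ge0.
have sumD y : B y -> (0 < lev y <= lev x + n)%N ->
    kap * \sum_(w <- b | par w == y) D w <= D y.
  move=> By /andP[ly lyn].
  have -> : \sum_(w <- b | par w == y) D w = \sum_(w <- b | par w == y)
      theta * gam ^+ n * (d%:R * kap) ^+ (lev x + n - lev y).
    rewrite big_seq_cond [RHS]big_seq_cond; apply: eq_bigr => w /andP[wb /eqP pw].
    by rewrite /D (child y w) // addnS subSS.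
  rewrite big_const_seq iter_addr_0 -[_ *+ count _ _]mulr_natl /D addnS subSn // exprS.
  set X := (d%:R * kap) ^+ _.
  have X0 : 0 <= X by rewrite exprn_ge0 // mulr_ge0.
  have -> : theta * gam ^+ n * (d%:R * kap * X) = kap * (d%:R * (theta * gam ^+ n * X)).
    ring.
  apply: ler_wpM2l => //; apply: ler_wpM2r; first exact: mulr_ge0.
  rewrite ler_nat; apply: leq_trans (dl y); rewrite count_filter.
  by apply: sub_count => w /andP[].
apply: (var1_le_vars (psi := psi)) => // [f hf|].
  have fi z : z \in seq.filter B (x :: l) -> indep z f.
    move=> zzs; case: hf => [->|[->|->]] //; last exact: gi.
    by apply: psiB; move: zzs; rewrite mem_filter => /andP[].
  have -> : avgs (x :: b) (fun u => psi u * f u) eta =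
      p0 * avgs b (fun u => psi u * f u) (upd eta x true)
      + q0 * avgs b (fun u => psi u * f u) (upd eta x false) by [].
  rewrite (avgs_lam (B := B) eta ob xb); last 2 first.
  - by move=> u t; rewrite fi // psiB.
  - by move=> y yb By u t; rewrite fi ?bzs // psiB.
  rewrite -!(congr1 (@^~ (upd eta x true)) (avgsZ b _ _)) /=.
  rewrite -(congr1 (@^~ (upd eta x true)) (avgsD b _ _)) /=.
  congr avgs; apply/funext => u; rewrite /psi.
  by rewrite -[p x (eta (par x))]/p0; field; rewrite gt_eqF.
apply: le_trans le_eps.
have -> : theta * gam ^+ n * (d%:R * kap) ^+ n.+1 = D x.
  by rewrite /D addKn.
have bound : forall y, y \in b \/ y = x -> forall u, `|dif y psi u| <= e y.
  move=> y yb u; rewrite /e; case: ifPn => [By|nBy].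
    by rewrite /dif !psiB // subrr normr0.
  have {}yb : y \in b by case: yb => // yx; rewrite yx Bx in nBy.
  have levx : (0 < lev (iter n.+1 par y))%N by rewrite -(top y).
  have := distorts_lam lev_par theta_ge0 gam_ge0 p_mono p_odds p_gam nBy
    (ordered_uniq ob) levx u.
  rewrite -(top y) // /dif /psi.
  have := den (upd u y true); have := den (upd u y false).
  have := lam_gt0 B b x (upd u y true); have := lam_gt0 B b x (upd u y false).
  move: (lam _ _ _ _) (lam _ _ _ _) => A' A; set k := theta * _ in tg0 *.
  move=> A0 A'0 dA dA' /andP[h1 h2].
  have -> : p0 / (p0 + q0 * A') - p0 / (p0 + q0 * A) =
      p0 * q0 * (A - A') / ((p0 + q0 * A') * (p0 + q0 * A)).
    by field; rewrite !gt_eqF.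
  have dd : 0 < (p0 + q0 * A') * (p0 + q0 * A) by rewrite mulr_gt0.
  rewrite ger0_norm; last first.
    by rewrite divr_ge0 ?(ltW dd) // mulr_ge0 ?subr_ge0 // mulr_ge0 // ltW.
  rewrite ler_pdivrMr //.
  have : p0 * q0 * (A - A') <= p0 * q0 * (k * A').
    by rewrite ler_wpM2l ?mulr_ge0 ?(ltW p00) ?(ltW q00) //; lra.
  have : 0 <= k * (p0 * p0 + q0 * A * p0 + q0 * q0 * A * A').
    by rewrite mulr_ge0 // !addr_ge0 ?mulr_ge0 ?(ltW p00) ?(ltW q00) ?(ltW A0) ?(ltW A'0).
  lra.
have De : {in b, forall y, e y + kap * \sum_(w <- b | par w == y) D w <= D y}.
  move=> y yb; rewrite /e; case: ifPn => [By|nBy].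
    rewrite add0r sumD // lev_b // andbT.
    by case/trajectP: By => j _ /lev_anc ->; rewrite addn_gt0 lx.
  rewrite big_seq_cond big_pred0 ?mulr0 ?addr0; last first.
    move=> w; apply/negP => /andP[wb /eqP pw]; case/negP: nBy; rewrite -pw.
    apply: anc_par; last by move: wb; rewrite mem_filter => /andP[].
    by apply: contraNneq xb => <-.
  by rewrite /D (lev_anc n.+1 y (top y yb nBy)) subnn mulr1.
apply: le_trans (dif_avgs_le eta kap_ge0 ob xb pk D0 De bound) _.
by rewrite /e Bx add0r sumD // lx leq_addr.
Qed.

Lemma anc_sub i j x y : (i <= j)%N -> anc i x y -> anc j x y.
Proof.
move=> /subnKC <- W.
by elim: (j - i)%N => [|k IH]; rewrite ?addn0 // addnS; apply: anc_succ.
Qed.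

(** The influence bound [kap] is assumed only at least [M] levels above the last one; [M] affects
    the constant, not the decay condition. *)
Lemma poincare N n M top S (eps : R) f sigma :
  ordered N -> (forall z, count (fun y => par y == z) N <= d)%N ->
  {in N, forall y, (0 < lev y <= top)%N} ->
  {in N, forall y, (lev y + M <= top)%N -> forall t s, `|p y t - p y s| <= kap} ->
  {in N, forall x, (count (anc (n + M).+1 x) N <= S)%N} ->
  0 < eps -> 8 * eps * (n + M).+2%:R <= 1 ->
  theta * gam ^+ n * (d%:R * kap) ^+ n.+1 <= eps ->
  vars N f sigma <=
  2 * ((2 + 4 * eps) * (2 * c^-1 ^+ d.+1) ^+ S * (n + M).+1%:R)
    * \sum_(z <- N) avgs N (sqf (dif z f)) sigma.
Proof.
move=> oN dN lN kN NS eps0 eps8 le_eps.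
pose deep x := (lev x + n.+1 + M <= top)%N.
(* A block that would come too close to the leaves gets [M] more levels. It then reaches the last
   level, nothing follows it, and a function independent of the block has zero variance. *)
pose nx x := if deep x then n else (n + M)%N.
have nxM x : (nx x <= n + M)%N by rewrite /nx; case: ifP => // _; apply: leq_addr.
apply: (@vars_le_dif d _ erefl N nx) => //.
- move=> x xN; apply: leq_trans (NS x xN); apply: sub_count => y.
  by apply: anc_sub; rewrite ltnS.
- exact: ltW.
move=> l1 x l2 g eN; rewrite /nx.
have xN : x \in N by rewrite eN mem_cat mem_head orbT.
have /andP[lx _] := lN x xN.
have ol : ordered (x :: l2) by move: oN; rewrite eN => /ordered_catr.
have l2N y : y \in l2 -> y \in N by rewrite eN mem_cat in_cons => ->; rewrite !orbT.
have lev_j y j : x = iter j par y -> lev y = (lev x + j)%N by apply: lev_anc_iter.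
case: ifPn => [dx|shallow] gi eta /=.
  apply: var1_level => // [z|y t s].
    by apply: leq_trans (dN z); rewrite eN count_cat /= addnA leq_addl.
  rewrite mem_filter => /andP[/trajectP[j jn /lev_j levy] /l2N yN].
  apply: kN => //; rewrite levy; apply: leq_trans dx.
  by rewrite leq_add2r leq_add2l.
set b := seq.filter _ l2.
have gb : {in b, forall y, indep y g}.
  move=> y yb; apply: gi; move: yb; rewrite !mem_filter in_cons.
  move=> /andP[/trajectP[j jn e] yl2]; rewrite yl2 orbT andbT.
  apply/trajectP; exists j => //; rewrite ltnNge; apply: contra shallow => jM.
  have /andP[_] := lN y (l2N y yl2); rewrite (lev_j y j e) /deep.
  by apply: leq_trans; rewrite -addnA leq_add2l addSn.
rewrite (avgs_indep gb) var1E /dif !gi ?mem_filter ?mem_head ?anc_refl //.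
by rewrite subrr expr0n mulr0 mulr_ge0 ?vars_ge0 // ltW.
Qed.

End Level.

End Bounds.
End Chain.

(** * Single-site flips in the Ising model on a finite graph *)

Section Flip.
Variables (R : realType) (V : finType) (e : rel V) (beta h : R).
Implicit Types (A : {set V}) (x y z : V) (omega eta : {ffun V -> bool}).
Implicit Types f : {ffun V -> bool} -> R.

Definition fupd omega x t : {ffun V -> bool} :=
  [ffun y => if y == x then t else omega y].

Lemma fupd_id omega x : fupd omega x (omega x) = omega.
Proof. by apply/ffunP => y; rewrite ffunE; case: eqP => // ->. Qed.

Lemma agree_offP A eta omega :
  reflect (forall x, x \notin A -> omega x = eta x) (agree_off A eta omega).
Proof.
apply: (iffP forallP) => [H x xA|H x]; first by have := H x; rewrite xA => /eqP.
by apply/implyP => xA; rewrite H.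
Qed.

Lemma agree_off_refl A eta : agree_off A eta eta.
Proof. exact/agree_offP. Qed.

Lemma agree_off_sym A eta omega : agree_off A eta omega = agree_off A omega eta.
Proof. by apply/agree_offP/agree_offP => H x /H. Qed.

Lemma agree_off_trans A eta omega zeta :
  agree_off A eta omega -> agree_off A omega zeta -> agree_off A eta zeta.
Proof.
by move=> /agree_offP H1 /agree_offP H2; apply/agree_offP => x xA; rewrite H2 ?H1.
Qed.

Lemma agree_off_fupd A eta omega x t : x \in A ->
  agree_off A eta (fupd omega x t) = agree_off A eta omega.
Proof.
move=> xA; apply/agree_offP/agree_offP => H y yA; rewrite -(H y yA) ffunE ifN //;
  by apply: contraNneq yA => ->.
Qed.

Lemma ising_weight_gt0 A omega : 0 < ising_weight e beta h A omega.
Proof. exact: expR_gt0. Qed.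

Lemma partition_fun_gt0 A eta : 0 < partition_fun e beta h A eta.
Proof.
rewrite /partition_fun (bigD1 eta) ?agree_off_refl //=.
by rewrite ltr_pwDl ?ising_weight_gt0 // sumr_ge0 // => *; apply/ltW/ising_weight_gt0.
Qed.

Definition local_field omega x : R :=
  \sum_(y | e x y) spin R (omega y) + \sum_(y | e y x) spin R (omega y) + h.

(** With the spin at [x] replaced by 0 in [s0], the energy is a part free of [x] plus a part linear
    in that spin; the absence of loops excludes a quadratic term. *)
Lemma ising_weight_flip A omega x : irreflexive e -> x \in A ->
  ising_weight e beta h A (fupd omega x true) =
  ising_weight e beta h A (fupd omega x false)
  * expR (2 * beta * local_field omega x).
Proof.
move=> irr xA; rewrite /ising_weight -expRD; congr expR.
set B := (A :|: boundary e A)%SET.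
pose s0 y : R := if y == x then 0 else spin R (omega y).
pose c t : R := spin R t.
have sE t y : spin R (fupd omega x t y) = s0 y + (y == x)%:R * c t.
  rewrite ffunE /s0; case: eqP => _; first by rewrite add0r mul1r.
  by rewrite mul0r addr0.
have xB : x \in B by rewrite inE xA.
have nbB y : e x y || e y x -> y \in B.
  move=> exy; rewrite !inE; case: (boolP (y \in A)) => //= _.
  by apply/existsP; exists x; rewrite xA.
pose S0 := \sum_(z in B) \sum_(y in B | e z y) s0 z * s0 y.
have pair t : \sum_(z in B) \sum_(y in B | e z y)
    spin R (fupd omega x t z) * spin R (fupd omega x t y) =
    S0 + c t * (\sum_(y | e x y) spin R (omega y) + \sum_(y | e y x) spin R (omega y)).
  transitivity (\sum_(z in B) \sum_(y in B | e z y)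
     (s0 z * s0 y + c t * ((z == x)%:R * s0 y + (y == x)%:R * s0 z))).
    apply: eq_bigr => z _; apply: eq_bigr => y /andP[_ ezy]; rewrite !sE.
    case: (eqVneq z x) ezy => [->|_ _]; last by case: (y == x) => /=; ring.
    by case: (eqVneq y x) => [->|_ _]; [rewrite irr|move=> /=; ring].
  under eq_bigr do rewrite big_split /= -[X in _ + X]mulr_sumr.
  rewrite big_split /= -[X in _ + X]mulr_sumr; congr (_ + _ * _).
  under [LHS]eq_bigr do rewrite big_split /= -[X in X + _]mulr_sumr.
  rewrite big_split /=; congr (_ + _).
    rewrite (bigD1 x) //= eqxx mul1r [X in _ + X]big1 ?addr0; last first.
      by move=> z /andP[_ /negPf ->]; rewrite mul0r.
    apply: eq_big => [y|y /andP[_ exy]].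
      by apply: andb_idl => exy; rewrite nbB ?exy.
    by rewrite /s0 ifN //; apply: contraTneq exy => ->; rewrite irr.
  have -> : \sum_(z in B) \sum_(y in B | e z y) (y == x)%:R * s0 z =
      \sum_(z in B | e z x) s0 z.
    rewrite [RHS]big_mkcondr /=; apply: eq_bigr => z _.
    case: ifPn => ezx; last first.
      rewrite big1 // => y /andP[_ ezy]; case: eqVneq ezy => [->|_ _].
        by rewrite (negPf ezx).
      by rewrite mul0r.
    rewrite (bigD1 x) /= ?xB // eqxx mul1r big1 ?addr0 // => y /andP[_ /negPf ->].
    by rewrite mul0r.
  apply: eq_big => [y|y /andP[_ exy]].
    by apply: andb_idl => exy; rewrite nbB ?exy ?orbT.
  by rewrite /s0 ifN //; apply: contraTneq exy => ->; rewrite irr.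
pose M0 := \sum_(z in A) s0 z.
have mag t : \sum_(z in A) spin R (fupd omega x t z) = M0 + c t.
  under eq_bigr do rewrite sE; rewrite big_split /=; congr (_ + _).
  rewrite (bigD1 x) //= eqxx mul1r big1 ?addr0 // => z /andP[_ /negPf ->].
  by rewrite mul0r.
rewrite !pair !mag /local_field /c /spin /=; ring.
Qed.

(** Moves from [eta] to [omega] one vertex at a time. This is how a product density and a Boltzmann
    weight are compared without expanding the energy. *)
Lemma ratio_of_flips A (nu w : {ffun V -> bool} -> R) eta omega :
  (forall zeta, 0 < w zeta) ->
  (forall zeta x, agree_off A eta zeta -> x \in A ->
     nu (fupd zeta x true) * w (fupd zeta x false) =
     nu (fupd zeta x false) * w (fupd zeta x true)) ->
  agree_off A eta omega -> nu eta * w omega = nu omega * w eta.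
Proof.
move=> w0 flip ao.
pose mix (s : seq V) : {ffun V -> bool} :=
  [ffun y => if y \in s then omega y else eta y].
suff H (s : seq V) : {subset s <= A} ->
    agree_off A eta (mix s) /\ nu eta * w (mix s) = nu (mix s) * w eta.
  have <- : mix (enum A) = omega.
    apply/ffunP => y; rewrite ffunE mem_enum; case: ifPn => // yA.
    by have /agree_offP -> := ao.
  by have [|] := H (enum A) => // y; rewrite mem_enum.
elim: s => [|x s IH] sA.
  have -> : mix [::] = eta by apply/ffunP => y; rewrite ffunE.
  by rewrite agree_off_refl mulrC.
have xA : x \in A by rewrite sA // mem_head.
have {IH} [aom IH] := IH (fun y ys => sA y (mem_behead (s := x :: s) ys)).
have -> : mix (x :: s) = fupd (mix s) x (omega x).
  apply/ffunP => y; rewrite !ffunE in_cons.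
  by case: eqP => [->|]; rewrite ?ffunE.
split; first by rewrite agree_off_fupd.
have fl t t' : nu (fupd (mix s) x t) * w (fupd (mix s) x t') =
               nu (fupd (mix s) x t') * w (fupd (mix s) x t).
  by case: t; case: t' => //; rewrite flip.
have {fl} := fl (mix s x) (omega x); rewrite fupd_id => fl.
have wm := w0 (mix s); apply: (mulIf (lt0r_neq0 wm)).
by rewrite mulrAC IH mulrAC fl mulrAC.
Qed.

Lemma gibbs_eq A (nu : {ffun V -> bool} -> R) eta omega :
  (forall zeta zeta' : {ffun V -> bool}, agree_off A eta zeta ->
    agree_off A eta zeta' ->
    nu zeta * ising_weight e beta h A zeta' =
    nu zeta' * ising_weight e beta h A zeta) ->
  \sum_(zeta | agree_off A eta zeta) nu zeta = 1 ->
  agree_off A eta omega -> gibbs e beta h A eta omega = nu omega.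
Proof.
move=> prop nu1 ao; rewrite /gibbs ao.
have Z0 := partition_fun_gt0 A eta.
apply: (mulIf (lt0r_neq0 Z0)); rewrite divfK ?gt_eqF // /partition_fun mulr_sumr.
under eq_bigr => zeta azeta do rewrite prop //.
by rewrite -mulr_suml nu1 mul1r.
Qed.

Lemma gibbs_meanE A eta f :
  gibbs_mean e beta h A eta f =
  \sum_(omega | agree_off A eta omega) gibbs e beta h A eta omega * f omega.
Proof.
rewrite /gibbs_mean [RHS]big_mkcond; apply: eq_bigr => omega _.
by rewrite /gibbs; case: ifP => // _; rewrite mul0r.
Qed.

Lemma gibbs_ge0 A eta omega : 0 <= gibbs e beta h A eta omega.
Proof.
rewrite /gibbs; case: ifP => // _; apply/ltW/divr_gt0.
  exact: ising_weight_gt0.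
exact: partition_fun_gt0.
Qed.

Lemma gibbs_mean_le A eta f g : (forall omega, f omega <= g omega) ->
  gibbs_mean e beta h A eta f <= gibbs_mean e beta h A eta g.
Proof.
by move=> fg; apply: ler_sum => omega _; rewrite ler_wpM2l // gibbs_ge0.
Qed.

Lemma gibbs_meanZ A eta (k : R) f :
  gibbs_mean e beta h A eta (fun omega => k * f omega) =
  k * gibbs_mean e beta h A eta f.
Proof.
by rewrite /gibbs_mean mulr_sumr; apply: eq_bigr => omega _; rewrite mulrCA.
Qed.

Lemma gibbs_sum1 A eta :
  \sum_(omega | agree_off A eta omega) gibbs e beta h A eta omega = 1.
Proof.
have Z0 := partition_fun_gt0 A eta; rewrite -[RHS](divff (lt0r_neq0 Z0)).
rewrite [X in _ = X / _]/partition_fun mulr_suml; apply: eq_bigr => omega ao.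
by rewrite /gibbs ao.
Qed.

(** With odds [o] of + at [x], the variance is [o / (1 + o) ^+ 2] times the squared difference, and
    [(1 + o) ^+ 2 <= 4 * O * o] when [o] lies between [O^-1] and [O]. *)
Lemma gibbs_var1_ge (O : R) eta x f : irreflexive e -> 0 <= beta -> 1 <= O ->
  expR (2 * beta * `|local_field eta x|) <= O ->
  (4 * O)^-1 * (f (fupd eta x true) - f (fupd eta x false)) ^+ 2 <=
  gibbs_var e beta h [set x] eta f.
Proof.
move=> irr beta0 O1 fieldO.
have aoE omega : agree_off [set x] eta omega =
    (omega == fupd eta x true) || (omega == fupd eta x false).
  apply/agree_offP/orP => [H|[] /eqP -> y].
  - case E : (omega x); [left|right]; apply/eqP/ffunP => y; rewrite ffunE;
      by case: eqP => [->//|/eqP ne]; apply: H; rewrite inE.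
  - by rewrite inE ffunE => /negPf ->.
  - by rewrite inE ffunE => /negPf ->.
have neq : fupd eta x true != fupd eta x false.
  by apply/eqP => /ffunP /(_ x); rewrite !ffunE eqxx.
have sumE (F : {ffun V -> bool} -> R) : \sum_(omega | agree_off [set x] eta omega) F omega
    = F (fupd eta x true) + F (fupd eta x false).
  rewrite (bigD1 (fupd eta x true)) /= ?aoE ?eqxx //; congr (_ + _).
  rewrite (big_pred1 (fupd eta x false)) // => omega; rewrite aoE /=.
  case: (eqVneq omega (fupd eta x false)) => [->|]; first by rewrite orbT eq_sym neq.
  by rewrite orbF andbN.
rewrite /gibbs_var !gibbs_meanE !sumE /gibbs !aoE !eqxx orbT /= /partition_fun !sumE.
have := @ising_weight_flip [set x] eta x irr (set11 x).
have := ising_weight_gt0 [set x] (fupd eta x true).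
have := ising_weight_gt0 [set x] (fupd eta x false).
set v := ising_weight _ _ _ _ (fupd eta x false).
set w := ising_weight _ _ _ _ (fupd eta x true).
move: (f (fupd eta x true)) (f (fupd eta x false)) => u z.
set o := expR _ => v0 w0 we.
have o0 : 0 < o by apply: expR_gt0.
have oO : o <= O.
  apply: le_trans fieldO; rewrite ler_expR ler_wpM2l ?mulr_ge0 //.
  exact: ler_norm.
have oiO : 1 <= O * o.
  rewrite -ler_pdivrMr // div1r; apply: le_trans fieldO.
  rewrite -expRN ler_expR -mulrN ler_wpM2l ?mulr_ge0 //.
  by rewrite -normrN ler_norm.
have wv0 : 0 < w + v by rewrite addr_gt0.
have -> : w / (w + v) * u ^+ 2 + v / (w + v) * z ^+ 2
    - (w / (w + v) * u + v / (w + v) * z) ^+ 2 =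
    w * v / (w + v) ^+ 2 * (u - z) ^+ 2.
  by field; rewrite gt_eqF.
apply: ler_wpM2r; first exact: sqr_ge0.
have O0 : 0 < 4 * O by rewrite mulr_gt0 // (lt_le_trans ltr01).
rewrite -div1r ler_pdivrMr // mulrAC ler_pdivlMr ?exprn_gt0 // mul1r.
rewrite we.
have : 0 <= v ^+ 2 * (4 * O * o - (o + 1) ^+ 2).
  rewrite mulr_ge0 ?sqr_ge0 //.
  have := ler_wpM2r (ltW o0) oO; have := ler_wpM2r (ltW o0) O1; lra.
lra.
Qed.

Lemma gibbs_gt0 A eta omega : agree_off A eta omega -> 0 < gibbs e beta h A eta omega.
Proof.
by move=> ao; rewrite /gibbs ao divr_gt0 ?ising_weight_gt0 ?partition_fun_gt0.
Qed.

Lemma gibbs_varE A eta f :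
  gibbs_var e beta h A eta f =
  gibbs_mean e beta h A eta (fun omega => (f omega - gibbs_mean e beta h A eta f) ^+ 2).
Proof.
have E k : gibbs_mean e beta h A eta (fun omega => (f omega - k) ^+ 2) =
    gibbs_mean e beta h A eta (fun omega => f omega ^+ 2)
    - 2 * k * gibbs_mean e beta h A eta f
    + k ^+ 2 * \sum_(omega | agree_off A eta omega) gibbs e beta h A eta omega.
  rewrite !gibbs_meanE !mulr_sumr -sumrB -big_split /=.
  by apply: eq_bigr => omega _; ring.
by rewrite E gibbs_sum1 /gibbs_var; ring.
Qed.

Lemma gibbs_var_gt0 A eta f : nonconstant_on_Omega A eta f ->
  0 < gibbs_var e beta h A eta f.
Proof.
move=> [s [s' [as1 as2 ne]]]; rewrite gibbs_varE gibbs_meanE.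
set k := gibbs_mean _ _ _ _ _ _.
have [w aw wk] : exists2 w, agree_off A eta w & f w != k.
  case: (eqVneq (f s) k) => [e1|]; last by exists s.
  by exists s' => //; rewrite -e1; apply/eqP => /esym.
rewrite (bigD1 w) //= ltr_pwDl //.
  by rewrite mulr_gt0 ?gibbs_gt0 // exprn_even_gt0 //= subr_eq0.
by apply: sumr_ge0 => *; rewrite mulr_ge0 ?gibbs_ge0 ?sqr_ge0.
Qed.

End Flip.

(** * The rooted tree *)

Section Tree.
Variable b : nat.
Notation word := (seq 'I_b).
Implicit Types (u v w : word) (x y z : option word).

(* [None] plays the part of a parent of the root [Some [::]]. *)
Definition tpar x : option word := if x is Some (_ :: u) then Some u else None.

Definition tlev x : nat := if x is Some u then (size u).+1 else 0.

Lemma tlev_par x : tlev (tpar x) = (tlev x).-1.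
Proof. by case: x => [[|i u]|]. Qed.

Lemma tpar_neq u : tpar (Some u) != Some u.
Proof.
by case: u => // i u; apply/eqP => -[/(congr1 size) /= /eqP]; rewrite ltn_eqF.
Qed.

Fixpoint words k : seq word :=
  if k is k'.+1 then [seq i :: u | i <- enum 'I_b, u <- words k'] else [:: [::]].

Lemma mem_words k u : (u \in words k) = (size u == k).
Proof.
elim: k u => [|k IH] u /=; first by case: u.
apply/allpairsP/idP => [[[i v] /= [_ vk ->]] /=|]; first by rewrite eqSS -IH.
case: u => // i u; rewrite eqSS -IH => uk.
by exists (i, u); rewrite mem_enum.
Qed.

Lemma words_uniq k : uniq (words k).
Proof.
elim: k => //= k IH; apply: allpairs_uniq => //; first exact: enum_uniq.
by move=> [i u] [j v] _ _ /= [-> ->].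
Qed.

Fixpoint words_le m : seq word :=
  if m is m'.+1 then words_le m' ++ words m else words 0.

Lemma mem_words_le m u : (u \in words_le m) = (size u <= m)%N.
Proof.
elim: m => [|m IH]; first by rewrite mem_words leqn0.
by rewrite mem_cat IH mem_words [RHS]leq_eqVlt ltnS orbC.
Qed.

Lemma words_le_uniq m : uniq (words_le m).
Proof.
elim: m => // m IH; rewrite cat_uniq IH words_uniq andbT.
apply/hasPn => u; rewrite mem_words => /eqP su.
by rewrite mem_words_le su -ltnNge.
Qed.

(** Level by level, so that parents come first and the list for a smaller depth is a prefix. *)
Definition nodes m : seq (option word) := map Some (words_le m).

Lemma nodesS m : nodes m.+1 = nodes m ++ map Some (words m.+1).
Proof. by rewrite /nodes map_cat. Qed.

Lemma mem_nodes m x : (x \in nodes m) = (0 < tlev x <= m.+1)%N.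
Proof.
case: x => [u|]; first by rewrite (mem_map (@Some_inj _)) mem_words_le.
by apply/negP => /mapP[].
Qed.

Lemma nodes_uniq m : uniq (nodes m).
Proof. by rewrite (map_inj_uniq (@Some_inj _)) words_le_uniq. Qed.

Lemma ordered_cat (l1 l2 : seq (option word)) :
  ordered tpar l1 -> ordered tpar l2 ->
  {in l1, forall x, x \notin l2 /\ tpar x \notin l2} ->
  ordered tpar (l1 ++ l2).
Proof.
elim: l1 => //= x l1 IH /and4P[xl pxx pl o1] o2 H.
have [x2 p2] := H x (mem_head _ _).
rewrite !mem_cat !negb_or xl pxx pl x2 p2 IH // => y yl.
by apply: H; rewrite in_cons yl orbT.
Qed.

Lemma ordered_words k : ordered tpar (map Some (words k)).
Proof.
have : uniq (map Some (words k)).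
  by rewrite (map_inj_uniq (@Some_inj _)) words_uniq.
have : all (fun x => tlev x == k.+1) (map Some (words k)).
  by apply/allP => _ /mapP[u + ->]; rewrite mem_words.
elim: (map _ _) => //= x l IH /andP[/eqP lx al] /andP[xl ul].
have np y : tlev y = k.+1 -> tpar x != y.
  by move=> ly; apply/eqP => /(congr1 tlev); rewrite tlev_par lx ly /=; lia.
rewrite xl np //= IH // andbT; apply/negP => pl.
by have := allP al _ pl => /eqP /np; rewrite eqxx.
Qed.

Lemma ordered_nodes m : ordered tpar (nodes m).
Proof.
elim: m => [|m IH]; first exact: ordered_words.
rewrite /nodes /= map_cat; apply: ordered_cat => //; first exact: ordered_words m.+1.
move=> x; rewrite mem_nodes => /andP[_ lx].
have nw y : (tlev y <= m.+1)%N -> y \notin map Some (words m.+1).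
  move=> ly; apply/negP => /mapP[u]; rewrite mem_words => /eqP su yu.
  by move: ly; rewrite yu /= su ltnn.
by split; apply: nw => //; rewrite tlev_par; lia.
Qed.

Lemma children_perm m u : (size u < m)%N ->
  perm_eq (seq.filter (fun y => tpar y == Some u) (nodes m))
          [seq Some (i :: u) | i <- enum 'I_b].
Proof.
move=> um; apply: uniq_perm.
- exact/filter_uniq/nodes_uniq.
- by rewrite map_inj_uniq ?enum_uniq // => i j [].
move=> y; rewrite mem_filter mem_nodes; apply/andP/mapP => [[]|[i _ ->]].
  by case: y => [[|i v]|] //= /eqP [->] _; exists i; rewrite ?mem_enum.
by rewrite /= eqxx.
Qed.

Lemma children_leaf m u : size u = m ->
  seq.filter (fun y => tpar y == Some u) (nodes m) = [::].
Proof.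
move=> um; apply/eqP; rewrite -(negbK (_ == _)) -has_filter; apply/hasPn => y.
rewrite mem_nodes => /andP[_ ly]; apply/eqP => /(congr1 tlev).
by rewrite tlev_par /= um; lia.
Qed.

Lemma count_children m z : (0 < b)%N ->
  (count (fun y => tpar y == z) (nodes m) <= b)%N.
Proof.
move=> b0; rewrite -size_filter; case: z => [u|].
  apply: (@leq_trans (size [seq Some (i :: u) | i <- enum 'I_b])).
    apply: uniq_leq_size; first exact/filter_uniq/nodes_uniq.
    move=> [[|i v]|]; rewrite mem_filter //= => /andP[/eqP [->] _].
    by apply: map_f; rewrite mem_enum.
  by rewrite size_map size_enum_ord.
apply: leq_trans b0; apply: (@uniq_leq_size _ _ [:: Some [::]]).
  exact/filter_uniq/nodes_uniq.
by move=> [[|i v]|]; rewrite mem_filter ?inE //= mem_nodes.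
Qed.

Lemma iter_tpar j y u : iter j tpar y = Some u ->
  exists2 w, y = Some (w ++ u) & size w = j.
Proof.
elim: j u => [|j IH] u /=; first by move=> ->; exists [::].
case E : (iter j tpar y) => [[|i v]|] //= [vu].
have [w -> <-] := IH _ E; exists (rcons w i); last by rewrite size_rcons.
by rewrite cat_rcons vu.
Qed.

Lemma count_anc m k x : x \in nodes m ->
  (count (anc tpar k x) (nodes m) <= size (words_le k))%N.
Proof.
case: x => [u _|]; last by rewrite mem_nodes.
rewrite -size_filter -(size_map (fun w => Some (w ++ u))).
apply: uniq_leq_size; first exact/filter_uniq/nodes_uniq.
move=> y; rewrite mem_filter => /andP[/trajectP[j jk e] _].
have [w -> sw] := iter_tpar (esym e); apply: map_f.
by rewrite mem_words_le sw ltnW.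
Qed.

End Tree.

(** * The recursion for the ratio of the weights of + and - at a vertex *)

Section Recursion.
Local Open Scope classical_set_scope.
Local Open Scope ring_scope.
Variables (R : realType) (a : R).
Hypothesis a_ge1 : 1 <= a.
Implicit Types x y : R.

(* [x] is the ratio of the weights of + and - at a vertex, its parent being
   ignored, and [a = exp (2 beta)]. *)
Definition cav x : R := (a * x + 1) / (x + a).

Definition pcond x (s : bool) : R := if s then a * x / (a * x + 1) else x / (x + a).

(** The difference [pcond x true - pcond x false], and also the derivative of the logarithm of [cav]
    with respect to that of [x]. *)
Definition influ x : R := (a ^+ 2 - 1) * x / ((a * x + 1) * (x + a)).

Lemma pcondB x t s : 0 < x -> `|pcond x t - pcond x s| <= influ x.
Proof.
move=> x0; have a0 := lt_le_trans ltr01 a_ge1.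
have ax : 0 < a * x + 1 by rewrite addr_gt0 ?mulr_gt0.
have xa : 0 < x + a by rewrite addr_gt0.
have i0 : 0 <= influ x.
  by rewrite divr_ge0 ?mulr_ge0 ?(ltW x0) ?(ltW ax) ?(ltW xa) // subr_ge0 exprn_ege1.
have e : pcond x true - pcond x false = influ x.
  by rewrite /pcond /influ; field; rewrite !gt_eqF.
case: t; case: s; rewrite ?subrr ?normr0 //; first by rewrite e ger0_norm.
by rewrite distrC e ger0_norm.
Qed.

Lemma pcond_mono x : 0 < x -> pcond x false <= pcond x true.
Proof.
move=> x0; have a0 := lt_le_trans ltr01 a_ge1.
have ax : 0 < a * x + 1 by rewrite addr_gt0 ?mulr_gt0.
have xa : 0 < x + a by rewrite addr_gt0.
rewrite /pcond ler_pdivrMr // mulrAC ler_pdivlMr //.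
have : 1 <= a * a by rewrite mulr_ege1.
by nra.
Qed.

Lemma pcond_odds x : 0 < x ->
  (1 - pcond x false) * pcond x true <=
  (1 + (a ^+ 2 - 1)) * (pcond x false * (1 - pcond x true)).
Proof.
move=> x0; have a0 := lt_le_trans ltr01 a_ge1.
have ax : 0 < a * x + 1 by rewrite addr_gt0 ?mulr_gt0.
have xa : 0 < x + a by rewrite addr_gt0.
suff -> : (1 - pcond x false) * pcond x true =
  (1 + (a ^+ 2 - 1)) * (pcond x false * (1 - pcond x true)) by [].
by rewrite /pcond; field; rewrite !gt_eqF.
Qed.

(** For [a = expR (2 * beta)] this is tanh beta. *)
Definition gam : R := (a - 1) / (a + 1).

Lemma gam_ge0 : 0 <= gam.
Proof. by rewrite divr_ge0 ?subr_ge0 // addr_ge0 // (le_trans ler01). Qed.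

Lemma gam_lt1 : gam < 1.
Proof.
have a0 := lt_le_trans ltr01 a_ge1.
by rewrite ltr_pdivrMr ?addr_gt0 //; lra.
Qed.

(** The difference of the two sides is a nonnegative multiple of [(x - L) ^+ 2]; the worst density
    is [L = x]. *)
Lemma pcond_gam x (L : R) : 0 < x -> 0 < L ->
  ((1 - pcond x false) * pcond x true - pcond x false * (1 - pcond x true)) * L <=
  gam * ((pcond x false + (1 - pcond x false) * L)
         * (pcond x true + (1 - pcond x true) * L)).
Proof.
move=> x0 L0; have a0 := lt_le_trans ltr01 a_ge1.
have ax : 0 < a * x + 1 by rewrite addr_gt0 ?mulr_gt0.
have xa : 0 < x + a by rewrite addr_gt0.
have a1 : 0 < a + 1 by rewrite addr_gt0.
rewrite -subr_ge0.
have -> : gam * ((pcond x false + (1 - pcond x false) * L)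
         * (pcond x true + (1 - pcond x true) * L)) -
  ((1 - pcond x false) * pcond x true - pcond x false * (1 - pcond x true)) * L
  = (a - 1) * a * (x - L) ^+ 2 / ((a + 1) * ((x + a) * (a * x + 1))).
  by rewrite /gam /pcond; field; rewrite !gt_eqF.
have den := ltW (mulr_gt0 a1 (mulr_gt0 xa ax)).
apply: divr_ge0 den; apply: mulr_ge0 (sqr_ge0 _).
by rewrite mulr_ge0 ?subr_ge0 // ltW.
Qed.

Lemma influ_le_gam x : 0 < x -> influ x <= gam.
Proof.
move=> x0; have a0 := lt_le_trans ltr01 a_ge1.
have ax : 0 < a * x + 1 by rewrite addr_gt0 ?mulr_gt0.
have xa : 0 < x + a by rewrite addr_gt0.
have a1 : 0 < a + 1 by rewrite addr_gt0.
rewrite -subr_ge0.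
have -> : gam - influ x = (a - 1) * a * (x - 1) ^+ 2 / ((a + 1) * ((x + a) * (a * x + 1))).
  by rewrite /gam /influ; field; rewrite !gt_eqF.
have den := ltW (mulr_gt0 a1 (mulr_gt0 xa ax)).
apply: divr_ge0 den; apply: mulr_ge0 (sqr_ge0 _).
by rewrite mulr_ge0 ?subr_ge0 // ltW.
Qed.

Lemma cav_gt0 x : 0 < x -> 0 < cav x.
Proof.
move=> x0; have a0 := lt_le_trans ltr01 a_ge1.
by rewrite divr_gt0 ?addr_gt0 ?mulr_gt0.
Qed.

Lemma cavB x y : 0 < x -> 0 < y ->
  cav y - cav x = (a ^+ 2 - 1) * (y - x) / ((y + a) * (x + a)).
Proof.
move=> x0 y0; have a0 := lt_le_trans ltr01 a_ge1.
by rewrite /cav; field; rewrite !gt_eqF ?addr_gt0.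
Qed.

Lemma ler_cav x y : 0 < x -> x <= y -> cav x <= cav y.
Proof.
move=> x0 xy; have y0 := lt_le_trans x0 xy; have a0 := lt_le_trans ltr01 a_ge1.
rewrite -subr_ge0 cavB // divr_ge0 ?mulr_ge0 ?subr_ge0 ?exprn_ege1 //.
by rewrite !addr_ge0 // ltW.
by rewrite !addr_ge0 // ltW.
Qed.

Lemma cav_bounds x : 0 < x -> a^-1 <= cav x <= a.
Proof.
move=> x0; have a0 := lt_le_trans ltr01 a_ge1.
have aa : 1 <= a * a by rewrite mulr_ege1.
rewrite -div1r ler_pdivrMr // /cav mulrAC ler_pdivlMr ?addr_gt0 //.
by rewrite ler_pdivrMr ?addr_gt0 //; apply/andP; split; nra.
Qed.

Variables (lam : R) (b : nat).
Hypothesis lam_gt0 : 0 < lam.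

Definition phi x : R := lam * cav x ^+ b.

Lemma phi_gt0 x : 0 < x -> 0 < phi x.
Proof. by move=> x0; rewrite mulr_gt0 // exprn_gt0 // cav_gt0. Qed.

Lemma ler_phi x y : 0 < x -> x <= y -> phi x <= phi y.
Proof.
move=> x0 xy; rewrite ler_wpM2l ?(ltW lam_gt0) // lerXn2r ?nnegrE ?ler_cav //.
  by rewrite ltW // cav_gt0.
by rewrite ltW // cav_gt0 // (lt_le_trans x0).
Qed.

(** The starting values of [hi] and [lo] are the ratios above an all + and an all - boundary, and
    also the limits of [phi] at infinity and at 0. Hence the two sequences are monotone. *)
Definition hi k : R := iter k phi (lam * a ^+ b).
Definition lo k : R := iter k phi (lam * a^-1 ^+ b).

Lemma phi_bounds x : 0 < x -> lo 0 <= phi x <= hi 0.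
Proof.
move=> x0; have a0 := lt_le_trans ltr01 a_ge1.
have /andP[c1 c2] := cav_bounds x0.
by rewrite !ler_wpM2l ?(ltW lam_gt0) // lerXn2r ?nnegrE ?invr_ge0 ?(ltW a0)
  ?(ltW (cav_gt0 x0)).
Qed.

Lemma lo_gt0 k : 0 < lo k.
Proof.
elim: k => [|k IH]; last exact: phi_gt0.
by rewrite mulr_gt0 // exprn_gt0 // invr_gt0 (lt_le_trans ltr01).
Qed.

Lemma hi_gt0 k : 0 < hi k.
Proof.
elim: k => [|k IH]; last exact: phi_gt0.
by rewrite mulr_gt0 // exprn_gt0 // (lt_le_trans ltr01).
Qed.

Lemma hiS_le k : hi k.+1 <= hi k.
Proof.
elim: k => [|k IH]; first by have /andP[] := phi_bounds (hi_gt0 0).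
exact: ler_phi (hi_gt0 _) IH.
Qed.

Lemma loS_ge k : lo k <= lo k.+1.
Proof.
elim: k => [|k IH]; first by have /andP[] := phi_bounds (lo_gt0 0).
exact: ler_phi (lo_gt0 _) IH.
Qed.

Lemma lo_le_hi k : lo k <= hi k.
Proof.
elim: k => [|k IH]; last exact: ler_phi (lo_gt0 _) IH.
by have /andP[/le_trans] := phi_bounds ltr01; exact.
Qed.

Lemma hi_noninc : {homo hi : m n / (m <= n)%N >-> n <= m}.
Proof. by apply/nonincreasing_seqP => k; apply: hiS_le. Qed.

Lemma lo_nondec : {homo lo : m n / (m <= n)%N >-> m <= n}.
Proof. by apply/nondecreasing_seqP => k; apply: loS_ge. Qed.

Lemma hi_cvg : cvgn hi.
Proof.
apply: nonincreasing_is_cvgn; first exact: hi_noninc.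
by exists 0 => _ [k _ <-]; apply/ltW/hi_gt0.
Qed.

Lemma lo_cvg : cvgn lo.
Proof.
apply: nondecreasing_is_cvgn; first exact: lo_nondec.
exists (hi 0) => _ [k _ <-]; apply: le_trans (lo_le_hi k) _.
exact: hi_noninc.
Qed.

Definition hi_lim : R := limn hi.
Definition lo_lim : R := limn lo.

Lemma lo_lim_gt0 : 0 < lo_lim.
Proof.
apply: lt_le_trans (lo_gt0 0) _.
exact: (nondecreasing_cvgn_le lo_nondec lo_cvg).
Qed.

Lemma lo_lim_le_hi_lim : lo_lim <= hi_lim.
Proof.
apply: ler_lim; [exact: lo_cvg|exact: hi_cvg|].
by near=> k; apply: lo_le_hi.
Unshelve. all: by end_near. Qed.

Lemma hi_lim_gt0 : 0 < hi_lim.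
Proof. exact: lt_le_trans lo_lim_gt0 lo_lim_le_hi_lim. Qed.

Lemma cvg_cav (u : R ^nat) x : 0 < x -> u @ \oo --> x ->
  (fun k => cav (u k)) @ \oo --> cav x.
Proof.
move=> x0 ux; rewrite /cav; apply: cvgM.
  by apply: cvgD; [apply: cvgM => //; exact: cvg_cst|exact: cvg_cst].
apply: cvgV; first by rewrite gt_eqF // addr_gt0 // (lt_le_trans ltr01).
by apply: cvgD => //; exact: cvg_cst.
Qed.

Lemma cvg_phi (u : R ^nat) x : 0 < x -> u @ \oo --> x ->
  (fun k => phi (u k)) @ \oo --> phi x.
Proof.
move=> x0 ux; rewrite /phi; apply: cvgM; first exact: cvg_cst.
apply: (@continuous_cvg _ _ _ _ _ _ (fun y : R => y ^+ b)).
  exact: exprn_continuous.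
exact: cvg_cav.
Qed.

Lemma phi_hi_lim : phi hi_lim = hi_lim.
Proof.
apply: (@cvg_unique R (@norm_hausdorff _ R) ((fun k => hi k.+1) @ \oo)).
  exact: cvg_phi hi_lim_gt0 hi_cvg.
by have := hi_cvg; rewrite -(cvg_shiftS hi).
Qed.

Lemma phi_lo_lim : phi lo_lim = lo_lim.
Proof.
apply: (@cvg_unique R (@norm_hausdorff _ R) ((fun k => lo k.+1) @ \oo)).
  exact: cvg_phi lo_lim_gt0 lo_cvg.
by have := lo_cvg; rewrite -(cvg_shiftS lo).
Qed.

(* If [hi k] decreases to [y], the slope of [phi] at [y] is at most 1; this is
   Bernoulli's inequality for [phi (hi k) / phi y = (cav (hi k) / cav y) ^+ b]. *)
Lemma influ_hi_lim : (0 < b)%N -> b%:R * influ hi_lim <= 1.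
Proof.
move=> b0; have a0 := lt_le_trans ltr01 a_ge1.
set y := hi_lim; have y0 : 0 < y := hi_lim_gt0.
have ay : 0 < a * y + 1 by rewrite addr_gt0 ?mulr_gt0.
have ya : 0 < y + a by rewrite addr_gt0.
(* Without interaction [phi] is constant and [hi k] equals its limit, so the division by [hi k - y]
   below needs [1 < a]. *)
move: a_ge1; rewrite le_eqVlt => /predU1P[a1|a1].
  by rewrite /influ -a1 expr1n subrr !mul0r mulr0.
have aa : 0 < a ^+ 2 - 1 by rewrite subr_gt0 exprn_egt1.
have yhi k : y < hi k.
  elim: k => [|k IH]; rewrite -[y]phi_hi_lim -/y /hi /= ?ltr_pM2l //;
    rewrite ltrXn2r ?nnegrE ?(ltW a0) ?(ltW (cav_gt0 _)) ?hi_gt0 -?lt0n //.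
    rewrite -subr_gt0.
    have -> : a - cav y = (a ^+ 2 - 1) / (y + a).
      by rewrite /cav; field; rewrite gt_eqF.
    exact: divr_gt0.
  have h0 := hi_gt0 k; rewrite -subr_gt0 cavB //.
  have num : 0 < (a ^+ 2 - 1) * (hi k - y) by rewrite mulr_gt0 // subr_gt0.
  exact: divr_gt0 num (mulr_gt0 (addr_gt0 h0 a0) ya).
have step k : b%:R * (a ^+ 2 - 1) * y <= (hi k + a) * (a * y + 1).
  have h0 := hi_gt0 k; have hy : 0 < hi k - y by rewrite subr_gt0.
  have ha : 0 < hi k + a by rewrite addr_gt0.
  pose x := (a ^+ 2 - 1) * (hi k - y) / ((hi k + a) * (a * y + 1)).
  have x0 : 0 <= x by rewrite ltW // divr_gt0 ?mulr_gt0.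
  have ex : cav (hi k) = cav y * (1 + x).
    by rewrite /cav /x; field; rewrite !gt_eqF.
  have := hiS_le k; rewrite [hi k.+1]/= -/(hi k) /phi ex exprMn mulrA.
  rewrite -/(phi y) phi_hi_lim -/y => le1.
  have bern : 1 + b%:R * x <= (1 + x) ^+ b.
    elim: (b) => [|n IH]; first by rewrite mul0r addr0.
    rewrite exprS -natr1; have n0 : 0 <= n%:R :> R by [].
    have := ler_wpM2l (addr_ge0 ler01 x0) IH; apply: le_trans.
    have := mulr_ge0 n0 (mulr_ge0 x0 x0); lra.
  have := le_trans (ler_wpM2l (ltW y0) bern) le1.
  have -> : y * (1 + b%:R * x) = y + b%:R * (a ^+ 2 - 1) * y * (hi k - y)
      / ((hi k + a) * (a * y + 1)).
    by rewrite /x; field; rewrite !gt_eqF.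
  rewrite addrC -lerBrDr ler_pdivrMr ?mulr_gt0 // mulrC ler_pM2l //.
have lim : (hi k + a) * (a * y + 1) @[k --> \oo] --> (y + a) * (a * y + 1).
  apply: cvgM; last exact: cvg_cst.
  by apply: cvgD; [exact: hi_cvg|exact: cvg_cst].
have le : b%:R * (a ^+ 2 - 1) * y <= (y + a) * (a * y + 1).
  apply: ler_cvg_to (cvg_cst _) lim _.
  by near=> k; apply: step.
rewrite /influ mulrA ler_pdivrMr ?mulr_gt0 // mul1r; lra.
Unshelve. all: by end_near. Qed.

(** [influ] is not monotone, so its numerator is bounded at [hi k] and its denominator at [l k];
    both tend to their values at [hi_lim]. *)
Lemma influ_eventually (kap : R) (l : R ^nat) : (0 < b)%N -> 1 < b%:R * kap ->
  (forall k, 0 < l k) -> l @ \oo --> hi_lim ->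
  exists M, forall k x, (M <= k)%N -> l k <= x <= hi k -> influ x <= kap.
Proof.
move=> b0 bkap l0 lcvg; have a0 := lt_le_trans ltr01 a_ge1.
have y0 := hi_lim_gt0.
have lim : (a ^+ 2 - 1) * hi k / ((a * l k + 1) * (l k + a)) @[k --> \oo] -->
    influ hi_lim.
  apply: cvgM; first by apply: cvgM; [exact: cvg_cst|exact: hi_cvg].
  apply: cvgV; first by rewrite gt_eqF // mulr_gt0 // addr_gt0 // mulr_gt0.
  apply: cvgM; apply: cvgD => //; try exact: cvg_cst.
  by apply: cvgM => //; exact: cvg_cst.
have lt_kap : influ hi_lim < kap.
  have b0' : 0 < b%:R :> R by rewrite ltr0n.
  by rewrite -(ltr_pM2l b0'); apply: le_lt_trans (influ_hi_lim b0) bkap.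
have [M _ HM] := cvgr_lt _ lim _ lt_kap.
exists M => k x Mk /andP[lx xh]; apply: le_trans (ltW (HM k Mk)).
have x0 := lt_le_trans (l0 k) lx; have lk0 := l0 k.
have aa : 0 <= a ^+ 2 - 1 by rewrite subr_ge0 exprn_ege1.
have pos z : 0 < z -> 0 < (a * z + 1) * (z + a).
  by move=> z0; rewrite mulr_gt0 ?addr_gt0 ?mulr_gt0.
apply: ler_pM.
- exact: mulr_ge0 aa (ltW x0).
- by rewrite invr_ge0 ltW // pos.
- exact: ler_wpM2l.
rewrite lef_pV2 ?posrE ?pos // ler_pM ?addr_ge0 ?mulr_ge0 ?(ltW a0) ?(ltW lk0) //.
  by rewrite lerD2r ler_wpM2l // ltW.
by rewrite lerD2r.
Qed.

End Recursion.

(** With [rho = s * s], one power of [s] offsets the linear factor, as [n.+1%:R * s ^+ n] is at most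
    the full geometric sum, and the other makes the product small. *)
Lemma exists_expr_le (R : realType) (rho C : R) (M : nat) :
  0 <= rho < 1 -> 0 <= C -> exists n, C * rho ^+ n * (n + M).+2%:R <= 1.
Proof.
move=> /andP[rho0 rho1] C0; pose s := Num.sqrt rho.
have s0 : 0 <= s by apply: sqrtr_ge0.
have s1 : s < 1 by rewrite -[ltRHS]sqrtr1 ltr_sqrt.
have s1' : 0 < 1 - s by rewrite subr_gt0.
have rhoE : rho = s * s by rewrite -expr2 sqr_sqrtr.
have geo n : n.+1%:R * s ^+ n <= (1 - s)^-1.
  rewrite -div1r ler_pdivlMr //; apply: (@le_trans _ _ (1 - s ^+ n.+1)).
    rewrite -[leRHS]opprB subrX1 -mulNr opprB mulrC ler_wpM2l ?(ltW s1') //.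
    rewrite mulr_natl -[n.+1 in leLHS]card_ord -sumr_const; apply: ler_sum => i _.
    by rewrite ler_wiXn2l ?(ltW s1) // -ltnS.
  by rewrite gerBl exprn_ge0.
have eps0 : 0 < (C * M.+2%:R + 1)^-1 * (1 - s).
  by rewrite mulr_gt0 // invr_gt0 ltr_wpDl // mulr_ge0.
have s1n : `|s| < 1 by rewrite ger0_norm.
have [n _ sn] := cvgr_lt _ (cvg_expr s1n) _ eps0.
exists n; have {sn} := ltW (sn n (leqnn n)); rewrite /= rhoE exprMn.
have X0 : 0 <= s ^+ n by rewrite exprn_ge0.
have D0 : 0 < C * M.+2%:R + 1 by rewrite ltr_wpDl // mulr_ge0.
rewrite mulrC ler_pdivlMr // => sn.
have le1 : (n + M).+2%:R <= M.+2%:R * n.+1%:R :> R.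
  have -> : (n + M).+2 = (n.+1 + M.+1)%N by rewrite addSn addnS.
  by rewrite -natrM ler_nat mulSn leq_add2l leq_pmulr.
have := geo n; rewrite -[leRHS]div1r ler_pdivlMr // => gn.
have E0 : 0 <= C * (s ^+ n * s ^+ n) by rewrite !mulr_ge0.
apply: le_trans (ler_wpM2l E0 le1) _.
have -> : C * (s ^+ n * s ^+ n) * (M.+2%:R * n.+1%:R) =
  (s ^+ n * (C * M.+2%:R)) * (n.+1%:R * s ^+ n) by ring.
have Y0 : 0 <= s ^+ n * (C * M.+2%:R) by rewrite !mulr_ge0.
by rewrite -(ler_pM2r s1'); have := ler_wpM2l Y0 gn; lra.
Qed.

(** * The Ising model on a complete tree as a tree-indexed Markov chain *)

Section TreeChain.
Variables (R : realType) (b : nat) (a lam : R).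
Hypotheses (a_ge1 : 1 <= a) (lam_gt0 : 0 < lam).
Variable rt : seq 'I_b -> R.
Implicit Types (u v w : seq 'I_b) (x y z : option (seq 'I_b)).
Implicit Types (sigma : option (seq 'I_b) -> bool).

(* A root has no parent: there the interaction is replaced by [1 = exp 0]. *)
Definition coupling x : R := if x is Some (_ :: _) then a else 1.
Definition ratio x : R := if x is Some u then rt u else lam.
Definition tp x (s : bool) : R := pcond (coupling x) (ratio x) s.

Lemma coupling_bounds x : 1 <= coupling x <= a.
Proof. by case: x => [[|i u]|] /=; rewrite ?lexx ?a_ge1. Qed.

Definition apow (s : bool) : R := if s then a else a^-1.

Definition parent_apow sigma u : R :=
  if u is _ :: v then apow (sigma (Some v)) else 1.

Definition nu m sigma : R := \prod_(x <- nodes b m) prob (@tpar b) tp x (sigma x) sigma.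

Lemma a_gt0 : 0 < a. Proof. exact: lt_le_trans a_ge1. Qed.

Lemma prob_flip u sigma : 0 < rt u ->
  prob (@tpar b) tp (Some u) true sigma =
  prob (@tpar b) tp (Some u) false sigma * (parent_apow sigma u * rt u).
Proof.
have a0 := a_gt0; rewrite /prob /tp /pcond /=; move: (rt u) => x x0.
have ax : 0 < a * x + 1 by rewrite addr_gt0 ?mulr_gt0.
have xa : 0 < x + a by rewrite addr_gt0.
have x1 : 0 < x + 1 by rewrite addr_gt0.
case: u => [|i v] /=; first by case: (sigma None); field; rewrite ?gt_eqF // mul1r gt_eqF.
by rewrite /apow; case: (sigma (Some v)); field; rewrite !gt_eqF.
Qed.

(** [cav] is the ratio of the normalizations of the child's law under the two spins of its
    parent. *)
Lemma prob_child_flip i u t sigma : 0 < rt (i :: u) ->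
  prob (@tpar b) tp (Some (i :: u)) t (upd sigma (Some u) true) * cav a (rt (i :: u)) =
  prob (@tpar b) tp (Some (i :: u)) t (upd sigma (Some u) false) * apow t.
Proof.
have a0 := a_gt0; rewrite /prob /tp /pcond /= !updxx; move: (rt _) => x x0.
have ax : 0 < a * x + 1 by rewrite addr_gt0 ?mulr_gt0.
have xa : 0 < x + a by rewrite addr_gt0.
by rewrite /cav /apow; case: t; field; rewrite !gt_eqF.
Qed.

Lemma nu_split m u sigma : (size u <= m)%N ->
  nu m sigma = prob (@tpar b) tp (Some u) (sigma (Some u)) sigma
  * (if (size u < m)%N then
       \prod_(i < b) prob (@tpar b) tp (Some (i :: u)) (sigma (Some (i :: u))) sigma
     else 1)
  * \prod_(y <- nodes b m | (y != Some u) && (tpar y != Some u))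
      prob (@tpar b) tp y (sigma y) sigma.
Proof.
move=> um; rewrite /nu (bigD1_seq (Some u)) ?nodes_uniq ?mem_nodes //= -mulrA.
congr (_ * _); rewrite (bigID (fun y => tpar y == Some u)) /=; congr (_ * _).
rewrite (eq_bigl (fun y => tpar y == Some u)); last first.
  move=> y /=; apply: andb_idl => /eqP py; apply/eqP => yu.
  by have := tpar_neq u; rewrite -{1}yu py eqxx.
rewrite -big_filter; case: ltnP => [um'|mu].
  by rewrite (perm_big _ (children_perm um')) big_map big_enum.
by rewrite children_leaf ?big_nil //; apply/eqP; rewrite eqn_leq um.
Qed.

(** The recursion on [rt] cancels the factors [cav] left by the children, so that the chain has the
    flip ratios of the Ising weight. *)
Lemma nu_flip m u sigma : (size u <= m)%N -> (forall v, 0 < rt v) ->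
  rt u = lam * (if (size u < m)%N then \prod_(i < b) cav a (rt (i :: u))
                else \prod_(i < b) apow (sigma (Some (i :: u)))) ->
  nu m (upd sigma (Some u) true) =
  nu m (upd sigma (Some u) false)
  * (lam * parent_apow sigma u * \prod_(i < b) apow (sigma (Some (i :: u)))).
Proof.
move=> um rt0 rtu; rewrite !(nu_split _ um) !updxx.
have neq i t : upd sigma (Some u) t (Some (i :: u)) = sigma (Some (i :: u)).
  by rewrite upd_neq //; apply/eqP => -[/(congr1 size) /= /eqP]; rewrite gtn_eqF.
have nself := tpar_neq u.
have -> : \prod_(y <- nodes b m | (y != Some u) && (tpar y != Some u))
    prob (@tpar b) tp y (upd sigma (Some u) true y) (upd sigma (Some u) true) =
  \prod_(y <- nodes b m | (y != Some u) && (tpar y != Some u))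
    prob (@tpar b) tp y (upd sigma (Some u) false y) (upd sigma (Some u) false).
  apply: eq_bigr => y /andP[yu pyu].
  by rewrite /prob !(upd_neq _ _ yu) !(upd_neq _ _ pyu).
rewrite [RHS]mulrAC; congr (_ * _).
have -> : prob (@tpar b) tp (Some u) true (upd sigma (Some u) true) =
    prob (@tpar b) tp (Some u) true sigma by rewrite /prob upd_neq.
have -> : prob (@tpar b) tp (Some u) false (upd sigma (Some u) false) =
    prob (@tpar b) tp (Some u) false sigma by rewrite /prob upd_neq.
rewrite prob_flip // rtu.
case: ltnP => [_|_]; last by ring.
set P := prob _ _ _ _ _; set Q := parent_apow _ _.
pose X t := \prod_(i < b) prob (@tpar b) tp (Some (i :: u))
  (sigma (Some (i :: u))) (upd sigma (Some u) t).
suff XE : X true * \prod_(i < b) cav a (rt (i :: u)) =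
    X false * \prod_(i < b) apow (sigma (Some (i :: u))).
  have XT t : \prod_(i < b) prob (@tpar b) tp (Some (i :: u))
      (upd sigma (Some u) t (Some (i :: u))) (upd sigma (Some u) t) = X t.
    by apply: eq_bigr => i _; rewrite neq.
  rewrite !XT.
  transitivity (P * Q * lam * (X true * \prod_(i < b) cav a (rt (i :: u)))).
    ring.
  by rewrite XE; ring.
by rewrite /X -!big_split /=; apply: eq_bigr => i _; apply: prob_child_flip.
Qed.

Section Bounds.
Variables (rlo rhi : R).
Hypotheses (rlo_gt0 : 0 < rlo) (lam_bnd : rlo <= lam <= rhi).
Hypothesis rt_bnd : forall u, rlo <= rt u <= rhi.

Definition pmin : R := Num.min (rlo / (rlo + a)) (a * rhi + 1)^-1.

Lemma ratio_bnd x : rlo <= ratio x <= rhi.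
Proof. by case: x => [u|] /=. Qed.

Lemma ratio_gt0 x : 0 < ratio x.
Proof. by have /andP[/(lt_le_trans rlo_gt0)] := ratio_bnd x. Qed.

Lemma rhi_gt0 : 0 < rhi.
Proof. by have /andP[/(lt_le_trans rlo_gt0)/lt_le_trans] := lam_bnd; apply. Qed.

Lemma pmin_gt0 : 0 < pmin.
Proof.
have a0 := a_gt0; have h0 := rhi_gt0.
by rewrite lt_min divr_gt0 ?addr_gt0 //= invr_gt0 addr_gt0 ?mulr_gt0.
Qed.

Lemma tp_bnd x s : pmin <= tp x s <= 1 - pmin.
Proof.
have a0 := a_gt0; have h0 := rhi_gt0.
have /andP[k1 ka] := coupling_bounds x; have /andP[rl rh] := ratio_bnd x.
have x0 := ratio_gt0 x; move: k1 ka rl rh x0; rewrite /tp.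
move: (coupling x) (ratio x) => k r k1 ka rl rh r0.
have k0 := lt_le_trans ltr01 k1.
have m1 : pmin <= rlo / (rlo + a) by rewrite ge_min lexx.
have m2 : pmin <= (a * rhi + 1)^-1 by rewrite ge_min lexx orbT.
have ra : 0 < r + a by rewrite addr_gt0.
have rk : 0 < r + k by rewrite addr_gt0.
have kr : 0 < k * r + 1 by rewrite addr_gt0 ?mulr_gt0.
have lower : rlo / (rlo + a) <= r / (r + k).
  rewrite ler_pdivrMr ?addr_gt0 // mulrAC ler_pdivlMr //.
  have := ler_wpM2r (ltW a0) rl; have := ler_wpM2l (ltW rlo_gt0) ka; nra.
have mono := pcond_mono k1 r0.
have upper : (a * rhi + 1)^-1 <= 1 - pcond k r true.
  have -> : 1 - pcond k r true = (k * r + 1)^-1.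
    by rewrite /pcond; field; rewrite gt_eqF.
  rewrite lef_pV2 ?posrE ?addr_gt0 ?mulr_gt0 // lerD2r.
  by rewrite ler_pM ?(ltW k0) ?(ltW r0).
have pF : pcond k r false = r / (r + k) by [].
by apply/andP; case: s; split; lra.
Qed.

Lemma tp_mono x : tp x false <= tp x true.
Proof.
have /andP[k1 _] := coupling_bounds x.
exact: (pcond_mono k1 (ratio_gt0 x)).
Qed.

Lemma tp_odds x : (1 - tp x false) * tp x true <=
  (1 + (a ^+ 2 - 1)) * (tp x false * (1 - tp x true)).
Proof.
have /andP[k1 ka] := coupling_bounds x.
apply: le_trans (pcond_odds k1 (ratio_gt0 x)) _.
have pm := pmin_gt0; have /andP[t1 _] := tp_bnd x false; have /andP[_ t2] := tp_bnd x true.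
apply: ler_wpM2r; first by rewrite mulr_ge0 //; rewrite -/(tp x _); lra.
have : coupling x ^+ 2 <= a ^+ 2 by rewrite lerXn2r ?nnegrE ?(le_trans ler01) // ltW ?a_gt0.
by lra.
Qed.

Lemma tp_gam x (L : R) : 0 < L ->
  ((1 - tp x false) * tp x true - tp x false * (1 - tp x true)) * L <=
  gam a * ((tp x false + (1 - tp x false) * L) * (tp x true + (1 - tp x true) * L)).
Proof.
move=> L0; have /andP[k1 ka] := coupling_bounds x.
apply: le_trans (pcond_gam k1 (ratio_gt0 x) L0) _.
have pm := pmin_gt0; have bT := tp_bnd x true; have bF := tp_bnd x false.
have pos s : 0 <= tp x s + (1 - tp x s) * L.
  by have /andP[t1 t2] := tp_bnd x s; rewrite addr_ge0 ?mulr_ge0 ?(ltW L0) //; lra.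
apply: ler_wpM2r; first exact: mulr_ge0 (pos false) (pos true).
have k0 := lt_le_trans ltr01 k1; have a0 := a_gt0.
by rewrite /gam ler_pdivrMr ?addr_gt0 // mulrAC ler_pdivlMr ?addr_gt0 //; nra.
Qed.

Lemma tp_influ x s t (kap : R) : 0 <= kap ->
  (forall u, x = Some u -> influ a (rt u) <= kap) -> `|tp x t - tp x s| <= kap.
Proof.
move=> kap0 H; have /andP[k1 _] := coupling_bounds x.
apply: le_trans (pcondB k1 t s (ratio_gt0 x)) _.
have i1 r : influ 1 r <= kap by rewrite /influ expr1n subrr !mul0r.
by case: x H {k1} => [[|i u]|] H; [exact: i1|exact: H|exact: i1].
Qed.

End Bounds.
End TreeChain.

(** * Configurations of a finite ball inside total configurations *)

Section TreeConfig.
Variables (R : realType) (b m : nat).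
Notation vert := (tree_vertex b m).
Implicit Types (u : seq 'I_b) (x y : vert) (omega : {ffun vert -> bool}).
Implicit Types (sigma : option (seq 'I_b) -> bool).

Definition node x : option (seq 'I_b) := Some (val (x : m.+1.-bseq 'I_b)).

Definition restr sigma : {ffun vert -> bool} := [ffun x => sigma (node x)].

Definition overlay sigma omega : option (seq 'I_b) -> bool := fun z =>
  if z is Some u then
    oapp omega (sigma z) (insub u : option (m.+1.-bseq 'I_b))
  else sigma z.

Lemma node_inj : injective node.
Proof. by move=> x y [/val_inj]. Qed.

Lemma overlay_node sigma omega x : overlay sigma omega (node x) = omega x.
Proof. by rewrite /overlay /node valK. Qed.

Lemma vert_of u : (size u <= m.+1)%N -> exists x, node x = Some u.
Proof. by move=> su; exists (Bseq su). Qed.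

Lemma overlay_out sigma omega z : (forall x, node x <> z) ->
  overlay sigma omega z = sigma z.
Proof.
case: z => // u H; rewrite /overlay insubN //.
by apply/negP => /vert_of[x /H].
Qed.

Lemma restr_overlay sigma omega : restr (overlay sigma omega) = omega.
Proof. by apply/ffunP => x; rewrite ffunE overlay_node. Qed.

Lemma overlay_eq sigma tau omega :
  (forall z, (forall x, node x <> z) -> sigma z = tau z) ->
  overlay sigma omega = overlay tau omega.
Proof.
move=> H; apply/funext => z; case: (pselect (exists x, node x = z)) => [[x <-]|no].
  by rewrite !overlay_node.
have no' x : node x <> z by move=> e; apply: no; exists x.
by rewrite !overlay_out // H.
Qed.

Lemma overlay_restr sigma : overlay sigma (restr sigma) = sigma.
Proof.
apply/funext => z; case: (pselect (exists x, node x = z)) => [[x <-]|no].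
  by rewrite overlay_node ffunE.
by rewrite overlay_out // => x e; apply: no; exists x.
Qed.

Lemma restr_upd sigma x t : restr (upd sigma (node x) t) = fupd (restr sigma) x t.
Proof. by apply/ffunP => y; rewrite !ffunE /upd (inj_eq node_inj). Qed.

Lemma overlay_fupd sigma omega x t :
  overlay sigma (fupd omega x t) = upd (overlay sigma omega) (node x) t.
Proof.
apply/funext => z; case: (pselect (exists y, node y = z)) => [[y <-]|no].
  by rewrite overlay_node ffunE /upd (inj_eq node_inj) overlay_node.
have no' y : node y <> z by move=> e; apply: no; exists y.
by rewrite upd_neq ?overlay_out //; apply/eqP => /esym/no'.
Qed.

Lemma overlay_upd sigma omega x t :
  overlay (upd sigma (node x) t) omega = overlay sigma omega.
Proof.
by apply: overlay_eq => z no; rewrite upd_neq //; apply/eqP => /esym/no.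
Qed.

Section Expand.
Variable p : option (seq 'I_b) -> bool -> R.
Notation prb := (prob (@tpar b) p).

(** Chain rule: the iterated average is a sum against the product of the conditional
    probabilities. *)
Lemma avgs_expand (l : seq vert) (F : (option (seq 'I_b) -> bool) -> R) sigma :
  ordered (@tpar b) (map node l) ->
  avgs (@tpar b) p (map node l) F sigma =
  \sum_(omega | agree_off [set x in l] (restr sigma) omega)
    (\prod_(x <- l) prb (node x) (omega x) (overlay sigma omega)) * F (overlay sigma omega).
Proof.
elim: l sigma => [|x l IH] sigma.
  move=> _; rewrite (big_pred1 (restr sigma)) ?big_nil ?mul1r ?overlay_restr //.
  move=> omega; apply/agree_offP/eqP => [H|->] //.
  by apply/ffunP => y; rewrite H // !inE.
rewrite /= => /and4P[xl pxx pxl ol].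
rewrite (partition_big (fun omega : {ffun vert -> bool} => omega x) predT) //= big_bool /=.
have xl' : x \notin l by rewrite -(mem_map node_inj).
have H t : prb (node x) t sigma * avgs (@tpar b) p (map node l) F (upd sigma (node x) t)
  = \sum_(omega | agree_off [set y in x :: l] (restr sigma) omega && (omega x == t))
    (\prod_(y <- x :: l) prb (node y) (omega y) (overlay sigma omega)) * F (overlay sigma omega).
  rewrite IH // mulr_sumr.
  have agE omega : agree_off [set y in x :: l] (restr sigma) omega && (omega x == t)
      = agree_off [set y in l] (restr (upd sigma (node x) t)) omega.
    rewrite restr_upd; apply/andP/agree_offP => [[/agree_offP ag /eqP xt] y|H].
      rewrite inE => yl; rewrite ffunE; case: eqVneq => [->//|yx].
      by apply: ag; rewrite !inE negb_or yx.
    split; last by rewrite H ?inE // ffunE eqxx.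
    apply/agree_offP => y; rewrite !inE negb_or => /andP[yx yl].
    by rewrite H ?inE // ffunE (negPf yx).
  apply: eq_big => [omega|omega ag]; first by rewrite agE.
  rewrite overlay_upd big_cons mulrA; congr (_ * _ * _).
  have /andP[ag' /eqP ->] : agree_off [set y in x :: l] (restr sigma) omega
    && (omega x == t) by rewrite agE.
  (* The parent of [x] precedes the whole list, so its spin is not among those summed over. *)
  suff E : overlay sigma omega (tpar (node x)) = sigma (tpar (node x)) by rewrite /prob E.
  case: (pselect (exists y, node y = tpar (node x))) => [[y e]|no].
    rewrite -e overlay_node; have /agree_offP -> := ag'; first by rewrite ffunE.
    rewrite inE in_cons negb_or -(inj_eq node_inj) e pxx.
    by rewrite -(mem_map node_inj) e.
  by rewrite overlay_out // => y e; apply: no; exists y.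
by rewrite -!H.
Qed.

End Expand.

Definition verts (k : nat) : seq vert := pmap insub (words_le b k).

Lemma map_verts k : (k <= m.+1)%N -> map node (verts k) = nodes b k.
Proof.
move=> km; rewrite /nodes /verts.
have : all (fun u => (size u <= m.+1)%N) (words_le b k).
  by apply/allP => u; rewrite mem_words_le => /leq_trans; apply.
elim: (words_le b k) => //= u l IH /andP[su /IH <-].
by rewrite insubT.
Qed.

Lemma mem_verts k x : (k <= m.+1)%N ->
  (x \in verts k) = (size (val (x : m.+1.-bseq 'I_b)) <= k)%N.
Proof. by move=> km; rewrite -(mem_map node_inj) map_verts // mem_nodes. Qed.

End TreeConfig.

(** * The Gibbs measure of a finite tree as a chain, and its spectral gap *)

Section TreeGibbs.
Variables (R : realType) (b m : nat) (beta h : R).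
Hypotheses (b_gt0 : (0 < b)%N) (beta_ge0 : 0 <= beta).
Notation vert := (tree_vertex b m).
Notation T := (tree_interior b m).
Notation e := (@tree_edge b m).
Notation word_of x := (val (x : m.+1.-bseq 'I_b)).
Implicit Types (x y : vert) (omega : {ffun vert -> bool}).
Implicit Types (sigma : option (seq 'I_b) -> bool).

Let a := expR (2 * beta).
Let lam := expR (2 * beta * h).

Lemma expR_spin s : expR (2 * beta * spin R s) = apow a s.
Proof. by case: s; rewrite /apow /spin ?mulr1 // mulrN1 expRN. Qed.

Lemma tree_edge_irr : irreflexive e.
Proof.
move=> x; apply/andP => -[sx /eqP xx]; have := congr1 size xx.
by rewrite size_behead; case: (size _) sx => // n _ /= /eqP; rewrite ltn_eqF.
Qed.

Lemma mem_interior x : (x \in T) = (size (word_of x) <= m)%N.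
Proof. by rewrite inE. Qed.

Lemma sum_children sigma omega x : x \in T ->
  \sum_(y | e x y) spin R (omega y) =
  \sum_(i < b) spin R (overlay sigma omega (Some (i :: word_of x))).
Proof.
rewrite mem_interior => xm.
have sz (i : 'I_b) : (size (i :: word_of x) <= m.+1)%N by [].
pose ch i : vert := Bseq (sz i).
have chi : {in predT &, injective ch} by move=> i j _ _ /(congr1 val) /= [].
rewrite (eq_bigl (mem (ch @: predT))); last first.
  move=> y; apply/idP/imsetP => [/andP[]|[i _ ->]]; last by rewrite /tree_edge /=.
  case E : (val (y : m.+1.-bseq 'I_b)) => [//|i u] _ /eqP xu.
  by exists i => //; apply/val_inj; rewrite /= E -xu.
rewrite big_imset //=; apply: eq_bigr => i _; congr (spin R _).
exact/esym/(overlay_node sigma omega (ch i)).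
Qed.

Lemma sum_parent sigma omega x :
  expR (2 * beta * \sum_(y | e y x) spin R (omega y)) =
  parent_apow a (overlay sigma omega) (word_of x).
Proof.
case E : (word_of x) => [|i u] /=.
  rewrite big_pred0 ?mulr0 ?expR0 // => y; apply/andP => -[].
  by rewrite E.
have su : (size u <= m.+1)%N.
  by have := size_bseq x; rewrite E /= => /ltnW.
pose z : vert := Bseq su.
rewrite (big_pred1 z); last first.
  move=> y; apply/andP/eqP => [[_ /eqP]|->]; first by rewrite E /= => yu; apply/val_inj.
  by rewrite E.
by rewrite expR_spin; have := overlay_node sigma omega z; rewrite /node /= => ->.
Qed.

Lemma expR_local_field sigma omega x : x \in T ->
  expR (2 * beta * local_field e h omega x) =
  lam * parent_apow a (overlay sigma omega) (word_of x)
  * \prod_(i < b) apow a (overlay sigma omega (Some (i :: word_of x))).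
Proof.
move=> xT; rewrite /local_field !mulrDr !expRD -(sum_parent sigma) (sum_children sigma) //.
have -> : \prod_(i < b) apow a (overlay sigma omega (Some (i :: word_of x))) =
    expR (2 * beta * \sum_(i < b) spin R (overlay sigma omega (Some (i :: word_of x)))).
  rewrite mulr_sumr (big_morph expR (@expRD R) (@expR0 R)).
  by apply: eq_bigr => i _; rewrite expR_spin.
rewrite /lam; ring.
Qed.

Lemma local_field_le omega x : x \in T ->
  `|local_field e h omega x| <= b.+1%:R + `|h|.
Proof.
move=> xT; rewrite /local_field (sum_children (fun=> true)) //.
apply: le_trans (ler_normD _ _) _; rewrite lerD2r -natr1.
have spin1 s : `|spin R s| = 1 by case: s; rewrite /spin ?normrN normr1.
apply: le_trans (ler_normD _ _) _; apply: lerD.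
  apply: le_trans (ler_norm_sum _ _ _) _.
  by under eq_bigr do rewrite spin1; rewrite sumr_const card_ord.
apply: le_trans (ler_norm_sum _ _ _) _; under eq_bigr do rewrite spin1.
rewrite sumr_const -[leRHS]/(1%:R) ler_nat; case E : (word_of x) => [|i u].
  by rewrite fintype.eq_card0 // => y; rewrite unfold_in /tree_edge E.
have su : (size u <= m.+1)%N by have := size_bseq x; rewrite E /= => /ltnW.
rewrite (fintype.eq_card1 (_ : _ =i pred1 (Bseq su : vert))) // => y; rewrite !unfold_in /=.
by apply/eqP/eqP => [uy|-> //]; apply/val_inj.
Qed.

Lemma ordered_verts k : (k <= m.+1)%N -> ordered (@tpar b) (map (@node b m) (verts b m k)).
Proof. by move=> km; rewrite map_verts // ordered_nodes. Qed.

Lemma nu_overlay (rt : seq 'I_b -> R) k sigma omega : (k <= m.+1)%N ->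
  \prod_(x <- verts b m k) prob (@tpar b) (tp a lam rt) (node x) (omega x) (overlay sigma omega)
  = nu a lam rt k (overlay sigma omega).
Proof.
move=> km; rewrite /nu -(map_verts b km) big_map.
by apply: eq_bigr => x _; rewrite overlay_node.
Qed.

Section Finite.
Variables (rt : seq 'I_b -> R) (sigma0 : option (seq 'I_b) -> bool).
Hypothesis rt_gt0 : forall u, 0 < rt u.
Hypothesis rt_rec : forall u, (size u <= m)%N ->
  rt u = lam * (if (size u < m)%N then \prod_(i < b) cav a (rt (i :: u))
                else \prod_(i < b) apow a (sigma0 (Some (i :: u)))).

(** The density of the chain and the Ising weight have the same ratio under every flip inside the
    tree, and both laws have total mass 1. *)
Lemma gibbs_mean_avgs f :
  gibbs_mean e beta h T (restr m sigma0) f =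
  avgs (@tpar b) (tp a lam rt) (nodes b m) (fun sigma => f (restr m sigma)) sigma0.
Proof.
have a_ge1 : 1 <= a by rewrite /a -expR0 ler_expR mulr_ge0.
rewrite -(map_verts b (leqnSn m)).
pose nu' (omega : {ffun vert -> bool}) := nu a lam rt m (overlay sigma0 omega).
have setE : [set x in verts b m m]%SET = T.
  by apply/setP => x; rewrite mem_interior inE mem_verts.
have exp F : avgs (@tpar b) (tp a lam rt) (map (@node b m) (verts b m m)) F sigma0 =
    \sum_(omega | agree_off T (restr m sigma0) omega) nu' omega * F (overlay sigma0 omega).
  rewrite avgs_expand ?ordered_verts // setE.
  by apply: eq_bigr => omega _; rewrite nu_overlay.
rewrite gibbs_meanE exp; apply: eq_bigr => omega ao; rewrite restr_overlay; congr (_ * _).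
apply: gibbs_eq => //; last first.
  have := exp (fun=> 1); rewrite avgs_const => ->.
  by apply: eq_bigr => zeta _; rewrite mulr1.
move=> zeta zeta' az az'.
have azz : agree_off T zeta zeta'.
  by apply: agree_off_trans az'; rewrite agree_off_sym.
apply: (ratio_of_flips (A := T)) azz => [w|w x aw xT]; first exact: ising_weight_gt0.
have aw' : agree_off T (restr m sigma0) w := agree_off_trans az aw.
rewrite ising_weight_flip //; last exact: tree_edge_irr.
rewrite (expR_local_field sigma0) // /nu' !overlay_fupd /node nu_flip //.
- by rewrite mulrAC -!mulrA.
- by rewrite -mem_interior.
rewrite rt_rec -?mem_interior //; congr (_ * _); case: ltnP => // xm.
apply: eq_bigr => i _; congr apow.
have xm' : size (word_of x) = m by apply/eqP; rewrite eqn_leq xm -mem_interior xT.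
have su : (size (i :: word_of x) <= m.+1)%N by rewrite /= xm'.
have := agree_offP _ _ _ aw' (Bseq su : vert).
rewrite mem_interior /= xm' ltnn => /(_ isT).
have := overlay_node sigma0 w (Bseq su : vert); rewrite /node /= => -> ->.
  by rewrite ffunE.
Qed.

Lemma gibbs_var_vars f :
  gibbs_var e beta h T (restr m sigma0) f =
  vars (@tpar b) (tp a lam rt) (nodes b m) (fun sigma => f (restr m sigma)) sigma0.
Proof. by rewrite /gibbs_var !gibbs_mean_avgs. Qed.

Definition field_bound : R := expR (2 * beta * (b.+1%:R + `|h|)).

(** The local field is bounded in terms of [b] and [h] only, so single-site variances and squared
    differences are comparable uniformly in the tree. *)
Lemma dirichlet_ge f :
  (4 * field_bound)^-1 * (\sum_(z <- nodes b m)
     avgs (@tpar b) (tp a lam rt) (nodes b m)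
       (sqf (dif z (fun sigma => f (restr m sigma)))) sigma0)
  <= dirichlet e beta h T (restr m sigma0) f.
Proof.
rewrite -(map_verts b (leqnSn m)) big_map mulr_sumr /dirichlet.
have uv : uniq (verts b m m).
  by rewrite -(map_inj_uniq (@node_inj b m)) map_verts // nodes_uniq.
rewrite big_uniq //= (eq_bigl (mem T)); last first.
  by move=> x; rewrite /= mem_verts // mem_interior.
rewrite map_verts //; apply: ler_sum => x xT.
pose g omega := (f (fupd omega x true) - f (fupd omega x false)) ^+ 2.
have -> : avgs (@tpar b) (tp a lam rt) (nodes b m)
       (sqf (dif (node x) (fun sigma => f (restr m sigma)))) sigma0 =
    gibbs_mean e beta h T (restr m sigma0) g.
  rewrite gibbs_mean_avgs; congr avgs; apply/funext => sigma.
  by rewrite /sqf /dif /g !restr_upd.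
rewrite -gibbs_meanZ; apply: gibbs_mean_le => omega.
apply: gibbs_var1_ge => //; first exact: tree_edge_irr.
  by rewrite /field_bound -expR0 ler_expR !mulr_ge0 // addr_ge0.
by rewrite ler_expR ler_wpM2l ?mulr_ge0 // local_field_le.
Qed.

Lemma spectral_gap_ge (C : R) : 0 < C ->
  (forall f, vars (@tpar b) (tp a lam rt) (nodes b m) f sigma0 <=
     C * \sum_(z <- nodes b m)
       avgs (@tpar b) (tp a lam rt) (nodes b m) (sqf (dif z f)) sigma0) ->
  1 / (4 * field_bound * C) <= spectral_gap e beta h T (restr m sigma0).
Proof.
move=> C0 poinc.
have O0 : 0 < 4 * field_bound by rewrite mulr_gt0 // expR_gt0.
apply: lb_le_inf; last first.
  move=> _ [f ncf <-]; have v0 := gibbs_var_gt0 e beta h ncf.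
  rewrite ler_pdivlMr // mul1r ler_pdivrMl; last exact: mulr_gt0.
  rewrite gibbs_var_vars -[_ * C * _]mulrA mulrCA; apply: le_trans (poinc _) _.
  rewrite ler_pM2l // -ler_pdivrMl //; exact: dirichlet_ge.
(* The set under [inf] must be nonempty, as the infimum of the empty set is 0; the spin at the root
   is a nonconstant function. *)
have rs : (size ([::] : seq 'I_b) <= m.+1)%N by [].
pose x0 : vert := Bseq rs.
have x0T : x0 \in T by rewrite mem_interior.
pose f (omega : {ffun vert -> bool}) : R := (omega x0)%:R.
exists (dirichlet e beta h T (restr m sigma0) f / gibbs_var e beta h T (restr m sigma0) f).
exists f => //; exists (fupd (restr m sigma0) x0 true), (fupd (restr m sigma0) x0 false).
rewrite !agree_off_fupd // !agree_off_refl; split => //.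
by rewrite /f !ffunE eqxx; apply/eqP; rewrite oner_eq0.
Qed.

End Finite.

End TreeGibbs.

(** * A spectral gap that is uniform in the tree *)

Section Uniform.
Variables (R : realType) (b : nat) (beta h : R).
Hypotheses (b_gt0 : (0 < b)%N) (beta_ge0 : 0 <= beta).
Let a := expR (2 * beta).
Let lam := expR (2 * beta * h).

Let a_ge1 : 1 <= a. Proof. by rewrite /a -expR0 ler_expR mulr_ge0. Qed.
Let lam_gt0 : 0 < lam. Proof. exact: expR_gt0. Qed.

(* The ratio at a vertex [u] whose descendants at distance [k.+1] carry the
   boundary condition [bc]. *)
Fixpoint cavity (bc : seq 'I_b -> bool) k u : R :=
  if k is k'.+1 then lam * \prod_(i < b) cav a (cavity bc k' (i :: u))
  else lam * \prod_(i < b) apow a (bc (i :: u)).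

Lemma cavity_bounds bc k u : lo a lam b k <= cavity bc k u <= hi a lam b k.
Proof.
have a0 := lt_le_trans ltr01 a_ge1.
have cst (x : R) : x ^+ b = \prod_(i < b) x by rewrite prodr_const card_ord.
elim: k u => [|k IH] u.
  rewrite /lo /hi /= !ler_pM2l // !cst.
  have ap s : 0 <= a^-1 <= apow a s /\ 0 <= apow a s <= a.
    have aa : a^-1 <= a by rewrite (le_trans _ a_ge1) // invf_le1.
    by case: s; rewrite /apow !lexx ?aa ?invr_ge0 ?(ltW a0).
  by apply/andP; split; apply: ler_prod => i _; case: (ap (bc (i :: u))).
rewrite /lo /hi /= -/(lo a lam b k) -/(hi a lam b k) /phi !ler_pM2l //.
rewrite !cst.
have l0 := lo_gt0 a_ge1 b lam_gt0 k.
apply/andP; split; apply: ler_prod => i _; have /andP[h1 h2] := IH (i :: u).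
  by rewrite ler_cav // andbT ltW // cav_gt0.
by rewrite ler_cav ?(lt_le_trans l0) // andbT ltW // cav_gt0 // (lt_le_trans l0).
Qed.

Lemma cavity_plus k u : cavity (fun=> true) k u = hi a lam b k.
Proof.
elim: k u => [|k IH] u /=; first by rewrite prodr_const card_ord.
by under eq_bigr do rewrite IH; rewrite prodr_const card_ord.
Qed.

(** Every parameter, the minimal probability [c] included, is fixed before [r] and [m]. This is
    possible because all ratios lie between [lo] and [hi] at height 0. *)
Lemma tree_gap_uniform (tau : vertex b -> bool) (kap : R) (M : nat) :
  0 <= kap -> b%:R * kap * gam a < 1 ->
  (forall (r : vertex b) k u, (M <= k)%N ->
     influ a (cavity (fun w => tau (w ++ r)) k u) <= kap) ->
  exists C : R, 0 < C /\
    forall (r : vertex b) (m : nat), 1 / C <= tree_gap beta h tau r m.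
Proof.
move=> kap0 small inf_kap.
have g0 := gam_ge0 a_ge1.
pose theta := a ^+ 2 - 1.
have th0 : 0 <= theta by rewrite subr_ge0 exprn_ege1.
have rho01 : 0 <= b%:R * kap * gam a < 1 by rewrite small andbT mulr_ge0 // mulr_ge0.
(* The correlation bound of depth [n] is [theta * (b%:R * kap)] times a power of
   [b%:R * kap * gam a]; the 8 and the factor [(n + M).+2] come from the absorption step. *)
have [n Hn] := @exists_expr_le R _ (8 * theta * (b%:R * kap)) M rho01
   (mulr_ge0 (mulr_ge0 (ler0n _ 8) th0) (mulr_ge0 (ler0n _ b) kap0)).
pose eps : R := (8 * (n + M).+2%:R)^-1.
have nM0 : 0 < (n + M).+2%:R :> R by [].
have eps0 : 0 < eps by rewrite invr_gt0 mulr_gt0.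
have eps8 : 8 * eps * (n + M).+2%:R <= 1.
  by rewrite mulrAC divff // gt_eqF // mulr_gt0.
have le_eps : theta * gam a ^+ n * (b%:R * kap) ^+ n.+1 <= eps.
  rewrite -[eps]mul1r ler_pdivlMr ?mulr_gt0 //; apply: le_trans Hn.
  rewrite [(_ * gam a) ^+ n]exprMn exprS le_eqVlt; apply/orP; left; apply/eqP; ring.
pose c := pmin a (lo a lam b 0) (hi a lam b 0).
pose K : R := 2 * ((2 + 4 * eps) * (2 * c^-1 ^+ b.+1) ^+ size (words_le b (n + M).+1)
   * (n + M).+1%:R).
have lo0 := lo_gt0 a_ge1 b lam_gt0 0.
have a0 := lt_le_trans ltr01 a_ge1.
have lam_bnd : lo a lam b 0 <= lam <= hi a lam b 0.
  rewrite ler_piMr ?ler_peMr ?exprn_ege1 ?exprn_ile1 ?invr_ge0 ?invf_le1 //;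
    exact: ltW.
have c0 : 0 < c := pmin_gt0 a_ge1 lo0 lam_bnd.
have K0 : 0 < K.
  have e0 : 0 < 2 + 4 * eps by rewrite addr_gt0 ?mulr_gt0.
  by rewrite !mulr_gt0 // exprn_gt0 // mulr_gt0 // exprn_gt0 // invr_gt0.
exists (4 * field_bound b beta h * K); split.
  exact: mulr_gt0 (mulr_gt0 (ltr0n _ 4) (expR_gt0 _)) K0.
move=> r m; pose bc w := tau (w ++ r).
pose rt u := cavity bc (m - size u) u.
pose sigma0 (z : option (seq 'I_b)) := if z is Some u then bc u else true.
have rt_bnd u : lo a lam b 0 <= rt u <= hi a lam b 0.
  have /andP[h1 h2] := cavity_bounds bc (m - size u) u.
  rewrite (le_trans _ h1) ?(le_trans h2) //.
    exact: (hi_noninc a_ge1 b lam_gt0).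
  exact: (lo_nondec a_ge1 b lam_gt0).
have rt0 u : 0 < rt u by have /andP[/(lt_le_trans lo0)] := rt_bnd u.
have -> : tree_gap beta h tau r m =
   spectral_gap (@tree_edge b m) beta h (tree_interior b m) (restr m sigma0).
  by rewrite /tree_gap; congr spectral_gap; apply/ffunP => x; rewrite !ffunE.
have rt_rec u : (size u <= m)%N ->
    rt u = lam * (if (size u < m)%N then \prod_(i < b) cav a (rt (i :: u))
                  else \prod_(i < b) apow a (sigma0 (Some (i :: u)))).
  move=> um; rewrite /rt; case: ltnP => [um'|mu].
    by rewrite -(subnSK um').
  by have -> : (m - size u)%N = 0%N by apply/eqP; rewrite subn_eq0.
apply: (@spectral_gap_ge R b m beta h beta_ge0 rt sigma0 rt0 rt_rec K K0) => f.
have p_bnd := tp_bnd a_ge1 lo0 lam_bnd rt_bnd.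
apply: (poincare c0 p_bnd (@tlev_par b) th0 g0 kap0
  (tp_mono a_ge1 lo0 lam_bnd rt_bnd) (tp_odds a_ge1 lo0 lam_bnd rt_bnd)
  (tp_gam a_ge1 lo0 lam_bnd rt_bnd) (n := n) (M := M) (top := m.+1)) => //.
- exact: ordered_nodes.
- by move=> z; apply: count_children.
- by move=> y; rewrite mem_nodes.
- move=> y yN lyM t s; apply: (tp_influ a_ge1 lo0 lam_bnd rt_bnd) => // u yu.
  move: lyM; rewrite yu /= addSn ltnS => uM; apply: inf_kap.
  by rewrite -(leq_add2l (size u)) subnKC // (leq_trans (leq_addr M _) uM).
- by move=> x xN; apply: count_anc.
Qed.

End Uniform.

Local Open Scope classical_set_scope.
Local Open Scope ring_scope.

(** * Sampling a chain from a uniform variable *)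

Section Sampling.
Variables (R : realType) (V : eqType) (par : V -> V) (p : V -> bool -> R).
Hypothesis p01 : forall x s, 0 <= p x s <= 1.
Implicit Types (x : V) (l : seq V) (sigma : V -> bool) (s r U : R).

(* [U] is read in the interval [s, r[, which is split in the proportions given
   by the law of each successive spin. *)
Fixpoint samp l sigma s r U : V -> bool :=
  if l is x :: l' then
    let c := s + (r - s) * prob par p x true sigma in
    if U < c then samp l' (upd sigma x true) s c U
    else samp l' (upd sigma x false) c r U
  else sigma.

Lemma samp_notin l sigma s r U x : x \notin l -> samp l sigma s r U x = sigma x.
Proof.
elim: l sigma s r => //= y l IH sigma s r; rewrite in_cons negb_or => /andP[xy xl].
by case: ifP => _; rewrite IH // upd_neq.
Qed.

Lemma samp_cat l1 l2 sigma s r U x : x \notin l2 ->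
  samp (l1 ++ l2) sigma s r U x = samp l1 sigma s r U x.
Proof.
move=> xl2; elim: l1 sigma s r => [|y l IH] sigma s r /=; first exact: samp_notin.
by case: ifP => _; apply: IH.
Qed.

(** Half-open intervals make the two pieces an exact partition, so the two measures add up as in
    [avg]. *)
Lemma lebesgue_samp l (F : (V -> bool) -> bool) sigma s r : s <= r ->
  let A := [set U | (s <= U < r) && F (samp l sigma s r U)]%classic in
  measurable A /\
  lebesgue_measure A =
    ((r - s) * avgs par p l (fun eta => (F eta)%:R) sigma)%:E.
Proof.
elim: l sigma s r => [|x l IH] sigma s r sr.
  move=> A; case: (boolP (F sigma)) => Fs; last first.
    have -> : A = set0.
      by apply/seteqP; split => U //=; rewrite /A /= (negPf Fs) andbF.
    by split; [exact: measurable0|rewrite measure0 /= (negPf Fs) mulr0].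
  have -> : A = `[s, r[%classic.
    by apply/seteqP; split => U; rewrite /A /= Fs andbT in_itv.
  split; first exact: measurable_itv.
  rewrite /= Fs mulr1 lebesgue_measure_itv /= lte_fin.
  by case: ltP => // rs; have -> : r - s = 0 by [apply/eqP; rewrite subr_eq0 eq_le rs sr]; rewrite /=.
pose c := s + (r - s) * prob par p x true sigma.
have /andP[pr0 pr1] : 0 <= prob par p x true sigma <= 1 by apply: p01.
have rs0 : 0 <= r - s by rewrite subr_ge0.
have sc : s <= c by rewrite lerDl mulr_ge0.
have cr : c <= r by rewrite -lerBrDl ler_piMr.
have [m1 e1] := IH (upd sigma x true) s c sc.
have [m2 e2] := IH (upd sigma x false) c r cr.
set A1 := [set U | _]%classic in m1 e1; set A2 := [set U | _]%classic in m2 e2.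
move=> A; have -> : A = A1 `|` A2.
  apply/seteqP; split => U; rewrite /A /A1 /A2 /= -/c.
    case: (ltP U c) => Uc /andP[/andP[sU Ur] FU]; [left|right].
      by rewrite sU.
    by rewrite Ur.
  case=> /andP[/andP[h1 h2] FU].
    by rewrite h1 h2 (lt_le_trans h2 cr).
  by rewrite (le_trans sc h1) h2 ltNge h1.
have dis : A1 `&` A2 = set0.
  apply/seteqP; split => // U [] /= /andP[/andP[_ h1] _] /andP[/andP[h2 _] _].
  by move: h1; rewrite ltNge h2.
split; first exact: measurableU.
have -> : lebesgue_measure (A1 `|` A2) = (lebesgue_measure A1 + lebesgue_measure A2)%E.
  exact: measureU.
rewrite e1 e2.
rewrite -EFinD; congr EFin; rewrite /= /avg -/c.
have -> : prob par p x false sigma = 1 - prob par p x true sigma by [].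
by rewrite {1 2}/c; ring.
Qed.

End Sampling.

Section UnitInterval.
Variable R : realType.

Let mI : measurable (`[0, 1[%classic : set R).
Proof. exact: measurable_itv. Qed.

Definition unif01 : set (measurableTypeR R) -> \bar R :=
  mrestr (@lebesgue_measure R) mI.

HB.instance Definition _ := Measure.on unif01.

Let unif01_setT : unif01 setT = 1%E.
Proof. by rewrite /unif01 /mrestr setTI lebesgue_measure_itv /= lte01 oppr0 adde0. Qed.

HB.instance Definition _ := Measure_isProbability.Build _ _ _ unif01 unif01_setT.

End UnitInterval.

(** * Infinite configurations and events of finite depth *)

Section TreeMeasure.
Variables (R : realType) (b : nat).
Implicit Types (sigma : option (seq 'I_b) -> bool).

Definition ghost_ext (eta : tree_config b) : option (seq 'I_b) -> bool :=
  fun x => if x is Some u then eta u else true.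

Definition depends M (F : (option (seq 'I_b) -> bool) -> bool) :=
  forall sigma sigma',
    (forall u, (size u <= M)%N -> sigma (Some u) = sigma' (Some u)) ->
    F sigma = F sigma'.

Lemma dependsS M M' F : (M <= M')%N -> depends M F -> depends M' F.
Proof. by move=> MM' dF s s' ss'; apply: dF => u uM; apply: ss'; apply: leq_trans MM'. Qed.

Definition event (F : (option (seq 'I_b) -> bool) -> bool) : set (tree_config b) :=
  [set eta | F (ghost_ext eta)].

(** Unlike the one-vertex cylinders, these are closed under intersection, as uniqueness of measures
    requires. *)
Definition events : set (set (tree_config b)) :=
  [set B | exists M F, depends M F /\ B = event F].

Lemma measurable_coord u s : measurable ([set eta | eta u = s] : set (tree_config b)).
Proof. by apply: sub_sigma_algebra; exists u, s. Qed.

Lemma measurable_event M F : depends M F -> measurable (event F).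
Proof.
move=> dF.
have -> : event F =
  \bigcup_(omega in [set omega | F (overlay (fun=> true) omega)])
    \bigcap_(x in [set: tree_vertex b M])
      [set eta : tree_config b | eta (val (x : M.+1.-bseq 'I_b)) = omega x].
  apply/seteqP; split => eta.
    move=> Feta; exists (restr M (ghost_ext eta)); last by move=> x _; rewrite /= ffunE.
    rewrite /= (dF _ (ghost_ext eta)) // => u uM.
    have [x <-] := @vert_of b M u (leqW uM).
    by rewrite overlay_node ffunE.
  move=> [omega Fom ext]; rewrite /event /= (dF _ (overlay (fun=> true) omega)) //.
  move=> u uM; have [x xu] := @vert_of b M u (leqW uM).
  by rewrite -xu overlay_node -(ext x I).
apply: fin_bigcup_measurable => [|omega _]; first exact: finite_finset.
by apply: fin_bigcap_measurable => [|x _]; [exact: finite_finset|exact: measurable_coord].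
Qed.

Lemma events_setI : setI_closed events.
Proof.
move=> _ _ [M1 [F1 [d1 ->]]] [M2 [F2 [d2 ->]]].
exists (maxn M1 M2), (fun sigma => F1 sigma && F2 sigma); split.
  move=> s s' ss'; congr andb; [apply: d1|apply: d2] => u uM; apply: ss';
    by rewrite leq_max uM ?orbT.
by apply/seteqP; split => eta /=; rewrite /event /= => /andP.
Qed.

Lemma eventsT : events setT.
Proof. by exists 0%N, (fun=> true); split => //; apply/seteqP; split. Qed.

Lemma events_gen (B : set (tree_config b)) : measurable B -> (<<s events>>) B.
Proof.
apply: sub_sigma_algebra2 => _ [u [s ->]].
exists (size u), (fun sigma => sigma (Some u) == s); split.
  by move=> sigma sigma' ->.
by apply/seteqP; split => eta; rewrite /event /= => /eqP.
Qed.

Lemma events_measurable : events `<=` measurable.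
Proof. by move=> _ [M [F [dF ->]]]; apply: measurable_event dF. Qed.

Section Chain.
Variable p : option (seq 'I_b) -> bool -> R.
Hypothesis p01 : forall x s, 0 <= p x s <= 1.
Notation samp := (samp (@tpar b) p).

(** Each spin is read from a finite list. Vertices appended later do not alter it, so the readings
    are consistent and no extension theorem is invoked. The value outside the unit interval concerns
    a null set. *)
Definition config_of (U : measurableTypeR R) : tree_config b := fun u =>
  if 0 <= U < 1 then samp (nodes b (size u)) (fun=> true) 0 1 U (Some u) else true.

Lemma samp_nodes M u (U : R) : (size u <= M)%N ->
  samp (nodes b (size u)) (fun=> true) 0 1 U (Some u) =
  samp (nodes b M) (fun=> true) 0 1 U (Some u).
Proof.
move=> /subnKC <-; elim: (M - size u)%N => [|k IH]; rewrite ?addn0 // addnS.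
rewrite nodesS samp_cat // (mem_map (@Some_inj _)) mem_words.
by rewrite -addnS -[X in X == _]addn0 eqn_add2l.
Qed.

Lemma event_config_of M F U : depends M F -> 0 <= U < 1 ->
  F (ghost_ext (config_of U)) = F (samp (nodes b M) (fun=> true) 0 1 U).
Proof.
by move=> dF U01; apply: dF => u uM; rewrite /ghost_ext /config_of U01; apply: samp_nodes.
Qed.

Lemma preimage_event M F : depends M F ->
  config_of @^-1` (event F) =
  [set U | (0 <= U < 1) && F (samp (nodes b M) (fun=> true) 0 1 U)]
  `|` (if F (fun=> true) then ~` `[0, 1[%classic else set0).
Proof.
move=> dF; apply/seteqP; split => U; rewrite /event /=.
  case: (boolP (0 <= U < 1)) => U01; first by rewrite (event_config_of dF U01); left.
  move=> FU; right; suff -> : F (fun=> true) by rewrite /= in_itv /= (negPf U01).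
  rewrite (dF _ (ghost_ext (config_of U))) // => u _.
  by rewrite /ghost_ext /config_of (negPf U01).
case=> [/andP[U01]|]; first by rewrite (event_config_of dF U01).
case: ifP => //= Ft; rewrite in_itv /= => U01.
rewrite (dF _ (fun=> true)) // => u _.
by rewrite /ghost_ext /config_of; case: ifP.
Qed.

Lemma measurable_config_of : measurable_fun setT config_of.
Proof.
have gen := @measurability _ _ (measurableTypeR R) (tree_config b) setT config_of
  (@cylinders b) erefl.
apply: gen => // _ [_ [u [s ->]] <-].
pose F sigma := sigma (Some u) == s.
have dF : depends (size u) F by move=> sigma sigma' e; rewrite /F e.
have -> : [set eta | eta u = s] = event F :> set (tree_config b).
  by apply/seteqP; split => eta; rewrite /event /F /= => /eqP.
rewrite setTI (preimage_event dF).
have [mA _] := lebesgue_samp (@tpar b) p01 (nodes b (size u)) F (fun=> true) (@ler01 R).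
apply: measurableU => //; case: ifP => _; last exact: measurable0.
by apply: measurableC; apply: measurable_itv.
Qed.

HB.instance Definition _ := isMeasurableFun.Build _ _ _ _ config_of measurable_config_of.

Definition tree_prob : probability (tree_config b) R := distribution (@unif01 R) config_of.

Lemma tree_probE M F : depends M F ->
  tree_prob (event F) =
  (avgs (@tpar b) p (nodes b M) (fun eta => (F eta)%:R) (fun=> true))%:E.
Proof.
move=> dF; have [mA mE] := lebesgue_samp (@tpar b) p01 (nodes b M) F (fun=> true) (@ler01 R).
rewrite /tree_prob /distribution /= /pushforward (preimage_event dF) /unif01 /mrestr.
set A := [set U | _] in mA mE *.
have -> : (A `|` (if F (fun=> true) then ~` `[0, 1[%classic else set0))
    `&` `[0, 1[%classic = A.
  apply/seteqP; split => U; rewrite /A /=.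
    by case=> [[//|]]; case: ifP.
  by move=> /andP[U01 FU]; split; [left; rewrite U01|rewrite in_itv].
by rewrite mE subr0 mul1r.
Qed.

End Chain.
End TreeMeasure.

(** * Two fixed points of the recursion yield two Gibbs measures *)

Section HeatBath.
Variables (R : realType) (b m : nat) (beta h : R).
Hypothesis beta_ge0 : 0 <= beta.
Notation vert := (tree_vertex b m).
Notation e := (@tree_edge b m).
Variable A : {set vert}.
Hypothesis A_int : A \subset tree_interior b m.
Let a := expR (2 * beta).
Let lam := expR (2 * beta * h).
Implicit Types (sigma : option (seq 'I_b) -> bool) (F : (option (seq 'I_b) -> bool) -> R).

Definition heat_bath F sigma : R :=
  \sum_omega gibbs e beta h A (restr m sigma) omega * F (overlay sigma omega).

Lemma out_of_tree x : (m.+2 < @tlev b x)%N -> forall y : vert, node y <> x.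
Proof.
by move=> lx y yx; move: lx; rewrite -yx /= ltnS ltnNge (size_bseq y).
Qed.

Lemma restr_upd_out sigma x t : (forall y : vert, node y <> x) ->
  restr m (upd sigma x t) = restr m sigma.
Proof. by move=> no; apply/ffunP => y; rewrite !ffunE upd_neq //; apply/eqP/no. Qed.

Lemma overlay_upd_out sigma x t (omega : {ffun vert -> bool}) :
  (forall y : vert, node y <> x) ->
  overlay (upd sigma x t) omega = upd (overlay sigma omega) x t.
Proof.
move=> no; apply/funext => z; case: (pselect (exists y : vert, node y = z)) => [[y <-]|ny].
  by rewrite overlay_node upd_neq ?overlay_node //; apply/eqP/no.
have ny' (y : vert) : node y <> z by move=> yz; apply: ny; exists y.
by rewrite overlay_out // /upd; case: eqP => // _; rewrite overlay_out.
Qed.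

(** Vertices this deep have parents of depth at least [m.+1], hence outside [A], so resampling [A]
    leaves their conditional laws unchanged. *)
Lemma avgs_overlay p l F sigma (omega : {ffun vert -> bool}) :
  all (fun x => m.+2 < @tlev b x)%N l -> agree_off A (restr m sigma) omega ->
  avgs (@tpar b) p l (fun eta => F (overlay eta omega)) sigma =
  avgs (@tpar b) p l F (overlay sigma omega).
Proof.
elim: l sigma => //= x l IH sigma /andP[lx al] ag.
have no := out_of_tree lx.
have avgE f eta : avg (@tpar b) p x f eta = prob (@tpar b) p x true eta * f (upd eta x true)
    + prob (@tpar b) p x false eta * f (upd eta x false) by [].
rewrite !avgE !IH ?restr_upd_out // !overlay_upd_out //.
suff prE t : prob (@tpar b) p x t (overlay sigma omega) = prob (@tpar b) p x t sigma.
  by rewrite !prE.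
rewrite /prob; suff -> : overlay sigma omega (tpar x) = sigma (tpar x) by [].
case: (pselect (exists y : vert, node y = tpar x)) => [[y yx]|ny].
  rewrite -yx overlay_node; have /agree_offP -> := ag; first by rewrite ffunE.
  apply/negP => yA; have := fintype.subsetP A_int y yA; rewrite mem_interior.
  by move: (lx); rewrite -(ltn_predK lx) -tlev_par -yx /= !ltnS ltnNge => /negP.
by rewrite overlay_out // => y yx; apply: ny; exists y.
Qed.

Lemma avgs_heat_bath p l F : all (fun x => m.+2 < @tlev b x)%N l ->
  avgs (@tpar b) p l (heat_bath F) = heat_bath (avgs (@tpar b) p l F).
Proof.
move=> al; apply/funext => sigma; rewrite /heat_bath avgs_sum.
apply: eq_bigr => omega _; rewrite avgsM_indep; last first.
  by move=> x xl eta t; rewrite restr_upd_out //; apply: out_of_tree (allP al x xl).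
case: (boolP (agree_off A (restr m sigma) omega)) => [ag|/negPf nag].
  by rewrite avgs_overlay.
by rewrite /gibbs nag !mul0r.
Qed.

Variable R0 : R.
Hypotheses (R0_gt0 : 0 < R0) (R0_fix : phi a lam b R0 = R0).
Let p := tp a lam (fun _ : seq 'I_b => R0).

Lemma partition_fun_agree eta omega : agree_off A eta omega ->
  partition_fun e beta h A eta = partition_fun e beta h A omega.
Proof.
move=> ag; apply: eq_bigl => zeta; apply/idP/idP => H.
  by apply: agree_off_trans H; rewrite agree_off_sym.
exact: agree_off_trans H.
Qed.

(** Reversibility: the weight of [omega] times the probability of resampling it to [zeta] is
    symmetric. The ball of depth [m.+1] contains all children of [A], where the fixed point equation
    gives the flip ratios. *)
Lemma stationary_ball F sigma :
  avgs (@tpar b) p (nodes b m.+1) (heat_bath F) sigma =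
  avgs (@tpar b) p (nodes b m.+1) F sigma.
Proof.
have a_ge1 : 1 <= a by rewrite /a -expR0 ler_expR mulr_ge0.
rewrite -(map_verts b (leqnn m.+1)).
have setE : [set x in verts b m m.+1]%SET = [set: vert]%SET.
  by apply/setP => x; rewrite !inE mem_verts // size_bseq.
pose w (omega : {ffun vert -> bool}) :=
  nu a lam (fun _ : seq 'I_b => R0) m.+1 (overlay sigma omega).
have exp G : avgs (@tpar b) p (map (@node b m) (verts b m m.+1)) G sigma =
    \sum_omega w omega * G (overlay sigma omega).
  rewrite avgs_expand ?ordered_verts // setE; apply: eq_big => [omega|omega _].
    by apply/agree_offP => x; rewrite inE.
  by rewrite nu_overlay.
rewrite !exp /heat_bath; under eq_bigr do rewrite restr_overlay mulr_sumr.
rewrite exchange_big /=; apply: eq_bigr => zeta _.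
have flip omega : agree_off A omega zeta ->
    w omega * ising_weight e beta h A zeta = w zeta * ising_weight e beta h A omega.
  apply: ratio_of_flips => [om|om x ag xA]; first exact: ising_weight_gt0.
  have xT := fintype.subsetP A_int x xA.
  rewrite ising_weight_flip //; last exact: tree_edge_irr.
  rewrite (expR_local_field beta h sigma) // /w !overlay_fupd /node nu_flip //.
  - by rewrite mulrAC -!mulrA.
  - by rewrite ltnW // ltnS -mem_interior.
  by rewrite ltnS -mem_interior xT prodr_const card_ord -/(phi a lam b R0) R0_fix.
transitivity (\sum_(omega | agree_off A omega zeta)
   w zeta * F (overlay sigma zeta) * gibbs e beta h A zeta omega).
  rewrite [RHS]big_mkcond; apply: eq_bigr => omega _.
  rewrite (overlay_eq (tau := sigma)); last first.
    by move=> z no; rewrite overlay_out.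
  rewrite /gibbs; case: ifPn => ag; last by rewrite mul0r mulr0.
  rewrite agree_off_sym ag (partition_fun_agree ag).
  by rewrite !mulrA flip //; ring.
rewrite -mulr_sumr (eq_bigl (agree_off A zeta)); last by move=> omega; apply: agree_off_sym.
by rewrite gibbs_sum1 mulr1.
Qed.

Lemma nodes_cat k j : exists l, nodes b (k + j) = nodes b k ++ l /\
  all (fun x => k.+1 < @tlev b x)%N l.
Proof.
elim: j => [|j [l [el al]]]; first by exists [::]; rewrite addn0 cats0.
exists (l ++ map Some (words b (k + j).+1)); rewrite addnS nodesS el catA; split=> //.
rewrite all_cat al andTb; apply/allP => _ /mapP[u + ->]; rewrite mem_words => /eqP su.
by rewrite /= su !ltnS leq_addr.
Qed.

Lemma stationary M F sigma : (m < M)%N ->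
  avgs (@tpar b) p (nodes b M) (heat_bath F) sigma = avgs (@tpar b) p (nodes b M) F sigma.
Proof.
move=> /subnKC <-; have [l [-> al]] := nodes_cat m.+1 (M - m.+1).
by rewrite !avgs_cat avgs_heat_bath // stationary_ball.
Qed.

End HeatBath.

(** Uniqueness on a class stable under intersection; the finite family is listed as a sequence,
    padded by the zero measure, to form one measure [msum]. *)
Lemma mixture_unique d (T : measurableType d) (R : realType) (I : finType)
    (P : {measure set T -> \bar R}) (mu : I -> {measure set T -> \bar R})
    (G : set (set T)) :
  G `<=` measurable -> setI_closed G -> G setT -> (P setT < +oo)%E ->
  (forall B, G B -> P B = (\sum_i mu i B)%E) ->
  forall B, (<<s G>>) B -> P B = (\sum_i mu i B)%E.
Proof.
move=> Gm GI GT PT H B GB.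
pose s := map mu (index_enum I).
pose z : {measure set T -> \bar R} := mzero.
pose mk k : {measure set T -> \bar R} := nth z s k.
have mkE C : msum mk (size s) C = (\sum_i mu i C)%E.
  rewrite /msum -(big_mkord xpredT (fun k => mk k C)) /=.
  transitivity (\sum_(q <- s) q C)%E; first by rewrite (big_nth z).
  by rewrite big_map.
rewrite -mkE.
apply: (@g_sigma_algebra_measure_unique _ R T G Gm (fun=> setT)) => //.
- by apply/seteqP; split => // x _; exists 0%N.
- by move=> C GC; rewrite (H C GC) -mkE.
Qed.

(** * The DLR equations for the chain of a fixed point *)

Section DLR.
Variables (R : realType) (b : nat) (beta h : R).
Hypothesis beta_ge0 : 0 <= beta.
Let a := expR (2 * beta).
Let lam := expR (2 * beta * h).
Variable R0 : R.
Hypotheses (R0_gt0 : 0 < R0) (R0_fix : phi a lam b R0 = R0).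
Let p := tp a lam (fun _ : seq 'I_b => R0).

Let a_ge1 : 1 <= a. Proof. by rewrite /a -expR0 ler_expR mulr_ge0. Qed.

Lemma tp_const01 x s : 0 <= p x s <= 1.
Proof.
have lam0 : 0 < lam by apply: expR_gt0.
pose lo := Num.min R0 lam; pose hi := Num.max R0 lam.
have lo0 : 0 < lo by rewrite lt_min R0_gt0.
have bl : lo <= lam <= hi by rewrite ge_min le_max !lexx !orbT.
have br (u : seq 'I_b) : lo <= R0 <= hi by rewrite ge_min le_max !lexx.
have pm := pmin_gt0 a_ge1 lo0 bl.
have /andP[h1 h2] := tp_bnd a_ge1 lo0 bl br x s.
by rewrite (le_trans (ltW pm) h1) (le_trans h2) // gerBl ltW.
Qed.

Section Kernel.
Variables (m : nat) (A : {set tree_vertex b m}).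
Hypothesis A_int : A \subset tree_interior b m.
Notation vert := (tree_vertex b m).
Notation e := (@tree_edge b m).
Notation conf := {ffun vert -> bool}.
Let P := tree_prob tp_const01.

Definition cyl (omega : conf) : set (tree_config b) :=
  [set eta | restr m (ghost_ext eta) = omega].

Lemma cylE omega : cyl omega = event (fun sigma => restr m sigma == omega).
Proof. by apply/seteqP; split => eta; rewrite /cyl /event /= => /eqP. Qed.

Lemma depends_restr (T : eqType) (f : conf -> T) t :
  depends m.+1
    (fun sigma : option (seq 'I_b) -> bool => f (restr m sigma) == t).
Proof.
move=> sigma sigma' ss'; congr (f _ == t); apply/ffunP => x; rewrite !ffunE.
by apply: ss'; apply: size_bseq.
Qed.

Lemma measurable_cyl omega : measurable (cyl omega).
Proof. rewrite cylE; apply: (measurable_event (M := m.+1)); exact: (depends_restr id). Qed.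

Lemma ghost_ext_splice (omega : conf) (eta : tree_config b) :
  ghost_ext (splice omega eta) = overlay (ghost_ext eta) omega.
Proof. by apply/funext => -[u|] //=; rewrite /splice /overlay. Qed.

Lemma measurable_splice (omega : conf) : measurable_fun setT (@splice b m omega).
Proof.
have gen := @measurability _ _ (tree_config b) (tree_config b) setT (@splice b m omega)
  (@cylinders b) erefl.
apply: gen => // _ [_ [u [s ->]] <-]; rewrite setTI.
case: (pselect (exists x : vert, node x = Some u)) => [[x xu]|no].
  have E eta : splice omega eta u = omega x.
    by have := overlay_node (ghost_ext eta) omega x; rewrite -ghost_ext_splice xu.
  case: (eqVneq (omega x) s) => [xs|xs].
    have -> : splice omega @^-1` [set eta | eta u = s] = setT; last exact: measurableT.
    by apply/seteqP; split => // eta _ /=; rewrite E.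
  have -> : splice omega @^-1` [set eta | eta u = s] = set0; last exact: measurable0.
  by apply/seteqP; split => // eta /=; rewrite E => /eqP; rewrite (negPf xs).
have -> : splice omega @^-1` [set eta | eta u = s] = [set eta : tree_config b | eta u = s].
  have E eta : splice omega eta u = eta u.
    have := @overlay_out b m (ghost_ext eta) omega (Some u); rewrite -ghost_ext_splice; apply.
    by move=> x xu; apply: no; exists x.
  by apply/seteqP; split => eta /=; rewrite E.
exact: measurable_coord.
Qed.

Definition kerw (q : conf * conf) : {nonneg R} :=
  NngNum (gibbs_ge0 e beta h A q.1 q.2).

(** [q] pairs the configuration of the ball with its resampling. Summed over [q], these measures
    give the right side of the DLR equations as a finite mixture. Ending with [Defined] lets [kermE]
    hold by computation. *)
Definition kerm (q : conf * conf) : {measure set (tree_config b) -> \bar R}.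
Proof.
refine (mscale (kerw q) (pushforward (mrestr P (measurable_cyl q.1)) (splice q.2))).
exact: measurable_splice.
Defined.

Definition moved (q : conf * conf) (B : set (tree_config b)) : set (tree_config b) :=
  splice q.2 @^-1` B `&` cyl q.1.

Lemma kermE q B : kerm q B = ((gibbs e beta h A q.1 q.2)%:E * P (moved q B))%E.
Proof. by []. Qed.

Lemma measurable_moved q B : measurable B -> measurable (moved q B).
Proof.
move=> mB; apply: measurableI; last exact: measurable_cyl.
by rewrite -[X in measurable X]setTI; apply: measurable_splice.
Qed.

Lemma gibbs_mean_moved B eta :
  gibbs_mean e beta h A (tree_restrict m [::] eta)
    (fun sigma => \1_B (splice sigma eta)) =
  \sum_q gibbs e beta h A q.1 q.2 * \1_(moved q B) eta.
Proof.
have re : tree_restrict m [::] eta = restr m (ghost_ext eta).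
  by apply/ffunP => x; rewrite !ffunE cats0.
rewrite /gibbs_mean re.
rewrite -(pair_bigA _ (fun om om' => gibbs e beta h A om om' * \1_(moved (om, om') B) eta)) /=.
rewrite [RHS](bigD1 (restr m (ghost_ext eta))) //= [X in _ = _ + X]big1 ?addr0; last first.
  move=> om nom; apply: big1 => om' _; rewrite indicE memNset ?mulr0 //.
  by move=> [_ /= ecyl]; rewrite -ecyl eqxx in nom.
apply: eq_bigr => om' _; congr (_ * _); rewrite !indicE; congr (nat_of_bool _)%:R.
apply/idP/idP; rewrite !in_setE; first by move=> HB; split.
by case.
Qed.

Lemma integral_gibbs_mean B : measurable B ->
  (\int[P]_eta (gibbs_mean e beta h A (tree_restrict m [::] eta)
    (fun sigma => \1_B (splice sigma eta)))%:E)%E = (\sum_q kerm q B)%E.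
Proof.
move=> mB; under eq_integral do rewrite gibbs_mean_moved -sumEFin.
rewrite ge0_integral_sum //=; last 2 first.
- move=> q; apply/measurable_EFinP; apply: measurable_funM => //.
  by apply: measurable_indic; apply: measurable_moved.
- by move=> q eta _; rewrite lee_fin mulr_ge0 ?gibbs_ge0 // indicE ler0n.
apply: eq_bigr => q _; under eq_integral do rewrite EFinM.
rewrite ge0_integralZl_EFin //; last 2 first.
- by apply/measurable_EFinP; apply: measurable_indic; apply: measurable_moved.
- exact: gibbs_ge0.
by rewrite integral_indic ?setIT //; exact: measurable_moved.
Qed.

(** On an event of finite depth both sides are iterated averages, and the equation is [stationary]
    at a depth beyond that of the ball. *)
Lemma dlr_event (B : set (tree_config b)) : events B -> P B = (\sum_q kerm q B)%E.
Proof.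
move=> [M [F [dF eB]]]; pose M' := maxn M m.+1.
have dF' : depends M' F by apply: dependsS dF; apply: leq_maxl.
have mM' : (m < M')%N by rewrite /M' leq_max leqnn orbT.
pose Fq (q : conf * conf) sigma := (restr m sigma == q.1) && F (overlay sigma q.2).
have dFq q : depends M' (Fq q).
  move=> s s' ss'; congr andb.
    by apply: (depends_restr id) => u um; apply: ss'; apply: leq_trans um mM'.
  apply: dF' => u uM; rewrite /overlay; case: insub => //=; exact: ss'.
have movedE q : moved q B = event (Fq q).
  rewrite /moved eB; apply/seteqP; split => eta; rewrite /event /Fq /cyl /=.
    by rewrite ghost_ext_splice => -[-> ->]; rewrite eqxx.
  by rewrite ghost_ext_splice => /andP[/eqP -> ->].
rewrite {1}eB (tree_probE _ dF').
under eq_bigr do rewrite kermE movedE (tree_probE _ (dFq _)) -EFinM.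
rewrite sumEFin; congr EFin.
rewrite -(stationary beta_ge0 A_int R0_gt0 R0_fix (fun sigma => (F sigma)%:R) _ mM').
transitivity (avgs (@tpar b) p (nodes b M')
   (fun eta => \sum_q gibbs e beta h A q.1 q.2 * (Fq q eta)%:R) (fun=> true)).
  congr avgs; apply/funext => eta; rewrite /heat_bath.
  rewrite -(pair_bigA _ (fun om om' => gibbs e beta h A om om' * (Fq (om, om') eta)%:R)) /=.
  rewrite [RHS](bigD1 (restr m eta)) //= [X in _ = _ + X]big1 ?addr0; last first.
    move=> om nom; apply: big1 => om' _.
    by rewrite /Fq /= eq_sym (negPf nom) mulr0.
  by apply: eq_bigr => om' _; rewrite /Fq /= eqxx.
rewrite avgs_sum; apply: eq_bigr => q _; by rewrite avgsZ.
Qed.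

End Kernel.

Lemma tree_prob_gibbs : infinite_gibbs beta h (tree_prob tp_const01).
Proof.
move=> m A A_int B mB; rewrite integral_gibbs_mean //.
apply: (mixture_unique (G := @events b)).
- exact: events_measurable.
- exact: events_setI.
- exact: eventsT.
- by apply: le_lt_trans (ltry 1); rewrite -(@probability_setT _ _ _ (tree_prob tp_const01)).
- by move=> C; apply: dlr_event.
- exact: events_gen.
Qed.

(** This value is injective in [R0], so the spin at the root separates the measures of two fixed
    points. *)
Lemma tree_prob_root :
  tree_prob tp_const01 [set eta | eta [::] = true] = (R0 / (R0 + 1))%:E.
Proof.
pose F (sigma : option (seq 'I_b) -> bool) := sigma (Some [::]).
have dF : depends 0 F by move=> s s' ss'; apply: ss'.
have -> : [set eta | eta [::] = true] = event F by [].
rewrite (tree_probE _ dF) /=; congr EFin.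
by rewrite /avg /prob /F /= mulr1 mulr0 addr0 !mul1r.
Qed.

End DLR.

Lemma nonunique_of_lim (R : realType) (b : nat) (beta h : R) : 0 <= beta ->
  let a := expR (2 * beta) in let lam := expR (2 * beta * h) in
  lo_lim a lam b != hi_lim a lam b -> gibbs_nonunique b beta h.
Proof.
move=> beta0 a lam neq.
have a1 : 1 <= a by rewrite /a -expR0 ler_expR mulr_ge0.
have lam0 : 0 < lam by apply: expR_gt0.
have lo0 := lo_lim_gt0 a1 b lam0; have hi0 := hi_lim_gt0 a1 b lam0.
exists (tree_prob (tp_const01 h beta0 lo0)), (tree_prob (tp_const01 h beta0 hi0)).
split.
- exact: tree_prob_gibbs (phi_lo_lim a1 b lam0).
- exact: tree_prob_gibbs (phi_hi_lim a1 b lam0).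
exists [set eta | eta [::] = true]; first exact: measurable_coord.
rewrite !tree_prob_root => -[e]; case/eqP: neq.
have lo1 := lt0r_neq0 (addr_gt0 lo0 ltr01); have hi1 := lt0r_neq0 (addr_gt0 hi0 ltr01).
move/eqP: e; rewrite eqr_div // => /eqP.
by rewrite !mulrDr !mulr1 mulrC => /addrI.
Qed.

(** * The three cases *)

Section Cases.
Variables (R : realType) (b : nat) (beta h : R) (tau : vertex b -> bool).
Hypotheses (b_gt1 : (1 < b)%N) (beta_ge0 : 0 <= beta).
Let a := expR (2 * beta).
Let lam := expR (2 * beta * h).

Let a_ge1 : 1 <= a. Proof. by rewrite /a -expR0 ler_expR mulr_ge0. Qed.
Let lam_gt0 : 0 < lam. Proof. exact: expR_gt0. Qed.
Let b_gt0 : (0 < b)%N. Proof. exact: ltnW. Qed.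

Definition gap_bounded : Prop := exists C : R, 0 < C /\
  forall (r : vertex b) (m : nat), 1 / C <= tree_gap beta h tau r m.

Lemma gap_of_gam : b%:R * gam a ^+ 2 < 1 -> gap_bounded.
Proof.
move=> small; apply: (@tree_gap_uniform R b beta h b_gt0 beta_ge0 tau (gam a) 0).
- exact: gam_ge0.
- by rewrite -mulrA -expr2.
move=> r k u _; apply: influ_le_gam => //.
have /andP[lo_rat _] := cavity_bounds h beta_ge0 (fun w => tau (w ++ r)) k u.
exact: lt_le_trans (lo_gt0 a_ge1 b lam_gt0 k) lo_rat.
Qed.

Lemma gap_of_lim (l : R ^nat) : (forall k, 0 < l k) ->
  l @ \oo --> hi_lim a lam b ->
  (forall r k u, l k <= cavity beta h (fun w => tau (w ++ r)) k u) ->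
  gap_bounded.
Proof.
move=> l0 lcvg lrat; have g0 := gam_ge0 a_ge1; have g1 := gam_lt1 a_ge1.
have b0 : 0 < b%:R :> R by rewrite ltr0n.
have g10 : 0 < 1 + gam a by rewrite ltr_pwDl.
(* Chosen so that [b%:R * kap] exceeds 1 while its product with [gam a] is
   [2 * gam a / (1 + gam a)], below 1. *)
pose kap := 2 / (b%:R * (1 + gam a)).
have bkap : b%:R * kap = 2 / (1 + gam a).
  by rewrite /kap; field; rewrite !gt_eqF.
have bkap1 : 1 < b%:R * kap by rewrite bkap ltr_pdivlMr // mul1r; lra.
have [M HM] := influ_eventually a_ge1 lam_gt0 b_gt0 bkap1 l0 lcvg.
apply: (@tree_gap_uniform R b beta h b_gt0 beta_ge0 tau kap M).
- by rewrite divr_ge0 // mulr_ge0 // ltW.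
- by rewrite bkap mulrAC ltr_pdivrMr // mul1r; lra.
move=> r k u Mk; apply: HM Mk _; rewrite lrat /=.
by have /andP[_] := cavity_bounds h beta_ge0 (fun w => tau (w ++ r)) k u.
Qed.

(** [beta1] is the value at which tanh beta equals the inverse square root of [b]. *)
Lemma gam_beta1 : beta < beta1 R b -> b%:R * gam a ^+ 2 < 1.
Proof.
set s := Num.sqrt (b%:R : R).
have s2 : s ^+ 2 = b%:R by rewrite sqr_sqrtr.
have s1 : 1 < s by rewrite -[ltLHS]sqrtr1 ltr_sqrt ?ltr1n // ltr0n.
rewrite /beta1 -/s => lt_beta.
have x0 : 0 < (s + 1) / (s - 1) by rewrite divr_gt0 ?subr_gt0 // addr_gt0 // (lt_trans ltr01).
have : a < (s + 1) / (s - 1).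
  rewrite /a -[ltRHS](lnK (x := (s + 1) / (s - 1))) ?posrE // ltr_expR; lra.
rewrite ltr_pdivlMr ?subr_gt0 // => lt_a.
have g0 := gam_ge0 a_ge1.
have a1 : 0 < a + 1 by rewrite (lt_le_trans ltr01) // lerDr (le_trans ler01).
have gs : s * gam a < 1 by rewrite /gam mulrA ltr_pdivrMr // mul1r; lra.
by rewrite -s2 -exprMn exprn_ilt1 // mulr_ge0 // ltW // (lt_trans ltr01).
Qed.

(** Covers the range where [critical_field] is 0 by definition and so says nothing on Gibbs
    measures: there [b%:R * gam a <= 1], and [gam a < 1]. *)
Lemma gam_beta0 : beta <= beta0 R b -> b%:R * gam a ^+ 2 < 1.
Proof.
rewrite /beta0 => le_beta; have b1 : 1 < b%:R :> R by rewrite ltr1n.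
have x0 : 0 < (b%:R + 1) / (b%:R - 1) :> R.
  by rewrite divr_gt0 ?subr_gt0 // addr_gt0 // (lt_trans ltr01).
have : a <= (b%:R + 1) / (b%:R - 1).
  rewrite /a -[leRHS](lnK (x := (b%:R + 1) / (b%:R - 1))) ?posrE // ler_expR; lra.
rewrite ler_pdivlMr ?subr_gt0 // => le_a.
have g0 := gam_ge0 a_ge1.
have a1 : 0 < a + 1 by rewrite (lt_le_trans ltr01) // lerDr (le_trans ler01).
have gb : b%:R * gam a <= 1 by rewrite /gam mulrA ler_pdivrMr // mul1r; lra.
apply: le_lt_trans (gam_lt1 a_ge1).
by rewrite expr2 mulrA ler_piMl.
Qed.

Lemma gap_of_unique : ~ gibbs_nonunique b beta h -> gap_bounded.
Proof.
move=> uniq; apply: (gap_of_lim (l := lo a lam b)) => [k||r k u].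
- exact: lo_gt0.
- suff <- : lo_lim a lam b = hi_lim a lam b by apply: lo_cvg.
  by apply/eqP; apply: contra_notT uniq => /nonunique_of_lim; apply.
by have /andP[] := cavity_bounds h beta_ge0 (fun w => tau (w ++ r)) k u.
Qed.

Lemma gap_of_field : (critical_field b beta < (`|h|)%:E)%E -> gap_bounded.
Proof.
rewrite /critical_field; case: ifPn => [/gam_beta0/gap_of_gam //|_ lt_h].
apply: gap_of_unique => nonuniq.
have := ereal_sup_ubound (_ : [set (`|x|)%:E | x in gibbs_nonunique b beta] (`|h|)%:E).
move=> /(_ (ex_intro2 _ _ h nonuniq erefl)).
by rewrite leNgt lt_h.
Qed.

(** Under + every ratio equals [hi k], so only the upper limit matters and the Gibbs measure may be
    non-unique. *)
Lemma gap_of_plus : (forall x, tau x = true) -> gap_bounded.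
Proof.
move=> plus; have tauE r : (fun w => tau (w ++ r)) = fun=> true by apply/funext.
apply: (gap_of_lim (l := hi a lam b)) => [k||r k u].
- exact: hi_gt0.
- exact: hi_cvg.
by rewrite tauE cavity_plus.
Qed.

End Cases.

Theorem theorem1p1 (R : realType) (b : nat) (beta h : R)
    (tau : vertex b -> bool) :
  (2 <= b)%N -> 0 <= beta ->
  (beta < beta1 R b \/ (critical_field b beta < (`|h|)%:E)%E)
    \/ (forall x : vertex b, tau x = true) ->
  exists C : R, 0 < C /\
    forall (r : vertex b) (m : nat), 1 / C <= tree_gap beta h tau r m.
Proof.
move=> b2 beta0 [[lt_beta|lt_h]|plus].
- by apply: gap_of_gam => //; apply: gam_beta1.
- exact: gap_of_field.
- exact: gap_of_plus.
Qed.
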